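(* Let $N\ge2$, $l=x_0<x_1<\cdots<x_N=L$, $\Omega_i=(x_{i-1},x_i)\times(0,\pi)$, and let $h_{\min}=\min_{1\le i\le N}(x_i-x_{i-1})$ be the minimum subdomain width. Let $g_i^k$ ($1\le i\le N-1$, $k\ge0$) be the interface errors generated from initial guesses $g_1^0,\dots,g_{N-1}^0$ by the Neumann--Neumann waveform relaxation (NNWR) iteration for the two-dimensional heat equation (error equations) on $\Omega=(l,L)\times(0,\pi)$ with subdomains $\Omega_i$. Let $\theta=1/4$. For $T>0$ fixed, for $k=1,2,3,\ldots$, $$\max_{1\le i\le N-1}\|g_i^k\|_{L^\infty(0,T;L^2(0,\pi))}\le\left(\frac{\sqrt6}{1-e^{-\frac{(2k+1)h_{\min}^2}{T}}}\right)^{2k}e^{-k^2h_{\min}^2/T}\max_{1\le i\le N-1}\|g_i^0\|_{L^\infty(0,T;L^2(0,\pi))}.$$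
   Context: NNWR iteration in 2D (error equations, heat equation $\partial_t u=\Delta u$ on $\Omega=(l,L)\times(0,\pi)$, $t\in(0,T]$, zero source, zero initial data, homogeneous Dirichlet data on $\partial\Omega$). Given initial guesses $g_i^0(y,t)$ on the interfaces $\{x_i\}\times(0,\pi)$, $1\le i\le N-1$, with $g_0^k=g_N^k=0$ for all $k$, and a relaxation parameter $\theta\in(0,1]$, for $k=1,2,\ldots$: Dirichlet step, for $i=1,\dots,N$: $$\partial_t u_i^k-\Delta u_i^k=0\text{ in }\Omega_i,\quad u_i^k(x,y,0)=0,\quad u_i^k(x_{i-1},y,t)=g_{i-1}^{k-1}(y,t),\quad u_i^k(x_i,y,t)=g_i^{k-1}(y,t),$$ $$u_i^k(x,0,t)=u_i^k(x,\pi,t)=0.$$ Neumann step, for $i=1,\dots,N$: $$\partial_t\psi_i^k-\Delta\psi_i^k=0\text{ in }\Omega_i,\quad\psi_i^k(x,y,0)=0,\quad \psi_i^k(x,0,t)=\psi_i^k(x,\pi,t)=0,$$ $$\partial_{n_i}\psi_i^k(x_{i-1},y,t)=(\partial_{n_{i-1}}u_{i-1}^k+\partial_{n_i}u_i^k)(x_{i-1},y,t),\qquad \partial_{n_i}\psi_i^k(x_i,y,t)=(\partial_{n_i}u_i^k+\partial_{n_{i+1}}u_{i+1}^k)(x_i,y,t),$$ where $\partial_{n_i}$ is the derivative in the direction of the unit outward normal of $\Omega_i$ (so $\partial_{n_i}=-\partial_x$ at $x_{i-1}$ and $\partial_{n_i}=\partial_x$ at $x_i$), except that on the physical boundary the Neumann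 conditions are replaced by homogeneous Dirichlet conditions: $\psi_1^k=0$ at $x=l$ and $\psi_N^k=0$ at $x=L$. Update: $g_i^k(y,t)=g_i^{k-1}(y,t)-\theta\left(\psi_i^k(x_i,y,t)+\psi_{i+1}^k(x_i,y,t)\right)$, $1\le i\le N-1$. The subdomain problems are understood through the Fourier sine series in $y$ and the Laplace transform in time: writing $u(x,y,t)=\sum_{n\ge1}U(x,n,t)\sin(ny)$ with $U(x,n,t)=\frac2\pi\int_0^\pi u(x,\eta,t)\sin(n\eta)\,d\eta$, each coefficient satisfies the one-dimensional problem $\partial_t U-\partial_{xx}U+n^2U=0$ with the corresponding boundary/interface conditions, solved via the Laplace transform in $t$; data given only on $(0,T)$ are extended by zero in time (the values of $g_i^k$ for $t\in(0,T)$ depend only on the initial guesses for $t\in(0,T)$). The exact error solution is zero, so the $g_i^k$ are the interface errors. *)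

(* Defs.v *)
From mathcomp Require Export all_boot all_order all_algebra.
From mathcomp Require Export all_classical all_reals all_analysis.

Set Implicit Arguments.
Unset Strict Implicit.
Unset Printing Implicit Defensive.

Import Order.TTheory GRing.Theory Num.Theory.
Import numFieldNormedType.Exports.

Local Open Scope classical_set_scope.
Local Open Scope ring_scope.

Section Norms.
Context {R : realType}.
Local Notation mu := (@lebesgue_measure R).
Implicit Types (v : R -> R) (f : R -> R -> R) (T : R).

Definition L2norm v : \bar R := 'N[mu]_2%:E[EFin \o (v \_ `]0, pi[)].

(* The first argument of [f] is y, the second one is t. *)
Definition LinfL2norm T f : \bar R :=
  'N[mu]_+oo%E[(fun t => L2norm (f ^~ t)) \_ `]0, T[].

Definition in_LinfL2 T f : Prop :=
  measurable_fun ((`]0, pi[ : set R) `*` (`]0, T[ : set R))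
    (fun p : R * R => f p.1 p.2) /\
  (LinfL2norm T f < +oo)%E.

End Norms.

Section Transforms.
Context {R : realType}.
Local Notation mu := (@lebesgue_measure R).

Definition sin_coef (v : R -> R) (n : nat) : R :=
  2 / pi * \int[mu]_(y in `]0, pi[) (v y * sin (n%:R * y)).

Definition laplace (w : R -> R) (s : R) : R :=
  \int[mu]_(t in `]0, +oo[) (expR (- (s * t)) * w t).

Definition laplace_integrable (w : R -> R) (s : R) : Prop :=
  mu.-integrable `]0, +oo[ (fun t => (expR (- (s * t)) * w t)%:E).

(* U(x,n,t) and its Laplace transform in t, for u = u(x,y,t). *)
Definition mode (u : R -> R -> R -> R) (n : nat) (x t : R) : R :=
  sin_coef (fun y => u x y t) n.

Definition mode_laplace (u : R -> R -> R -> R) (n : nat) (s x : R) : R :=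
  laplace (mode u n x) s.

End Transforms.

Section Heat.
Context {R : realType}.
Local Notation mu := (@lebesgue_measure R).

(* [W] is a solution on ]a, b[ x ]0, +oo[ of the equation
   W_t - W_xx + n^2 W = 0 with W = 0 at t = 0, to which the Laplace transform
   in t is applicable: it is of exponential order, locally uniformly in x.
   For boundary data that are merely bounded in t, W(x, .) has no pointwise
   limit as x tends to a or b; the values W(a, .) and W(b, .) are the boundary
   values of W in the sense that the Laplace transform of W(x, .) is continuous
   up to x = a and x = b. *)
Record mode_solution (a b : R) (n : nat) (W : R -> R -> R) : Prop := {
  mode_derivable : forall x t, a < x < b -> 0 < t ->
    [/\ derivable (W x) t 1, derivable (W ^~ t) x 1
      & derivable (derive1 (W ^~ t)) x 1] ;
  mode_continuous : forall x t, a < x < b -> 0 < t ->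
    {for (x, t), continuous (fun p : R * R => derive1 (W p.1) p.2)} /\
    {for (x, t), continuous (fun p : R * R => derive1n 2 (W ^~ p.2) p.1)} ;
  mode_equation : forall x t, a < x < b -> 0 < t ->
    derive1 (W x) t - derive1n 2 (W ^~ t) x + n%:R ^+ 2 * W x t = 0 ;
  mode_initial : forall x, a < x < b ->
    W x 0 = 0 /\ W x t @[t --> 0^'+] --> (0 : R) ;
  mode_exp_order : exists sigma : R, forall c d, a < c -> d < b ->
    exists M : R, forall x t, c <= x <= d -> 0 < t ->
    [/\ `|W x t| <= M * expR (sigma * t),
        `|derive1 (W x) t| <= M * expR (sigma * t)
      & `|derive1 (W ^~ t) x| <= M * expR (sigma * t)] ;
  mode_boundary : \forall s \near +oo,
    (forall x, a <= x <= b -> laplace_integrable (W x) s) /\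
    {within `[a, b], continuous (fun x => laplace (W x) s)}
}.

(* The problem u_t - Laplacian u = 0 on ]a, b[ x ]0, pi[ with zero initial
   value and zero lateral values at y = 0 and y = pi, understood through the
   sine series of u in y (which converges to u in L^2(0, pi) since
   u(x, ., t) is in that space). *)
Record heat_solution (a b : R) (u : R -> R -> R -> R) : Prop := {
  heat_measurable : forall x, a <= x <= b ->
    measurable_fun ((`]0, pi[ : set R) `*` (`]0, +oo[ : set R))
      (fun p : R * R => u x p.1 p.2) ;
  heat_L2 : forall x, a <= x <= b ->
    {ae mu, forall t, 0 < t -> (L2norm (fun y => u x y t) < +oo)%E} ;
  heat_initial : forall x y, a < x < b -> 0 < y < pi -> u x y 0 = 0 ;
  heat_lateral : forall x t, a < x < b -> 0 < t -> u x 0 t = 0 /\ u x pi t = 0 ;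
  heat_mode : forall n, (0 < n)%N -> mode_solution a b n (mode u n)
}.

(* [d] is the derivative of [w] at the endpoint [x] of an interval in the
   outward direction [nu] (1 at a right endpoint, -1 at a left endpoint); only
   values of [w] on the interval are used. *)
Definition is_normal_derive (w : R -> R) (x nu d : R) : Prop :=
  (w x - w (x - h * nu)) / h @[h --> 0^'+] --> d.

End Heat.

Section NNWR.
Context {R : realType}.

Definition on_interface (f g : R -> R -> R) : Prop :=
  forall y t, 0 < y < pi -> 0 < t -> f y t = g y t.

(* The i-th subdomain is ]x (i - 1), x i[ x ]0, pi[ for 1 <= i <= N. *)
Definition dirichlet_step (N : nat) (x : nat -> R) (g : nat -> R -> R -> R)
    (u : nat -> R -> R -> R -> R) : Prop :=
  forall i, (1 <= i <= N)%N ->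
  [/\ heat_solution (x i.-1) (x i) (u i),
      on_interface (u i (x i.-1)) (g i.-1)
    & on_interface (u i (x i)) (g i)].

(* The two flux conditions at each interface x i: for bounded data the normal
   derivatives exist only mode by mode and after Laplace transform in t. *)
Definition neumann_step (N : nat) (x : nat -> R)
    (u psi : nat -> R -> R -> R -> R) : Prop :=
  [/\ forall i, (1 <= i <= N)%N -> heat_solution (x i.-1) (x i) (psi i),
      forall i n, (1 <= i < N)%N -> (0 < n)%N -> \forall s \near +oo,
        exists dl dr : R,
        [/\ is_normal_derive (mode_laplace (u i) n s) (x i) 1 dl,
            is_normal_derive (mode_laplace (u i.+1) n s) (x i) (-1) dr,
            is_normal_derive (mode_laplace (psi i) n s) (x i) 1 (dl + dr)
          & is_normal_derive (mode_laplace (psi i.+1) n s) (x i) (-1) (dl + dr)],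
      on_interface (psi 1%N (x 0%N)) (fun _ _ => 0)
    & on_interface (psi N (x N)) (fun _ _ => 0)].

Definition update_step (theta : R) (N : nat) (x : nat -> R)
    (psi : nat -> R -> R -> R -> R) (g g' : nat -> R -> R -> R) : Prop :=
  forall i, (1 <= i < N)%N -> on_interface (g' i)
    (fun y t => g i y t - theta * (psi i (x i) y t + psi i.+1 (x i) y t)).

(* [g k i y t] is the interface error g_i^k(y, t); the initial guesses are data
   on ]0, T[ extended by zero, and the iteration is run on ]0, +oo[. *)
Record nnwr (theta : R) (N : nat) (x : nat -> R) (T : R)
    (u psi : nat -> nat -> R -> R -> R -> R)
    (g : nat -> nat -> R -> R -> R) : Prop := {
  nnwr_guess : forall i, (1 <= i < N)%N -> in_LinfL2 T (g 0%N i) ;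
  nnwr_extend : forall i y t, (1 <= i < N)%N -> T <= t -> g 0%N i y t = 0 ;
  nnwr_physical : forall k y t, g k 0%N y t = 0 /\ g k N y t = 0 ;
  nnwr_dirichlet : forall k, dirichlet_step N x (g k) (u k.+1) ;
  nnwr_neumann : forall k, neumann_step N x (u k.+1) (psi k.+1) ;
  nnwr_update : forall k, update_step theta N x (psi k.+1) (g k) (g k.+1)
}.

Definition hmin (N : nat) (x : nat -> R) : R :=
  \big[Num.min/x 1%N - x 0%N]_(1 <= i < N.+1) (x i - x i.-1).

Definition max_norm (N : nat) (T : R) (g : nat -> R -> R -> R) : \bar R :=
  \big[maxe/-oo%E]_(1 <= i < N) LinfL2norm T (g i).

End NNWR.

(* Main.v *)
(* After sine series in [y] and Laplace transform in [t], each mode satisfies a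
   linear ODE in [x] with exponential solutions, so that a step of the iteration
   acts on the interface modes by a matrix whose entries are built from
   [coth (h_i sigma)], [1 / sinh (h_i sigma)], [sigma = sqrt (s + n ^ 2)]. For
   [theta = 1 / 4] the constant terms cancel and all remaining entries are of
   order [exp (- 2 h_min sigma)]. They are transforms of signed sums of heat
   kernels damped by [exp (- n ^ 2 t)]; hence, for any [s > 0], the step contracts
   the norm [sup_t exp (- s t) ||g(t)||_(L^2)] by
   [(4 + c E) E ^ 2 / (1 - E ^ 2) ^ 2], [E = exp (- h_min sqrt s)]. Iterating [k]
   times costs [exp (s T)] when the weight is removed, and optimizing over [s] (as
   in a Chernoff bound) gives the factor of the theorem. Here [c = 4] in general,
   and [c = 2] if [T <= 4 h_min ^ 2], where differences of kernels are smaller than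
   their sums; only in that range does the optimization need the smaller value. *)
Require Import Defs.
From mathcomp Require Import measurable_realfun gauss_integral ess_sup_inf.
From mathcomp Require Import lebesgue_integral_under exponential_distribution.
From mathcomp Require Import ring lra.

Set Implicit Arguments.
Unset Strict Implicit.
Unset Printing Implicit Defensive.

Import Order.TTheory GRing.Theory Num.Theory.
Import numFieldNormedType.Exports.

Local Open Scope classical_set_scope.
Local Open Scope ring_scope.

(** * Convolution and uniqueness for the Laplace transform *)

Section Convolution.
Context {R : realType}.
Local Notation mu := (@lebesgue_measure R).

(** The interface data are merely bounded and measurable, so one step of the iteration is available
    only as an identity between transforms, mode by mode and for large [s]. The estimates live on
    the time side. The passage back is Lerch's uniqueness theorem: a bound is proved for some
    functions with the right transforms ([l2_bounded]) and then holds almost everywhere for the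
    actual modes. The weight [exp (- s t)] makes iteration cheap: in the weighted norm, convolution
    with a nonnegative kernel costs at most the transform of the kernel at [s], an explicit function
    of [E], so no iterated kernel is ever estimated. Convolutions are causal, hence bounds on []0,
    T[] reproduce themselves. Sums over modes are truncated at [m], with estimates uniform in [m];
    Bessel's inequality suffices for the initial guesses, and completeness of the sines is needed
    only for the last iterate. In the optimization, the 6 of the theorem has to absorb [4 + c E]
    together with the loss caused by a weight that differs from the ideal one. *)

Lemma lebesgue_measure_shift (a : R) (A : set R) : measurable A ->
  pushforward mu ((fun x => x - a) : _ -> measurableTypeR R) A = mu A.
Proof.
move=> mA; apply/esym.
have ms : measurable_fun setT ((fun x => x - a) : measurableTypeR R -> measurableTypeR R).
  exact: measurable_funB.
apply: (@lebesgue_measure_unique _ (measure_function_pushforward__canonical__measure_function_Measure mu ms)) => //= _ [[c b]] _ <-.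
rewrite /pushforward.
rewrite (_ : _ @^-1` _ = `]c + a, b + a]%classic); last first.
  by apply/seteqP; split => x /=; rewrite !in_itv/= ltrBrDr lerBlDr.
by rewrite !lebesgue_measure_itv/= !lte_fin ltrD2r -!EFinB opprD addrACA subrr addr0.
Qed.

Lemma ge0_integral_shift (a : R) (f : R -> \bar R) : measurable_fun setT f ->
  (forall x, 0 <= f x)%E -> (\int[mu]_x f (x - a)%R = \int[mu]_x f x)%E.
Proof.
move=> mf f0.
have ms : measurable_fun setT ((fun x => x - a) : measurableTypeR R -> measurableTypeR R).
  exact: measurable_funB.
have := ge0_integral_pushforward ms mu measurableT mf (fun x _ => f0 x).
rewrite preimage_setT => <-.
by apply: eq_measure_integral => A mA _; apply: lebesgue_measure_shift.
Qed.

Lemma Rintegral_shift (a : R) (f : R -> R) : mu.-integrable setT (EFin \o f) ->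
  mu.-integrable setT (fun x => (f (x - a))%:E) /\
  \int[mu]_x f (x - a) = \int[mu]_x f x.
Proof.
move=> fi.
have mf : measurable_fun setT f by case/integrableP : fi => /measurable_EFinP.
have ms : measurable_fun setT ((fun x => x - a) : measurableTypeR R -> measurableTypeR R).
  exact: measurable_funB.
split.
  apply/integrableP; split; first by apply/measurable_EFinP; exact: measurableT_comp.
  rewrite (@ge0_integral_shift a (fun x => `|(f x)%:E|%E))//; last exact/measurableT_comp/measurable_EFinP.
  by case/integrableP : fi.
rewrite /Rintegral integralE [in RHS]integralE; congr (fine (_ - _)).
  rewrite (_ : (fun x => (f (x - a))%:E) = (fun x => (EFin \o f) (x - a)))//.
  rewrite -(@ge0_integral_shift a (fun x => ((EFin \o f)^\+ x)%E))//; last first.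
    exact/measurable_funepos/measurable_EFinP.
  by apply: eq_integral => x _; rewrite /= !funeposE.
rewrite -(@ge0_integral_shift a (fun x => ((EFin \o f)^\- x)%E))//; last first.
  exact/measurable_funeneg/measurable_EFinP.
by apply: eq_integral => x _; rewrite /= !funenegE.
Qed.

Lemma integral_convolution (f g : R -> R) :
  mu.-integrable setT (EFin \o f) -> mu.-integrable setT (EFin \o g) ->
  mu.-integrable setT (fun t : R => (\int[mu]_r (f r * g (t - r)))%:E) /\
  \int[mu]_t \int[mu]_r (f r * g (t - r)) =
  (\int[mu]_t f t) * (\int[mu]_t g t).
Proof.
move=> fi gi.
have mf : measurable_fun setT f by case/integrableP : fi => /measurable_EFinP.
have mg : measurable_fun setT g by case/integrableP : gi => /measurable_EFinP.
pose F (p : R * R) := (f p.2 * g (p.1 - p.2))%:E.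
have mF : measurable_fun setT F.
  apply/measurable_EFinP; apply: measurable_funM.
    exact: measurableT_comp mf measurable_snd.
  apply: measurableT_comp mg _.
  exact: measurable_funB measurable_fst measurable_snd.
have Fi : (mu \x mu)%E.-integrable setT F.
  apply/integrable21ltyP => //.
  under eq_integral => r _.
    rewrite /F /=; under eq_integral => t _ do rewrite normrM EFinM.
    rewrite integralZl//; last first.
      by have [] := Rintegral_shift r (integrable_norm gi).
    rewrite (@ge0_integral_shift r (fun x => `|g x|%:E))//; last first.
      by apply/measurable_EFinP; exact: measurableT_comp.
    over.
  have gn : (\int[mu]_x `|g x|%:E)%E \is a fin_num.
    by apply: integrable_fin_num => //; exact: integrable_norm.
  rewrite -(fineK gn).
  rewrite integralZr//; last exact: integrable_norm.
  have fn : (\int[mu]_x `|f x|%:E)%E \is a fin_num.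
    by apply: integrable_fin_num => //; exact: integrable_norm.
  by rewrite -(fineK fn) -EFinM ltry.
have Gi := integrable_fubini_F Fi.
have aG := integrable_ae measurableT Gi.
have eqG : ae_eq mu setT (fubini_F mu F) (fun t => (\int[mu]_r (f r * g (t - r)))%:E).
  by apply: filterS aG => t /(_ I) tf _; rewrite /Rintegral fineK.
have mFF : measurable_fun setT (fubini_F mu F) := measurable_int _ Gi.
have mG : measurable_fun setT (fun t : R => (\int[mu]_r (f r * g (t - r)))%:E).
  apply/measurable_EFinP.
  exact: (measurableT_comp (@fine_measurable R setT measurableT) mFF).
(* [fine] sends an infinite inner integral to 0, so the real-valued convolution stays below
   [fubini_F] in absolute value also on the null set where the inner integral is infinite. *)
have hi : mu.-integrable setT (fun t : R => (\int[mu]_r (f r * g (t - r)))%:E).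
  apply: le_integrable Gi => // t _; rewrite /Rintegral /fubini_F /F /=.
  by case: (\int[mu]_x _)%E => //= [|]; rewrite ?normr0 leey.
split => //.
have e : (\int[mu]_t fubini_F mu F t = \int[mu]_t (\int[mu]_r (f r * g (t - r)))%:E)%E.
  exact: ae_eq_integral.
rewrite {1}/Rintegral -e.
rewrite (integral12_prod_meas1 Fi) -(integral21_prod_meas1 Fi).
rewrite (_ : (\int[mu]_r fubini_G mu F r = \int[mu]_r ((f r)%:E * (\int[mu]_t g t)%:E))%E); last first.
  apply: eq_integral => r _; rewrite /fubini_G /F /=.
  under eq_integral => t _ do rewrite EFinM.
  have [gri gre] := Rintegral_shift r gi.
  rewrite integralZl//; congr (_ * _)%E.
  by rewrite -gre /Rintegral fineK//; exact: integrable_fin_num.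
rewrite integralZr// fineM//; exact: integrable_fin_num.
Qed.
End Convolution.

Section Lerch.
Context {R : realType}.
Local Notation mu := (@lebesgue_measure R).
Local Notation Rp := (`]0%R, +oo[%classic : set R).

Lemma eqR_integrable (D : set R) (f g : R -> \bar R) : measurable D ->
  (forall x, D x -> f x = g x) -> mu.-integrable D f -> mu.-integrable D g.
Proof.
move=> mD fg; apply: eq_integrable => // x; rewrite inE; exact: fg.
Qed.

Lemma ae_imply (P Q : R -> Prop) : (forall x, P x -> Q x) ->
  {ae mu, forall x, P x} -> {ae mu, forall x, Q x}.
Proof. by move=> PQ; apply: negligibleS => x /= nq p; apply: nq; exact: PQ. Qed.

Lemma ae_and (P Q : R -> Prop) : {ae mu, forall x, P x} -> {ae mu, forall x, Q x} ->
  {ae mu, forall x, P x /\ Q x}.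
Proof.
move=> nP nQ; apply: (negligibleS _ (negligibleU nP nQ)) => x /= /not_andP.
by case; [left|right].
Qed.

Lemma integrableRZl (D : set R) (k : R) (f : R -> R) : measurable D ->
  mu.-integrable D (fun x => (f x)%:E) -> mu.-integrable D (fun x => (k * f x)%:E).
Proof. by move=> mD fi; exact: (@integrableZl _ _ R mu D mD k (fun x => (f x)%:E) fi). Qed.

Lemma integrableRD (D : set R) (f g : R -> R) : measurable D ->
  mu.-integrable D (fun x => (f x)%:E) -> mu.-integrable D (fun x => (g x)%:E) ->
  mu.-integrable D (fun x => (f x + g x)%:E).
Proof.
move=> mD fi gi.
exact: (@integrableD _ _ R mu D mD (fun x => (f x)%:E) (fun x => (g x)%:E) fi gi).
Qed.

Lemma integrableRB (D : set R) (f g : R -> R) : measurable D ->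
  mu.-integrable D (fun x => (f x)%:E) -> mu.-integrable D (fun x => (g x)%:E) ->
  mu.-integrable D (fun x => (f x - g x)%:E).
Proof.
move=> mD fi gi.
exact: (@integrableB _ _ R mu D mD (fun x => (f x)%:E) (fun x => (g x)%:E) fi gi).
Qed.

Lemma dominated_cvg_Rintegral (D : set R) (f_ : nat -> R -> R) (f g : R -> R) :
  measurable D -> (forall n, measurable_fun D (f_ n)) -> measurable_fun D f ->
  {ae mu, forall x, D x -> f_ n x @[n --> \oo] --> f x} ->
  mu.-integrable D (EFin \o g) -> (forall n x, D x -> `|f_ n x| <= g x) ->
  mu.-integrable D (EFin \o f) /\
  \int[mu]_(x in D) f_ n x @[n --> \oo] --> \int[mu]_(x in D) f x.
Proof.
move=> mD mf_ mf fcv gi fg.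
have fcv' : {ae mu, forall x, D x -> (EFin \o f_ n) x @[n --> \oo] --> (EFin \o f) x}.
  apply: ae_imply fcv => x h Dx; apply: cvg_EFin; first exact: nearW.
  exact: h.
have fg' : {ae mu, forall x n, D x -> (`|(EFin \o f_ n) x| <= (EFin \o g) x)%E}.
  by apply: aeW => x n Dx; rewrite lee_fin fg.
have [fi _ cv] := @dominated_convergence _ _ R mu D mD (fun n => EFin \o f_ n) (EFin \o f) (EFin \o g)
  (fun n => (measurable_EFinP _ _).2 (mf_ n)) ((measurable_EFinP _ _).2 mf) fcv' gi fg'.
split => //; apply: (fine_cvg (f := fun n => \int[mu]_(x in D) (f_ n x)%:E)%E).
by rewrite /Rintegral fineK; [exact: cv|exact: integrable_fin_num].
Qed.

Lemma near_pinfty_ge (P : R -> Prop) : (\forall s \near +oo, P s) ->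
  exists2 s0 : R, 0 < s0 & forall s, s0 <= s -> P s.
Proof.
move=> [M [_ HM]]; exists (Num.max M 0 + 1).
  by rewrite ltr_wpDl// le_max lexx orbT.
move=> s ls; apply: HM; apply: lt_le_trans ls.
by rewrite (@le_lt_trans _ _ (Num.max M 0))// ?ltrDl// le_max lexx.
Qed.

Lemma series_exp_le (y : R) n : `|series (exp_coeff y) n| <= expR `|y|.
Proof.
apply: (@le_trans _ _ (series (exp_coeff `|y|) n)).
  rewrite /series /= (le_trans (ler_norm_sum _ _ _))//; apply: ler_sum => i _.
  by rewrite normrM normrX (ger0_norm (_ : 0 <= (i`!%:R)^-1)).
apply: nondecreasing_cvgn_le; last exact: is_cvg_series_exp_coeff.
apply/nondecreasing_seqP => m; rewrite /series /= big_nat_recr//= lerDl.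
exact: exp_coeff_ge0.
Qed.

(* Phragmen's argument: the series of [expR (- expR (n (t - u)))] in powers of
   [expR (n (t - u))] turns integrals of transforms at [s0 + j n], all zero, into
   a regularization of the tail integral. *)
Lemma laplace_eq0_tail (w : R -> R) (s0 : R) :
  (forall s, s0 <= s -> laplace_integrable w s /\ laplace w s = 0) ->
  forall t : R, 0 < t -> \int[mu]_(u in `]t, +oo[) (expR (- (s0 * u)) * w u) = 0.
Proof.
move=> H t t0.
pose G u := expR (- (s0 * u)) * w u.
have Gi : mu.-integrable Rp (EFin \o G) by have [] := H s0 (lexx _).
have mG : measurable_fun Rp G.
  by case/integrableP : Gi => /measurable_EFinP.
have Gni : mu.-integrable Rp (fun u => `|G u|%:E) by exact: integrable_norm.
(* The [m]-th term of the series is a multiple of [expR (- ((s0 + m j) u)) w u], whose integral is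
   zero; for [u > 0] all partial sums are dominated by [expR (expR (j t)) |G u|]. *)
have step1 j : \int[mu]_(u in Rp) (expR (- expR (j%:R * (t - u))) * G u) = 0.
  pose f n u := series (exp_coeff (- expR (j%:R * (t - u)))) n * G u.
  have mser n : measurable_fun [set: R] (fun u : R => series (exp_coeff (- expR (j%:R * (t - u)))) n).
    rewrite /series /exp_coeff /=.
    apply: measurable_sum => m; apply: measurable_funM => //.
    apply: measurable_funX; apply: measurableT_comp => //.
    apply: measurableT_comp => //; apply: measurable_funM => //; exact: measurable_funB.
  have mf n : measurable_fun Rp (f n).
    by apply: measurable_funM => //; exact: measurable_funTS.
  have int0 n : \int[mu]_(u in Rp) f n u = 0.
    rewrite /f /series /Rintegral /=.
    under eq_integral do rewrite mulr_suml -sumEFin.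
    have I0 m : mu.-integrable Rp (fun u => (exp_coeff (- expR (j%:R * (t - u))) m * G u)%:E)
       /\ (\int[mu]_(u in Rp) (exp_coeff (- expR (j%:R * (t - u))) m * G u)%:E = 0)%E.
      have E u : (exp_coeff (- expR (j%:R * (t - u))) m * G u)%:E =
          (((- 1) ^+ m / m`!%:R * expR (m%:R * (j%:R * t)))%:E * (expR (- ((s0 + m%:R * j%:R) * u)) * w u)%:E)%E.
        rewrite /exp_coeff /= /G -EFinM; congr EFin.
        rewrite (exprNn (expR (j%:R * (t - u))) m) -expRM_natl.
        rewrite (_ : m%:R * (j%:R * (t - u)) = m%:R * (j%:R * t) + - (m%:R * j%:R * u)); last by ring.
        rewrite (_ : - ((s0 + m%:R * j%:R) * u) = - (m%:R * j%:R * u) + - (s0 * u)); last by ring.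
        by rewrite !expRD; ring.
      have [|wi w0] := H (s0 + m%:R * j%:R).
        by rewrite lerDl mulr_ge0.
      split.
        apply: (@eqR_integrable _ (fun u : R => (((- 1) ^+ m / m`!%:R *
          expR (m%:R * (j%:R * t)))%:E * (expR (- ((s0 + m%:R * j%:R) * u)) * w u)%:E)%E)) => //.
        exact: integrableZl.
      transitivity (\int[mu]_(u in Rp) (((- 1) ^+ m / m`!%:R *
          expR (m%:R * (j%:R * t)))%:E * (expR (- ((s0 + m%:R * j%:R) * u)) * w u)%:E))%E.
        by apply: eq_integral => u _; exact: E.
      rewrite integralZl//.
      have := w0; rewrite /laplace /Rintegral => {}w0.
      rewrite -[X in (_ * X)%E]fineK ?w0 ?mule0//.
      exact: integrable_fin_num.
    rewrite integral_sum//; last by move=> m; have [] := I0 m.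
    by rewrite big1// => m _; have [] := I0 m.
  have mlim : measurable_fun Rp (fun u : R => expR (- expR (j%:R * (t - u))) * G u).
    apply: measurable_funM => //; apply: measurable_funTS.
    apply: measurableT_comp => //; apply: measurableT_comp => //.
    apply: measurableT_comp => //; apply: measurable_funM => //; exact: measurable_funB.
  have gi : mu.-integrable Rp (fun u : R => (expR (expR (j%:R * t)) * `|G u|)%:E).
    exact: integrableRZl.
  have [||_ cv] := dominated_cvg_Rintegral (measurable_itv _) mf mlim _ gi.
  - apply: aeW => u _; apply: cvgM; last exact: cvg_cst.
    exact: is_cvg_series_exp_coeff.
  - move=> n u; rewrite /= in_itv/= andbT => u0.
    rewrite /f normrM ler_wpM2r//.
    rewrite (le_trans (series_exp_le _ _))// ler_expR normrN ger0_norm ?expR_ge0//.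
    by rewrite ler_expR ler_wpM2l// gerBl ltW.
  rewrite -(cvg_lim _ cv)//.
  rewrite (_ : (fun n => _) = cst 0) ?lim_cst//.
  by apply/funext => n; exact: int0.
pose f (n : nat) u := expR (- expR (n%:R * (t - u))) * G u.
have mf n : measurable_fun Rp (f n).
  apply: measurable_funM => //; apply: measurable_funTS.
  apply: measurableT_comp => //; apply: measurableT_comp => //.
  apply: measurableT_comp => //; apply: measurable_funM => //; exact: measurable_funB.
have mlim : measurable_fun Rp (fun u : R => \1_(`]t, +oo[ : set R) u * G u).
  by apply: measurable_funM => //; apply: measurable_indic.
(* As [n] grows, [expR (- expR (n (t - u)))] tends to 1 for [u > t] and to 0 for [u < t]; at [u = t]
   it stays at [expR (- 1)], so that point is excluded. *)
have fcv : {ae mu, forall u, Rp u -> f n u @[n --> \oo] --> \1_(`]t, +oo[ : set R) u * G u}.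
  exists [set t]; split => //; first exact: lebesgue_measure_set1.
  move=> u /= /not_implyP[_ nc].
  apply: contra_notP nc => /eqP/negPf ut.
  apply: cvgM; last exact: cvg_cst.
  rewrite indicE.
  have [tu|ut'] := ltP t u.
    rewrite mem_set/=; last by rewrite in_itv/= tu.
    rewrite -[X in _ --> X](_ : expR (- 0) = _); last by rewrite oppr0 expR0.
    apply: continuous_cvg; first exact: continuous_expR.
    apply: cvgN.
    under eq_fun do rewrite expRM_natl.
    by apply: cvg_expr; rewrite ger0_norm ?expR_ge0// expR_lt1 subr_lt0.
  rewrite memNset/=; last by rewrite in_itv/= andbT; apply/negP; rewrite -leNgt.
  have tu : 0 < t - u by rewrite subr_gt0 lt_neqAle ut' ut.
  apply: (@squeeze_cvgr _ _ _ _ (cst 0) (fun n => expR (- (t - u)) ^+ n)).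
  - apply: nearW => n; rewrite expR_ge0/= -expRM_natl ler_expR mulrN lerN2.
    by apply: le_trans (expR_ge1Dx _); rewrite lerDr.
  - exact: cvg_cst.
  - by apply: cvg_expr; rewrite ger0_norm ?expR_ge0// expR_lt1 oppr_lt0.
have [|_ cv] := dominated_cvg_Rintegral (measurable_itv _) mf mlim fcv Gni.
  move=> n u _; rewrite /f normrM ler_piMl//.
  by rewrite ger0_norm ?expR_ge0// expR_le1 oppr_le0 expR_ge0.
have e0 : \int[mu]_(u in Rp) (\1_(`]t, +oo[ : set R) u * G u) = 0.
  rewrite -(cvg_lim _ cv)// (_ : (fun n => _) = cst 0) ?lim_cst//.
  by apply/funext => n; exact: step1.
rewrite -[RHS]e0 Rintegral_mkcond [RHS]Rintegral_mkcond.
apply: eq_Rintegral => u _; rewrite !patchE indicE /=.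
case: ifPn => [|]; rewrite ?inE ?notin_setE/= in_itv/= andbT => tu.
  by rewrite mem_set/= ?in_itv/= ?andbT ?(lt_trans t0)// mul1r.
by case: ifPn => //; rewrite mul0r.
Qed.

(** All tail integrals of [expR (- (s0 u)) w u] vanish, hence so does its primitive; Lebesgue's
    differentiation theorem then makes the integrand zero almost everywhere. *)
Lemma laplace_uniq (w : R -> R) :
  (\forall s \near +oo, laplace_integrable w s /\ laplace w s = 0) ->
  {ae mu, forall t, 0 < t -> w t = 0}.
Proof.
move=> /near_pinfty_ge[s0 s00 H].
pose G := (fun u => expR (- (s0 * u)) * w u) \_ `]0, +oo[.
have wi : laplace_integrable w s0 by have [] := H s0 (lexx _).
have Gi : mu.-integrable setT (EFin \o G).
  rewrite /G -restrict_EFin; apply/(integrable_mkcond _ _).1 => //.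
have GD D : measurable D -> mu.-integrable D (EFin \o G).
  by move=> mD; exact: integrableS Gi.
have F0 x : \int[mu]_(u in `]-oo, x]) G u = 0.
  have GT : \int[mu]_u G u = 0.
    by rewrite /G -Rintegral_mkcond; have [] := H s0 (lexx _).
  have : \int[mu]_u G u - \int[mu]_(u in `]-oo, x]) G u = \int[mu]_(u in `]x, +oo[) G u.
    by rewrite -set_itvNyy Rintegral_itvB// set_itvNyy.
  rewrite GT sub0r => /eqP; rewrite eqr_oppLR => /eqP ->.
  have [x0|x0] := ltP 0 x.
    rewrite (_ : \int[mu]_(u in `]x, +oo[) G u = 0) ?oppr0//.
    rewrite -[RHS](laplace_eq0_tail H x0); apply: eq_Rintegral => u.
    rewrite inE/= in_itv/= andbT => xu.
    by rewrite /G patchE mem_set//= in_itv/= andbT (lt_trans x0).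
  rewrite (_ : \int[mu]_(u in `]x, +oo[) G u = 0) ?oppr0//.
  rewrite -GT Rintegral_mkcond; apply: eq_Rintegral => u _; rewrite /G /patch.
  case: ifPn => //; rewrite notin_setE/= in_itv/= andbT => xu.
  by case: ifPn => //; rewrite inE/= in_itv/= andbT => /(le_lt_trans x0).
have loc : locally_integrable [set: R] G.
  by have := integrable_locally measurableT Gi; rewrite patch_setT.
have := FTC1Ny (fun y => GD _ (measurable_itv _)) loc.
apply: filterS; first exact: (ae_filter_ringOfSetsType mu).
move=> t /= [_ dG] t0.
have : G t = 0.
  rewrite -dG; under eq_fun do rewrite F0.
  exact: derive1_cst.
rewrite /G patchE mem_set/=; last by rewrite in_itv/= t0.
by move/eqP; rewrite mulf_eq0 expR_eq0/= => /eqP.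
Qed.
End Lerch.

(** * Heat kernels *)

Section HeatKernel.
Context {R : realType}.
Local Notation mu := (@lebesgue_measure R).
Local Notation Rp := (`]0%R, +oo[%classic : set R).

(** Unnormalized, with limit [Num.sqrt pi] at [+oo]; [Num.sqrt pi - gauss_cdf] is the complementary
    error function up to a constant factor. *)
Definition gauss_cdf (x : R) := \int[mu]_(u in `]-oo, x]) gauss_fun u.

Lemma is_derive_gauss_cdf (x : R) : is_derive x 1 gauss_cdf (gauss_fun x).
Proof.
have gi D : measurable D -> mu.-integrable D (EFin \o gauss_fun).
  by move=> mD; apply: integrableS (@integrableT_gauss R).
have x1 : x < x + 1 by rewrite ltrDl.
have [d1 d2] := @continuous_FTC1 R gauss_fun -oo%O x (x + 1) x1
  (gi _ (measurable_itv _)) (ltNyr _) (@continuous_gauss_fun R x).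
by apply: DeriveDef => //; rewrite -derive1E.
Qed.

(** [A] is the whole line for the limit at [+oo] and empty for the limit at [-oo]; in both cases the
    indicator of []-oo, u n]] is eventually constant at each point. *)
Lemma gauss_cdf_cvg_lim (u : R ^nat) (A : set R) : measurable A ->
  (forall x, \forall n \near \oo, (x <= u n) = (x \in A)) ->
  gauss_cdf (u n) @[n --> \oo] --> \int[mu]_(x in A) gauss_fun x.
Proof.
move=> mA uA; rewrite /gauss_cdf Rintegral_mkcond.
under eq_fun do rewrite Rintegral_mkcond.
have mg : measurable_fun setT (@gauss_fun R) by exact: measurable_gauss_fun.
suff [_ +] : mu.-integrable setT (EFin \o (@gauss_fun R \_ A)) /\
  \int[mu]_x (gauss_fun \_ `]-oo, (u n)]) x @[n --> \oo] --> \int[mu]_x (gauss_fun \_ A) x by [].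
apply: (@dominated_cvg_Rintegral _ setT (fun n => gauss_fun \_ `]-oo, (u n)]) _ gauss_fun) => //.
- by move=> n; apply/(measurable_restrictT (@gauss_fun R)) => //; exact: measurable_funTS.
- by apply/(measurable_restrictT (@gauss_fun R)) => //; exact: measurable_funTS.
- apply: aeW => x _; apply: cvg_near_cst.
  near=> n; rewrite !patchE; have <- : (x <= u n) = (x \in A) by near: n; exact: uA.
  by rewrite (_ : (x \in `]-oo, (u n)]%classic) = (x <= u n))//; apply/idP/idP; rewrite inE/= in_itv/=.
- exact: integrableT_gauss.
- move=> n x _; rewrite patchE; case: ifP => _.
    by rewrite ger0_norm ?gauss_fun_ge0.
  by rewrite normr0 gauss_fun_ge0.
Unshelve. all: by end_near. Qed.

Lemma gauss_cdf_cvgy : gauss_cdf x @[x --> +oo] --> Num.sqrt pi.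
Proof.
apply/cvg_pinftyP => u uy.
rewrite (_ : Num.sqrt pi = \int[mu]_(x in setT) gauss_fun x); last first.
  by rewrite /Rintegral integralT_gauss.
apply: gauss_cdf_cvg_lim => // x.
near=> n; rewrite in_setT; near: n.
by move/cvgryPge : uy => /(_ x); apply: filterS => n ->.
Unshelve. all: by end_near. Qed.

Lemma gauss_cdf_cvgNy : gauss_cdf x @[x --> -oo] --> 0.
Proof.
apply/cvgNy_compNP/cvg_pinftyP => u uy /=.
rewrite -[X in _ --> X](Rintegral_set0 mu (@gauss_fun R)).
apply: (@gauss_cdf_cvg_lim (fun n => - u n)) => // x.
near=> n; rewrite in_set0; apply/negbTE; rewrite -ltNge ltrNl; near: n.
by move/cvgryPgt : uy => /(_ (- x)).
Unshelve. all: by end_near. Qed.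

(* As [Num.sqrt t = 0] and [0^-1 = 0], this is 0 for t <= 0. *)
Definition heat_kernel (d t : R) : R :=
  d / (2 * Num.sqrt pi) * (Num.sqrt t)^-1 ^+ 3 * expR (- (d ^+ 2 / (4 * t))).

Lemma heat_kernel_ge0 (d t : R) : 0 <= d -> 0 <= heat_kernel d t.
Proof.
move=> d0; rewrite /heat_kernel mulr_ge0 ?expR_ge0// mulr_ge0 ?exprn_ge0 ?invr_ge0//.
by rewrite divr_ge0// mulr_ge0.
Qed.

Lemma heat_kernel_eq0 (d t : R) : t <= 0 -> heat_kernel d t = 0.
Proof.
move=> t0; rewrite /heat_kernel.
by rewrite (ler0_sqrtr t0) invr0 expr0n/= mulr0 mul0r.
Qed.

Lemma continuous_heat_kernel (d t : R) : 0 < t -> {for t, continuous (heat_kernel d)}.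
Proof.
move=> t0; rewrite /heat_kernel.
have st0 : Num.sqrt t != 0 by rewrite gt_eqF// sqrtr_gt0.
apply: cvgM; first apply: cvgM.
- exact: cvg_cst.
- apply: (cvg_comp (fun x => (Num.sqrt x)^-1) (fun x => x ^+ 3) _ (@exprn_continuous _ 3 _)).
  by apply: cvgV => //; exact: sqrt_continuous.
- apply: (cvg_comp (fun x => - (d ^+ 2 / (4 * x))) expR _ (@continuous_expR _ _)).
  apply: cvgN; apply: cvgM; first exact: cvg_cst.
  apply: cvgV; first by rewrite mulf_neq0// gt_eqF.
  by apply: cvgM; [exact: cvg_cst|exact: cvg_id].
Qed.

Lemma measurable_heat_kernel d : measurable_fun [set: R] (heat_kernel d).
Proof.
rewrite (_ : heat_kernel d = heat_kernel d \_ Rp).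
  apply/(measurable_restrictT (heat_kernel d)); first exact: measurable_itv.
  apply: open_continuous_measurable_fun; first exact: interval_open.
  by move=> t; rewrite inE/= in_itv/= andbT; exact: continuous_heat_kernel.
apply/funext => t; rewrite patchE; case: ifPn => //.
rewrite notin_setE/= in_itv/= andbT => /negP; rewrite -leNgt.
exact: heat_kernel_eq0.
Qed.

(** A consequence of [v ^ 2 / 2 <= exp v]. It makes the kernel continuous at 0 from the right, as
    the fundamental theorem on [[0, +oo[] demands. *)
Lemma heat_kernel_le_sqrt (d t : R) : 0 < d -> 0 < t ->
  heat_kernel d t <= 16 / (Num.sqrt pi * d ^+ 3) * Num.sqrt t.
Proof.
move=> d0 t0.
have st0 : 0 < Num.sqrt t by rewrite sqrtr_gt0.
have sp0 : 0 < Num.sqrt pi :> R by rewrite sqrtr_gt0 pi_gt0.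
have tE : t = Num.sqrt t ^+ 2 by rewrite sqr_sqrtr// ltW.
rewrite /heat_kernel; move: (Num.sqrt t) st0 tE => r r0 tE.
set v := d ^+ 2 / (4 * t).
have v0 : 0 < v by rewrite divr_gt0 ?mulr_gt0 ?exprn_gt0.
have ev : expR (- v) <= 2 / v ^+ 2.
  rewrite expRN -[leRHS]invrK lef_pV2 ?posrE ?expR_gt0 ?invr_gt0 ?divr_gt0 ?exprn_gt0//.
  rewrite invf_div; apply: le_trans (expR_ge1Dxn 1 (ltW v0)).
  by rewrite (_ : 2`!%:R = 2)// lerDr.
apply: (le_trans (ler_wpM2l _ ev)).
  by rewrite mulr_ge0 ?exprn_ge0 ?invr_ge0 ?divr_ge0 ?mulr_ge0 ?(ltW r0) ?(ltW d0) ?(ltW sp0).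
rewrite /v tE le_eqVlt; apply/orP; left; apply/eqP.
by field; rewrite ?gt_eqF.
Qed.

Let alpha (d t : R) := d / 2 * (Num.sqrt t)^-1.
Let beta (s t : R) := Num.sqrt s * Num.sqrt t.

(* The antiderivative of [expR (- (s * t)) * heat_kernel d t] in terms of the
   error function. *)
Let F (d s t : R) := (Num.sqrt pi)^-1 *
  (expR (- (d * Num.sqrt s)) * (Num.sqrt pi - gauss_cdf (alpha d t - beta s t)) +
   expR (d * Num.sqrt s) * (Num.sqrt pi - gauss_cdf (alpha d t + beta s t))).

Lemma is_derive_heat_kernel_primitive (d s t : R) : 0 < s -> 0 < t ->
  is_derive t 1 (F d s) (expR (- (s * t)) * heat_kernel d t).
Proof.
move=> s0 t0.
have st0 : Num.sqrt t != 0 by rewrite gt_eqF// sqrtr_gt0.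
have sp0 : Num.sqrt pi != 0 :> R by rewrite gt_eqF// sqrtr_gt0 pi_gt0.
have dsq : is_derive t 1 Num.sqrt (2 * Num.sqrt t)^-1 by exact: is_derive1_sqrt.
have dinv := is_deriveV st0 dsq.
have dal : is_derive t 1 (alpha d) (d / 2 * (- (Num.sqrt t) ^- 2 * (2 * Num.sqrt t)^-1)).
  exact: (@is_deriveZ _ _ _ _ (d / 2) _ _ _ dinv).
have dbe : is_derive t 1 (beta s) (Num.sqrt s * (2 * Num.sqrt t)^-1).
  exact: (@is_deriveZ _ _ _ _ (Num.sqrt s) _ _ _ dsq).
have d1 := @is_derive1_comp _ gauss_cdf (alpha d - beta s) t _ _ (is_derive_gauss_cdf (alpha d t - beta s t)) (is_deriveB dal dbe).
have d2 := @is_derive1_comp _ gauss_cdf (alpha d + beta s) t _ _ (is_derive_gauss_cdf (alpha d t + beta s t)) (is_deriveD dal dbe).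
have d1' := @is_deriveZ _ _ _ _ (expR (- (d * Num.sqrt s))) _ _ _ (is_deriveB (is_derive_cst (Num.sqrt pi) t 1) d1).
have d2' := @is_deriveZ _ _ _ _ (expR (d * Num.sqrt s)) _ _ _ (is_deriveB (is_derive_cst (Num.sqrt pi) t 1) d2).
have d3 := @is_deriveZ _ _ _ _ ((Num.sqrt pi)^-1) _ _ _ (is_deriveD d1' d2').
apply: (is_derive_eq d3).
have tE : t = Num.sqrt t ^+ 2 by rewrite sqr_sqrtr// ltW.
have sE : s = Num.sqrt s ^+ 2 by rewrite sqr_sqrtr// ltW.
(* Completing the square: [(alpha - beta) ^ 2 = d ^ 2 / (4 t) - d sqrt s + s t], and likewise with
   plus signs. Both Gaussian terms thus carry the exponential of the integrand, and the derivatives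
   of [beta] cancel. *)
have e1 : expR (- (d * Num.sqrt s)) * gauss_fun (alpha d t - beta s t) =
    expR (- (s * t)) * expR (- (d ^+ 2 / (4 * t))).
  rewrite /gauss_fun -!expRD; congr expR; rewrite /alpha /beta [in RHS]sE [in RHS]tE.
  by field.
have e2 : expR (d * Num.sqrt s) * gauss_fun (alpha d t + beta s t) =
    expR (- (s * t)) * expR (- (d ^+ 2 / (4 * t))).
  rewrite /gauss_fun -!expRD; congr expR; rewrite /alpha /beta [in RHS]sE [in RHS]tE.
  by field.
set a' := d / 2 * _ in dal *; set b' := Num.sqrt s * _ in dbe *.
set E1 := expR (- (d * Num.sqrt s)) in e1 *; set E2 := expR (d * Num.sqrt s) in e2 *.
set g1 := gauss_fun (alpha d t - beta s t) in e1 *.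
set g2 := gauss_fun (alpha d t + beta s t) in e2 *.
transitivity ((Num.sqrt pi)^-1 * (E1 * (0 - g1 * (a' - b')) + E2 * (0 - g2 * (a' + b')))).
  by [].
transitivity ((Num.sqrt pi)^-1 * (- (E1 * g1) * (a' - b') - (E2 * g2) * (a' + b'))).
  by ring.
rewrite e1 e2 /heat_kernel /a'.
set X := expR (- (s * t)); set Y := expR _.
by field; rewrite st0 sp0.
Qed.

Lemma heat_kernel_primitive_cvgy (d s : R) : 0 < d -> 0 < s ->
  F d s t @[t --> +oo] --> expR (- (d * Num.sqrt s)).
Proof.
move=> d0 s0.
have ss0 : 0 < Num.sqrt s by rewrite sqrtr_gt0.
have sp0 : Num.sqrt pi != 0 :> R by rewrite gt_eqF// sqrtr_gt0 pi_gt0.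
have h1 : (alpha d t - beta s t) @[t --> +oo] --> -oo.
  apply/cvgrNyPle => A.
  pose M := (Num.sqrt s)^-1 * `|d / 2 - A|.
  near=> t.
  have t1 : 1 <= t by near: t; apply: nbhs_pinfty_ge; exact: num_real.
  have tM : M ^+ 2 <= t by near: t; apply: nbhs_pinfty_ge; exact: num_real.
  have st1 : 1 <= Num.sqrt t by rewrite -[leLHS]sqrtr1 ler_sqrt// (le_trans ler01).
  have stM : M <= Num.sqrt t.
    by rewrite -[leLHS]ger0_norm ?mulr_ge0 ?invr_ge0// -sqrtr_sqr ler_sqrt// (le_trans ler01).
  have a1 : alpha d t <= d / 2.
    by rewrite /alpha ler_piMr ?divr_ge0 ?(ltW d0)// invf_le1// (lt_le_trans ltr01).
  have b1 : d / 2 - A <= beta s t.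
    rewrite (le_trans (ler_norm _))// /beta -ler_pdivrMl//.
  by rewrite lerBlDr (le_trans a1)// -lerBlDl.
have h2 : (alpha d t + beta s t) @[t --> +oo] --> +oo.
  apply/cvgryPge => A.
  pose M := (Num.sqrt s)^-1 * `|A|.
  near=> t.
  have t1 : 1 <= t by near: t; apply: nbhs_pinfty_ge; exact: num_real.
  have tM : M ^+ 2 <= t by near: t; apply: nbhs_pinfty_ge; exact: num_real.
  have stM : M <= Num.sqrt t.
    by rewrite -[leLHS]ger0_norm ?mulr_ge0 ?invr_ge0// -sqrtr_sqr ler_sqrt// (le_trans ler01).
  have a1 : 0 <= alpha d t by rewrite /alpha mulr_ge0 ?invr_ge0 ?divr_ge0 ?(ltW d0).
  have b1 : A <= beta s t.
    by rewrite (le_trans (ler_norm _))// /beta -ler_pdivrMl.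
  by rewrite (le_trans b1)// lerDr.
have -> : expR (- (d * Num.sqrt s)) = (Num.sqrt pi)^-1 *
  (expR (- (d * Num.sqrt s)) * (Num.sqrt pi - 0) +
   expR (d * Num.sqrt s) * (Num.sqrt pi - Num.sqrt pi)).
  by rewrite subrr mulr0 addr0 subr0 mulrCA mulVf// mulr1.
apply: cvgM; first exact: cvg_cst.
apply: cvgD; (apply: cvgM; first exact: cvg_cst); (apply: cvgB; first exact: cvg_cst).
- exact: cvg_comp h1 gauss_cdf_cvgNy.
- exact: cvg_comp h2 gauss_cdf_cvgy.
Unshelve. all: by end_near. Qed.

Lemma heat_kernel_primitive_cvg0 (d s : R) : 0 < d -> 0 < s ->
  F d s t @[t --> 0^'+] --> 0.
Proof.
move=> d0 s0.
have ss0 : 0 < Num.sqrt s by rewrite sqrtr_gt0.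
have hA A : \forall t \near 0^'+, A <= alpha d t - beta s t /\ A <= alpha d t + beta s t.
  pose M := d / (2 * (`|A| + Num.sqrt s)).
  have AS : 0 < `|A| + Num.sqrt s by rewrite ltr_wpDl.
  have M0 : 0 < M by rewrite divr_gt0// mulr_gt0.
  near=> t.
  have t0 : 0 < t by near: t; exact: nbhs_right_gt.
  have t1 : t <= 1 by near: t; exact: nbhs_right_le.
  have tM : t <= M ^+ 2 by near: t; apply: nbhs_right_le; rewrite exprn_gt0.
  have st0 : 0 < Num.sqrt t by rewrite sqrtr_gt0.
  have st1 : Num.sqrt t <= 1 by rewrite -[leRHS]sqrtr1 ler_sqrt.
  have stM : Num.sqrt t <= M.
    by rewrite -[leRHS]ger0_norm ?(ltW M0)// -sqrtr_sqr ler_sqrt// exprn_ge0// ltW.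
  have a1 : `|A| + Num.sqrt s <= alpha d t.
    rewrite /alpha ler_pdivlMr//.
    by move: stM; rewrite /M ler_pdivlMr ?mulr_gt0// ler_pdivlMr// => h; lra.
  have b1 : beta s t <= Num.sqrt s by rewrite /beta ler_piMr// ltW.
  have b0 : 0 <= beta s t by rewrite /beta mulr_ge0.
  have := ler_norm A.
  by split; lra.
have h1 : (alpha d t - beta s t) @[t --> 0^'+] --> +oo.
  by apply/cvgryPge => A; apply: filterS (hA A) => t [].
have h2 : (alpha d t + beta s t) @[t --> 0^'+] --> +oo.
  by apply/cvgryPge => A; apply: filterS (hA A) => t [].
rewrite -[X in _ --> X](_ : (Num.sqrt pi)^-1 *
  (expR (- (d * Num.sqrt s)) * (Num.sqrt pi - Num.sqrt pi) +
   expR (d * Num.sqrt s) * (Num.sqrt pi - Num.sqrt pi)) = 0); last first.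
  by rewrite subrr !mulr0 addr0 mulr0.
apply: cvgM; first exact: cvg_cst.
apply: cvgD; (apply: cvgM; first exact: cvg_cst); (apply: cvgB; first exact: cvg_cst).
- exact: cvg_comp h1 gauss_cdf_cvgy.
- exact: cvg_comp h2 gauss_cdf_cvgy.
Unshelve. all: by end_near. Qed.

(** The kernel carries boundary data of the heat equation on a half-line to distance [d], which
    multiplies the transform by [exp (- d sqrt s)]. The integral is read off from the limits of [F]
    at both ends. *)
Lemma heat_kernel_laplace (d s : R) : 0 < d -> 0 < s ->
  laplace_integrable (heat_kernel d) s /\
  laplace (heat_kernel d) s = expR (- (d * Num.sqrt s)).
Proof.
move=> d0 s0.
pose f (t : R) := expR (- (s * t)) * heat_kernel d t.
(* At [t = 0] the convention [0^-1 = 0] gives [F] a value different from its limit; [G] takes the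
   limit 0 there. *)
pose G (t : R) := if 0 < t then F d s t else 0.
have mf : measurable_fun [set: R] f.
  apply: measurable_funM; last exact: measurable_heat_kernel.
  by apply: measurableT_comp => //; apply: measurableT_comp => //; exact: measurable_funM.
have f0 (t : R) : 0 <= f t by rewrite mulr_ge0 ?expR_ge0 ?heat_kernel_ge0 ?ltW.
have nG (t : R) : 0 < t -> \forall u \near t, F d s u = G u.
  move=> t0; near=> u; rewrite /G ifT//; near: u; exact: lt_nbhsr.
have dG (t : R) : 0 < t -> is_derive t 1 G (f t).
  by move=> t0; apply: near_eq_is_derive (nG t t0) _; exact: is_derive_heat_kernel_primitive.
have I : (\int[mu]_(t in `[0%R, +oo[) (f t)%:E = (expR (- (d * Num.sqrt s)))%:E - (G 0)%:E)%E.
  apply: ge0_continuous_FTC2y.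
  - by move=> t _; exact: f0.
  - apply/continuous_within_itvcyP; split.
      move=> t; rewrite in_itv/= andbT => t0.
      apply: cvgM; last exact: continuous_heat_kernel.
      apply: (cvg_comp (fun x => - (s * x)) expR _ (@continuous_expR _ _)).
      by apply: cvgN; apply: cvgM; [exact: cvg_cst|exact: cvg_id].
    rewrite /f (heat_kernel_eq0 _ (lexx 0)) mulr0.
    apply: (@squeeze_cvgr _ _ _ _ (cst 0) (fun t => 16 / (Num.sqrt pi * d ^+ 3) * Num.sqrt t)).
    + near=> t; rewrite f0/=.
      have t0 : 0 < t by near: t; exact: nbhs_right_gt.
      apply: le_trans (heat_kernel_le_sqrt d0 t0).
      by rewrite ler_piMl ?heat_kernel_ge0 ?(ltW d0)// expR_le1 oppr_le0 mulr_ge0 ?(ltW s0) ?(ltW t0).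
    + exact: cvg_cst.
    + rewrite -[X in _ --> X](mulr0 (16 / (Num.sqrt pi * d ^+ 3))).
      apply: cvgM; first exact: cvg_cst.
      rewrite -[X in _ --> X]sqrtr0; apply: cvg_at_right_filter; exact: sqrt_continuous.
  - apply: cvg_trans (heat_kernel_primitive_cvgy d0 s0).
    by apply: near_eq_cvg; near=> t; rewrite /G ifT//; near: t; apply: nbhs_pinfty_gt; exact: num_real.
  - by move=> t t0; have [] := dG _ t0.
  - rewrite {2}/G ltxx.
    apply: cvg_trans (heat_kernel_primitive_cvg0 d0 s0).
    by apply: near_eq_cvg; near=> t; rewrite /G ifT//; near: t; exact: nbhs_right_gt.
  - move=> t; rewrite in_itv/= andbT => t0; rewrite derive1E.
    by have [_ ->] := dG _ t0.
move: I; rewrite {1}/G ltxx sube0 -integral_itv_obnd_cbnd; last first.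
  by apply/measurable_EFinP; exact: measurable_funTS.
move=> I; split; last by rewrite /laplace /Rintegral I.
apply/integrableP; split; first by apply/measurable_EFinP; exact: measurable_funTS.
under eq_integral do rewrite gee0_abs ?lee_fin ?f0//.
by rewrite I ltry.
Unshelve. all: by end_near. Qed.
End HeatKernel.

Section HeatSeries.
Context {R : realType}.
Local Notation mu := (@lebesgue_measure R).
Local Notation Rp := (`]0%R, +oo[%classic : set R).

(* With [q = expR (- Num.sqrt s)], the transform is [q ^ a / (1 - q ^ b)]; the cases
   [b = 2 a] are the kernels of [coth] and [1 / sinh]. *)
Definition heat_series (a b t : R) :=
  limn (series (fun m => heat_kernel (a + m%:R * b) t)).

Let C (t : R) := (2 * Num.sqrt pi)^-1 * (Num.sqrt t)^-1 ^+ 3.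

Let C_ge0 t : 0 <= C t.
Proof. by rewrite mulr_ge0 ?exprn_ge0 ?invr_ge0 ?mulr_ge0. Qed.

Let heat_kernelE (d t : R) :
  heat_kernel d t = C t * (d * expR (- (d ^+ 2 / (4 * t)))).
Proof. by rewrite /heat_kernel /C; ring. Qed.

Let dm_gt0 (a b : R) (m : nat) : 0 < a -> 0 < b -> 0 < a + m%:R * b.
Proof. by move=> a0 b0; rewrite ltr_wpDr// mulr_ge0// ltW. Qed.

Let dm_ge0 (a b : R) (m : nat) : 0 < a -> 0 < b -> 0 <= a + m%:R * b.
Proof. by move=> a0 b0; exact/ltW/dm_gt0. Qed.

(** One half of the Gaussian exponent absorbs the factor [d], through [exp (- v) <= 1 / v]; the
    other half decays geometrically because [d ^ 2 >= 2 a (m b)]. *)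
Lemma heat_kernel_geometric (a b t : R) m : 0 < a -> 0 < b -> 0 < t ->
  heat_kernel (a + m%:R * b) t <=
  geometric (C t * (8 * t / a)) (expR (- (a * b / (4 * t)))) m.
Proof.
move=> a0 b0 t0; rewrite heat_kernelE /geometric /=.
have mb0 : 0 <= m%:R * b by rewrite mulr_ge0// ltW.
set d := a + m%:R * b.
have ad : a <= d by rewrite lerDl.
have d0 : 0 < d by exact: lt_le_trans ad.
rewrite -expRM_natl -[leRHS]mulrA; apply: ler_wpM2l => //.
rewrite (_ : - (d ^+ 2 / (4 * t)) = - (d ^+ 2 / (8 * t)) + - (d ^+ 2 / (8 * t))); last first.
  by field; rewrite gt_eqF.
rewrite expRD mulrA; apply: ler_pM; rewrite ?expR_ge0//.
- by apply: mulr_ge0; rewrite ?expR_ge0 ?(ltW d0).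
- have v0 : 0 < d ^+ 2 / (8 * t) by rewrite divr_gt0 ?exprn_gt0 ?mulr_gt0.
  apply: (@le_trans _ _ (d * (d ^+ 2 / (8 * t))^-1)).
    rewrite ler_pM2l// expRN lef_pV2 ?posrE ?expR_gt0//.
    by apply: le_trans (expR_ge1Dx _); rewrite lerDr.
  rewrite (_ : d * _ = 8 * (t * d^-1)); last by field; rewrite !gt_eqF.
  rewrite -mulrA ler_pM2l// ler_pM2l// lef_pV2 ?posrE//.
- rewrite ler_expR mulrN lerN2 mulrA ler_pdivlMr ?mulr_gt0//.
  rewrite (_ : m%:R * (a * b) / (4 * t) * (8 * t) = 2 * a * (m%:R * b)); last first.
    by field; rewrite gt_eqF.
  rewrite /d sqrrD; have := sqr_ge0 a; have := sqr_ge0 (m%:R * b).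
  by move=> h1 h2; lra.
Qed.

Let mulr_lim_series (c : R) (f : R ^nat) : cvgn (series f) ->
  cvgn (series (fun m => c * f m)) /\
  c * limn (series f) = limn (series (fun m => c * f m)).
Proof. by move=> cf; split; [exact: is_cvg_seriesZ|rewrite -[LHS](lim_seriesZ c cf)]. Qed.

Lemma is_cvg_heat_series (a b t : R) : 0 < a -> 0 < b ->
  cvgn (series (fun m => heat_kernel (a + m%:R * b) t)).
Proof.
move=> a0 b0; have [t0|t0] := leP t 0.
  rewrite (_ : (fun m => _) = fun=> 0); last first.
    by apply/funext => m; rewrite heat_kernel_eq0.
  rewrite (_ : series _ = fun=> 0); first exact: is_cvg_cst.
  by apply/funext => m; rewrite /series /= big1.
apply: (series_le_cvg _ _ (fun m => heat_kernel_geometric m a0 b0 t0)).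
- by move=> m; rewrite heat_kernel_ge0 ?dm_ge0.
- move=> m; rewrite /geometric /= mulr_ge0 ?exprn_ge0 ?expR_ge0//.
  by rewrite mulr_ge0// divr_ge0 ?mulr_ge0 ?(ltW t0) ?(ltW a0).
- apply: is_cvg_geometric_series; rewrite ger0_norm ?expR_ge0// expR_lt1 oppr_lt0.
  by rewrite divr_gt0 ?mulr_gt0.
Qed.

Lemma heat_series_ge0 (a b t : R) : 0 < a -> 0 < b -> 0 <= heat_series a b t.
Proof.
move=> a0 b0; apply: limr_ge; first exact: is_cvg_heat_series.
apply: nearW => n; rewrite /series /= sumr_ge0// => m _.
by rewrite heat_kernel_ge0 ?dm_ge0.
Qed.

Lemma le_heat_series (a b a' b' c t : R) : 0 < a -> 0 < b -> 0 < a' -> 0 < b' ->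
  (forall m, heat_kernel (a + m%:R * b) t <= c * heat_kernel (a' + m%:R * b') t) ->
  heat_series a b t <= c * heat_series a' b' t.
Proof.
move=> a0 b0 a'0 b'0 h.
have c1 := @is_cvg_heat_series _ _ t a0 b0.
have c2 := @is_cvg_heat_series _ _ t a'0 b'0.
have [c3 E] := mulr_lim_series c c2.
by rewrite /heat_series E; exact: lim_series_le.
Qed.

(** As a function of [d], the kernel peaks at [d ^ 2 = 2 t], so from [d ^ 2 >= t] on it may still
    rise, but by a factor of at most 2: [exp z >= 1 + z] with [z >= (d' - d) / (2 d)] gives
    [2 d exp z >= d + d']. *)
Lemma le2_heat_kernel (d d' t : R) : 0 < d -> d <= d' -> 0 < t -> t <= d ^+ 2 ->
  heat_kernel d' t <= 2 * heat_kernel d t.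
Proof.
move=> d0 dd t0 td; rewrite !heat_kernelE [leRHS]mulrCA; apply: ler_wpM2l => //.
have -> : - (d ^+ 2 / (4 * t)) = - (d' ^+ 2 / (4 * t)) + (d' ^+ 2 - d ^+ 2) / (4 * t).
  by field; rewrite gt_eqF.
rewrite expRD (_ : 2 * (d * _) = 2 * (d * expR ((d' ^+ 2 - d ^+ 2) / (4 * t))) *
  expR (- (d' ^+ 2 / (4 * t)))); last by ring.
rewrite ler_pM2r ?expR_gt0//.
have h : (d' - d) / (2 * d) <= (d' ^+ 2 - d ^+ 2) / (4 * t).
  rewrite ler_pdivrMr ?mulr_gt0// mulrAC ler_pdivlMr ?mulr_gt0//.
  rewrite -subr_ge0 (_ : _ - _ = (d' - d) * (2 * (d' + d) * d - 4 * t)); last by ring.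
  rewrite mulr_ge0 ?subr_ge0//.
  apply: (@le_trans _ _ (4 * d ^+ 2)); first by rewrite ler_pM2l.
  by rewrite expr2; nra.
apply: (@le_trans _ _ (2 * (d * (1 + (d' - d) / (2 * d))))).
  rewrite mulrDr mulr1 (_ : d * ((d' - d) / (2 * d)) = (d' - d) / 2); last by field; rewrite gt_eqF.
  by lra.
rewrite ler_pM2l// ler_pM2l//; apply: le_trans (expR_ge1Dx _).
by rewrite lerD2l.
Qed.

(** The [m]-th distances are [(m + 1) a] and [(m + 1) b], so the series compare term by term; the
    time restriction is tightest at [m = 0]. *)
Lemma heat_series_le2 (a b t : R) : 0 < a -> a <= b -> 0 < t -> t <= a ^+ 2 ->
  heat_series b b t <= 2 * heat_series a a t.
Proof.
move=> a0 ab t0 ta; have b0 := lt_le_trans a0 ab.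
apply: le_heat_series => // m.
have cE c : c + m%:R * c = m.+1%:R * c :> R by rewrite -natr1; ring.
rewrite !cE.
have am : a <= m.+1%:R * a by rewrite ler_peMl ?ler1n// ltW.
apply: le2_heat_kernel => //; first by rewrite mulr_gt0.
  by rewrite ler_pM2l.
rewrite (le_trans ta)// ler_sqr// nnegrE; last exact: le_trans (ltW a0) am.
exact: ltW.
Qed.

(** The distances [2 a], [4 a], ... are every other one of [a], [2 a], [3 a], ..., and all terms are
    nonnegative. *)
Lemma heat_series_double (a t : R) : 0 < a ->
  heat_series (2 * a) (2 * a) t <= heat_series a a t.
Proof.
move=> a0; have a20 : 0 < 2 * a by rewrite mulr_gt0.
have c1 := @is_cvg_heat_series _ _ t a20 a20.
have c2 := @is_cvg_heat_series _ _ t a0 a0.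
apply: limr_le => //; apply: nearW => n.
apply: (@le_trans _ _ (series (fun m => heat_kernel (a + m%:R * a) t) n.*2)).
  rewrite /series /=; elim: n => [|n IH]; first by rewrite !big_nil.
  rewrite doubleS !big_nat_recr//= -addrA lerD// ler_wpDl//.
    by rewrite heat_kernel_ge0 ?dm_ge0.
  rewrite (_ : 2 * a + n%:R * (2 * a) = a + n.*2.+1%:R * a)//.
  by rewrite -[n.*2.+1%:R]natr1 -addnn natrD; ring.
apply: (nondecreasing_cvgn_le _ c2).
apply/nondecreasing_seqP => m; rewrite /series /= big_nat_recr//= lerDl.
by rewrite heat_kernel_ge0 ?dm_ge0.
Qed.

Lemma measurable_heat_series (a b : R) : 0 < a -> 0 < b ->
  measurable_fun [set: R] (heat_series a b).
Proof.
move=> a0 b0.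
apply: (@measurable_fun_cvg _ _ R setT (fun n t => series (fun m => heat_kernel (a + m%:R * b) t) n)).
  move=> n; rewrite /series /=; apply: measurable_sum => m; exact: measurable_heat_kernel.
by move=> t _; exact: is_cvg_heat_series.
Qed.

(** Integrating the nonnegative series term by term leaves a geometric series of ratio
    [exp (- b sqrt s)]. *)
Lemma heat_series_laplace (a b s : R) : 0 < a -> 0 < b -> 0 < s ->
  laplace_integrable (heat_series a b) s /\
  laplace (heat_series a b) s = expR (- (a * Num.sqrt s)) / (1 - expR (- (b * Num.sqrt s))).
Proof.
move=> a0 b0 s0.
have dm (m : nat) : 0 < a + m%:R * b by exact: dm_gt0.
have me : measurable_fun [set: R] (fun t : R => expR (- (s * t))).
  by apply: measurableT_comp => //; apply: measurableT_comp => //; exact: measurable_funM.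
have q1 : `|expR (- (b * Num.sqrt s))| < 1.
  by rewrite ger0_norm ?expR_ge0// expR_lt1 oppr_lt0 mulr_gt0// sqrtr_gt0.
have I : (\int[mu]_(t in Rp) (expR (- (s * t)) * heat_series a b t)%:E =
    (expR (- (a * Num.sqrt s)) / (1 - expR (- (b * Num.sqrt s))))%:E)%E.
  transitivity (\int[mu]_(t in Rp) \sum_(0 <= m <oo) (expR (- (s * t)) * heat_kernel (a + m%:R * b) t)%:E)%E.
    apply: eq_integral => t _.
    have c := @is_cvg_heat_series _ _ t a0 b0.
    have [c3 ->] := mulr_lim_series (expR (- (s * t))) c.
    rewrite -EFin_lim//; congr (lim (_ @ \oo)); apply/funext => n /=.
    by rewrite /series /= sumEFin.
  rewrite integral_nneseries//; last 2 first.
    - move=> m; apply/measurable_EFinP; apply: measurable_funTS; apply: measurable_funM => //.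
      exact: measurable_heat_kernel.
    - by move=> m t _; rewrite lee_fin mulr_ge0 ?expR_ge0 ?heat_kernel_ge0 ?(ltW (dm m)).
  transitivity (\sum_(0 <= m <oo) (geometric (expR (- (a * Num.sqrt s))) (expR (- (b * Num.sqrt s))) m)%:E)%E.
    apply: eq_eseriesr => m _.
    have [hi hl] := heat_kernel_laplace (dm m) s0.
    rewrite -[LHS]fineK; last exact: integrable_fin_num.
    rewrite [X in X%:E = _](_ : _ = laplace (heat_kernel (a + m%:R * b)) s)// hl.
    by rewrite /geometric /= -expRM_natl -expRD; congr (expR _)%:E; ring.
  apply/cvg_lim => //.
  rewrite (_ : (fun n => _) = EFin \o series (geometric (expR (- (a * Num.sqrt s))) (expR (- (b * Num.sqrt s))))).
    apply: cvg_EFin; first exact: nearW.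
    exact: cvg_geometric_series.
  by apply/funext => n /=; rewrite /series /= sumEFin.
split; last by rewrite /laplace /Rintegral I.
apply/integrableP; split.
  apply/measurable_EFinP; apply: measurable_funTS; apply: measurable_funM => //.
  exact: measurable_heat_series.
under eq_integral => t _ do rewrite gee0_abs ?lee_fin ?mulr_ge0 ?expR_ge0 ?heat_series_ge0//.
by rewrite I ltry.
Qed.
End HeatSeries.

(** * Weighted bounds for convolutions *)

Section LaplaceConvolution.
Context {R : realType}.
Local Notation mu := (@lebesgue_measure R).
Local Notation Rp := (`]0%R, +oo[%classic : set R).

(** Both factors are cut off to []0, +oo[] and integrated over the whole line, so that translation
    invariance and Fubini apply without moving limits of integration. *)
Definition conv (k w : R -> R) (t : R) : R :=
  \int[mu]_r ((k \_ Rp) r * (w \_ Rp) (t - r)).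

(** A positive factor also commutes with infinite positive or negative parts. This matters because
    the integrand of [conv k w t] may fail to be integrable for exceptional [t], while the weight
    has to be pulled out for every [t]. *)
Lemma Rintegral_pZl (f : R -> R) (c : R) : measurable_fun [set: R] f -> 0 < c ->
  \int[mu]_r (c * f r) = c * \int[mu]_r f r.
Proof.
move=> mf c0; rewrite /Rintegral integralE [in RHS]integralE.
have fineM' (x : \bar R) : c * fine x = fine (c%:E * x)%E.
  case: x => [x| |] //=; rewrite mulr0; first by rewrite gt0_muley ?lte_fin.
  by rewrite gt0_muleNy ?lte_fin.
have E1 : (\int[mu]_x (fun x0 => (c * f x0)%:E)^\+ x = c%:E * \int[mu]_x (fun x0 => (f x0)%:E)^\+ x)%E.
  rewrite -ge0_integralZl//; last 2 first.
  - by apply: measurable_funepos; exact/measurable_EFinP.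
  - by rewrite lee_fin ltW.
  apply: eq_integral => x _; rewrite !funeposE /= -!EFin_max -EFinM; congr EFin.
  by rewrite maxr_pMr ?ltW// mulr0.
have E2 : (\int[mu]_x (fun x0 => (c * f x0)%:E)^\- x = c%:E * \int[mu]_x (fun x0 => (f x0)%:E)^\- x)%E.
  rewrite -ge0_integralZl//; last 2 first.
  - by apply: measurable_funeneg; exact/measurable_EFinP.
  - by rewrite lee_fin ltW.
  apply: eq_integral => x _; rewrite !funenegE /= -!EFin_max -EFinM; congr EFin.
  by rewrite maxr_pMr ?ltW// mulr0 mulrN.
rewrite E1 E2 fineM'; congr fine.
move: (integral _ _ _) (integral _ _ _) => x y.
by case: x => [x| |]; case: y => [y| |] //;
  rewrite ?gt0_muley ?gt0_muleNy ?lte_fin// -?EFinM -?EFinN -?EFinD ?mulrBr// ?gt0_muley ?gt0_muleNy ?lte_fin.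
Qed.

Lemma laplace_integrableT (w : R -> R) (s : R) : laplace_integrable w s ->
  mu.-integrable setT (fun r => (expR (- (s * r)) * (w \_ Rp) r)%:E) /\
  \int[mu]_r (expR (- (s * r)) * (w \_ Rp) r) = laplace w s.
Proof.
move=> wi.
have E r : expR (- (s * r)) * (w \_ Rp) r = ((fun r => expR (- (s * r)) * w r) \_ Rp) r.
  by rewrite !patchE; case: ifP => //; rewrite mulr0.
split.
  apply: (@eqR_integrable _ _ (fun r => (((fun r => expR (- (s * r)) * w r) \_ Rp) r)%:E)) => //.
    by move=> r _; rewrite E.
  rewrite -[X in mu.-integrable _ X]/(EFin \o _) -restrict_EFin.
  by apply/(integrable_mkcond _ _).1 => //; exact: measurable_itv.
by rewrite /laplace [RHS]Rintegral_mkcond; apply: eq_Rintegral => r _; rewrite E.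
Qed.

Lemma measurable_laplace_integrand (w : R -> R) (s : R) : laplace_integrable w s ->
  measurable_fun [set: R] (w \_ Rp).
Proof.
move=> /laplace_integrableT[/integrableP[/measurable_EFinP mw _] _].
apply: (eq_measurable_fun (fun r : R => expR (s * r) * (expR (- (s * r)) * (w \_ Rp) r))).
  by move=> r _; rewrite mulrA -expRD subrr expR0 mul1r.
apply: measurable_funM => //; apply: measurableT_comp => //; exact: measurable_funM.
Qed.

Lemma conv_laplace (k w : R -> R) (s : R) :
  laplace_integrable k s -> laplace_integrable w s ->
  laplace_integrable (conv k w) s /\
  laplace (conv k w) s = laplace k s * laplace w s.
Proof.
move=> ki wi.
have mk := measurable_laplace_integrand ki; have mw := measurable_laplace_integrand wi.
have [fi <-] := laplace_integrableT ki; have [gi <-] := laplace_integrableT wi.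
have [hi <-] := integral_convolution fi gi.
have E (t : R) : \int[mu]_r (expR (- (s * r)) * (k \_ Rp) r * (expR (- (s * (t - r))) * (w \_ Rp) (t - r))) =
    expR (- (s * t)) * conv k w t.
  rewrite -Rintegral_pZl ?expR_gt0//; last first.
    apply: measurable_funM => //; apply: (measurableT_comp mw); exact: measurable_funB.
  apply: eq_Rintegral => r _.
  rewrite [expR (- (s * t))](_ : _ = expR (- (s * r)) * expR (- (s * (t - r)))); first by ring.
  by rewrite -expRD; congr expR; ring.
split.
  apply: (@eqR_integrable _ _ (fun t : R => (\int[mu]_r (expR (- (s * r)) * (k \_ Rp) r *
    (expR (- (s * (t - r))) * (w \_ Rp) (t - r))))%:E)); first exact: measurable_itv.
    by move=> t _; rewrite E.
  exact: integrableS hi.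
rewrite /laplace [LHS]Rintegral_mkcond; apply: eq_Rintegral => t _.
rewrite E patchE; case: ifPn => //.
rewrite notin_setE/= in_itv/= andbT => /negP; rewrite -leNgt => t0.
rewrite (_ : conv k w t = 0) ?mulr0//.
rewrite /conv; under eq_Rintegral => r _.
  rewrite (_ : _ * _ = 0); first over.
  rewrite !patchE; case: ifPn => [|_]; last by rewrite mul0r.
  rewrite inE/= in_itv/= andbT => r0; case: ifPn => [|_]; last by rewrite mulr0.
  by rewrite inE/= in_itv/= andbT subr_gt0 => rt; have := lt_trans r0 (lt_le_trans rt t0); rewrite ltxx.
by rewrite /Rintegral integral0.
Qed.

Lemma laplaceD (v w : R -> R) s : laplace_integrable v s -> laplace_integrable w s ->
  laplace_integrable (fun t => v t + w t) s /\ laplace (fun t => v t + w t) s = laplace v s + laplace w s.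
Proof.
move=> vi wi.
have E (t : R) : expR (- (s * t)) * (v t + w t) = expR (- (s * t)) * v t + expR (- (s * t)) * w t.
  exact: mulrDr.
split.
  apply: (@eqR_integrable _ _ (fun t => (expR (- (s * t)) * v t + expR (- (s * t)) * w t)%:E)).
  - exact: measurable_itv.
  - by move=> t _; rewrite -E.
  - exact: integrableRD.
rewrite /laplace -RintegralD//; by apply: eq_Rintegral => t _; rewrite -E.
Qed.

(** Only large [s] count: kernels and modes have different abscissas of convergence, and agreement
    near [+oo] is all that uniqueness needs. *)
Definition has_laplace (w F : R -> R) : Prop :=
  \forall s \near +oo, laplace_integrable w s /\ laplace w s = F s.

Lemma has_laplace_eq (w F G : R -> R) : (\forall s \near +oo, F s = G s) ->
  has_laplace w F -> has_laplace w G.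
Proof. by move=> FG wF; near=> s; rewrite -(near FG s)//; exact: (near wF s). Unshelve. all: by end_near. Qed.

Lemma has_laplaceD (v w F G : R -> R) : has_laplace v F -> has_laplace w G ->
  has_laplace (fun t => v t + w t) (fun s => F s + G s).
Proof.
move=> vF wG; near=> s.
have [vi <-] : laplace_integrable v s /\ laplace v s = F s by near: s.
have [wi <-] : laplace_integrable w s /\ laplace w s = G s by near: s.
exact: laplaceD.
Unshelve. all: by end_near. Qed.

Lemma has_laplaceZ (c : R) (w F : R -> R) : has_laplace w F ->
  has_laplace (fun t => c * w t) (fun s => c * F s).
Proof.
move=> wF; near=> s.
have [wi <-] : laplace_integrable w s /\ laplace w s = F s by near: s.
have E (t : R) : expR (- (s * t)) * (c * w t) = c * (expR (- (s * t)) * w t) by ring.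
split.
  apply: (@eqR_integrable _ _ (fun t => (c * (expR (- (s * t)) * w t))%:E)).
  - exact: measurable_itv.
  - by move=> t _; rewrite -E.
  - exact: integrableRZl.
rewrite /laplace -RintegralZl//; by apply: eq_Rintegral => t _; rewrite -E.
Unshelve. all: by end_near. Qed.

Lemma has_laplaceM (k w F G : R -> R) : has_laplace k F -> has_laplace w G ->
  has_laplace (conv k w) (fun s => F s * G s).
Proof.
move=> kF wG; near=> s.
have [ki <-] : laplace_integrable k s /\ laplace k s = F s by near: s.
have [wi <-] : laplace_integrable w s /\ laplace w s = G s by near: s.
exact: conv_laplace.
Unshelve. all: by end_near. Qed.

Lemma has_laplace_uniq (v w F : R -> R) : has_laplace v F -> has_laplace w F ->
  {ae mu, forall t, 0 < t -> v t = w t}.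
Proof.
move=> vF wF.
have : has_laplace (fun t => v t + (- 1) * w t) (fun s => F s + (- 1) * F s).
  by apply: has_laplaceD => //; exact: has_laplaceZ.
move=> /(@has_laplace_eq _ _ (fun=> 0)) h.
have /laplace_uniq : has_laplace (fun t => v t + (- 1) * w t) (fun=> 0).
  by apply: h; apply: nearW => s; rewrite mulN1r subrr.
apply: ae_imply => t h0 t0; apply/eqP; rewrite -subr_eq0 -mulN1r; exact/eqP/h0.
Qed.

(** The term [n ^ 2 W] of the mode equation shifts the transform variable to [s + n ^ 2]; in time
    this is damping, so one kernel per symbol serves every mode. *)
Definition damp (n : nat) (k : R -> R) (t : R) : R := expR (- (n%:R ^+ 2 * t)) * k t.

Lemma has_laplace_damp (n : nat) (k F : R -> R) : has_laplace k F ->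
  has_laplace (damp n k) (fun s => F (s + n%:R ^+ 2)).
Proof.
move=> /near_pinfty_ge[s0 s00 H]; near=> s.
have [|ki <-] := H (s + n%:R ^+ 2).
  by rewrite (@le_trans _ _ s)// ?lerDl ?sqr_ge0//; near: s; apply: nbhs_pinfty_ge; exact: num_real.
have E (t : R) : expR (- (s * t)) * damp n k t = expR (- ((s + n%:R ^+ 2) * t)) * k t.
  by rewrite /damp mulrA -expRD; congr (expR _ * _); ring.
split; first by apply: eqR_integrable ki => // t _; rewrite E.
by apply: eq_Rintegral => t _; rewrite E.
Unshelve. all: by end_near. Qed.
End LaplaceConvolution.

Section EuclideanNorm.
Context {R : realType}.
Implicit Types (a b : nat -> R) (m : nat).

(** Modes are numbered from 1. The truncation at [m] keeps every sum finite; [m] is released only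
    when a function is recovered from its coefficients. *)
Definition l2 m a : R := Num.sqrt (\sum_(1 <= n < m) a n ^+ 2).

Lemma l2_ge0 m a : 0 <= l2 m a. Proof. exact: sqrtr_ge0. Qed.

Lemma sqr_l2 m a : l2 m a ^+ 2 = \sum_(1 <= n < m) a n ^+ 2.
Proof. by rewrite sqr_sqrtr// sumr_ge0// => n _; exact: sqr_ge0. Qed.

Lemma le_l2 m a n : (1 <= n < m)%N -> `|a n| <= l2 m a.
Proof.
move=> nm; rewrite -sqrtr_sqr ler_sqrt; last first.
  by apply: sumr_ge0 => i _; exact: sqr_ge0.
rewrite (bigD1_seq n) ?mem_index_iota ?iota_uniq//= lerDl.
by apply: sumr_ge0 => i _; exact: sqr_ge0.
Qed.

Lemma l2_cauchy_schwarz m a b : \sum_(1 <= n < m) a n * b n <= l2 m a * l2 m b.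
Proof.
have [a0|a0] := eqVneq (l2 m a) 0.
  rewrite a0 mul0r big_nat_cond big1// => n; rewrite andbT => nm.
  have := le_l2 a nm; rewrite a0 normr_le0 => /eqP ->; exact: mul0r.
have [b0|b0] := eqVneq (l2 m b) 0.
  rewrite b0 mulr0 big_nat_cond big1// => n; rewrite andbT => nm.
  have := le_l2 b nm; rewrite b0 normr_le0 => /eqP ->; exact: mulr0.
have A0 : 0 < l2 m a by rewrite lt_neqAle eq_sym a0 l2_ge0.
have B0 : 0 < l2 m b by rewrite lt_neqAle eq_sym b0 l2_ge0.
set A := l2 m a in A0 *; set B := l2 m b in B0 *.
have : 0 <= \sum_(1 <= n < m) (B * a n - A * b n) ^+ 2.
  by apply: sumr_ge0 => n _; exact: sqr_ge0.
have E n : (B * a n - A * b n) ^+ 2 =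
  B ^+ 2 * a n ^+ 2 + (A ^+ 2 * b n ^+ 2 + (- (2 * A * B)) * (a n * b n)) by ring.
under eq_bigr do rewrite E.
rewrite !big_split/= -!mulr_sumr -!sqr_l2 -/A -/B.
set S := \sum_(_ <= _ < _) _ => h.
have : 0 <= 2 * A * B * (A * B - S) by move: h; congr (_ <= _); ring.
by rewrite pmulr_rge0 ?mulr_gt0// subr_ge0.
Qed.

Lemma l2D m a b : l2 m (fun n => a n + b n) <= l2 m a + l2 m b.
Proof.
rewrite -[leRHS]ger0_norm ?addr_ge0 ?l2_ge0// -sqrtr_sqr ler_sqrt ?sqr_ge0//.
under eq_bigr => n _ do rewrite sqrrD.
rewrite !big_split/= -!sqr_l2 sqrrD mulr2n lerD2r lerD2l lerD//;
  exact: l2_cauchy_schwarz.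
Qed.

Lemma l2Z m c a : l2 m (fun n => c * a n) = `|c| * l2 m a.
Proof.
rewrite /l2; under eq_bigr => n _ do rewrite exprMn.
by rewrite -mulr_sumr sqrtrM ?sqr_ge0// sqrtr_sqr.
Qed.

Lemma l2_norm m a : l2 m (fun n => `|a n|) = l2 m a.
Proof.
by congr Num.sqrt; apply: eq_bigr => n _; rewrite real_normK ?num_real.
Qed.
End EuclideanNorm.

Section ConvolutionBound.
Context {R : realType}.
Local Notation mu := (@lebesgue_measure R).
Local Notation Rp := (`]0%R, +oo[%classic : set R).

Lemma ae_subl (P : R -> Prop) (t : R) :
  {ae mu, forall u, P u} -> {ae mu, forall r, P (t - r)}.
Proof.
move=> [A [mA A0 PA]].
have mN : measurable ((-%R : R -> R) @^-1` A).
  rewrite -[X in measurable X]setTI.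
  have : measurable_fun [set: R] (-%R : R -> R) by apply: measurable_funN; exact: measurable_id.
  by apply.
have ms : measurable ((fun x : R => x - t) @^-1` ((-%R : R -> R) @^-1` A)).
  rewrite -[X in measurable X]setTI.
  have : measurable_fun [set: R] (fun x : R => x - t) by exact: measurable_funB.
  by apply.
exists ((fun x : R => x - t) @^-1` ((-%R : R -> R) @^-1` A)); split => //.
  have := lebesgue_measure_shift t mN; rewrite /pushforward => ->.
  by have := lebesgue_measureN mA; rewrite /pushforward => ->.
by move=> r /= nP; rewrite opprB; exact: PA.
Qed.

Lemma integrable_ae_le (f g : R -> R) : measurable_fun setT f ->
  mu.-integrable setT (EFin \o g) -> {ae mu, forall r, `|f r| <= g r} ->
  mu.-integrable setT (EFin \o f).
Proof.
move=> mf gi fg; have mg : measurable_fun setT g by case/integrableP : gi => /measurable_EFinP.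
apply/integrableP; split; first exact/measurable_EFinP.
have gn : (\int[mu]_x `|(g x)%:E| < +oo)%E by case/integrableP : gi.
apply: le_lt_trans gn; apply: ae_ge0_le_integral => //.
- by apply: measurableT_comp => //; exact/measurable_EFinP.
- by apply: measurableT_comp => //; exact/measurable_EFinP.
- by apply: ae_imply fg => r h _; rewrite lee_fin (le_trans h)// ler_norm.
Qed.

Lemma le_Rintegral_ae (f g : R -> R) : mu.-integrable setT (EFin \o f) ->
  mu.-integrable setT (EFin \o g) -> {ae mu, forall r, f r <= g r} ->
  \int[mu]_r f r <= \int[mu]_r g r.
Proof.
move=> fi gi fg; rewrite -subr_ge0 -RintegralB//.
have hi : mu.-integrable setT (fun r => (g r - f r)%:E) by exact: integrableRB.
have mh : measurable_fun setT (fun r : R => (g r - f r)%:E) := measurable_int _ hi.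
have e : (\int[mu]_r (g r - f r)%:E = \int[mu]_r `|(g r - f r)%:E|)%E.
  apply: ae_eq_integral => //; first exact: measurableT_comp.
  by apply: ae_imply fg => r h _; rewrite gee0_abs// lee_fin subr_ge0.
by rewrite /Rintegral e fine_ge0// integral_ge0.
Qed.

Lemma Rintegral_sum_nat (D : set R) (m : nat) (f : nat -> R -> R) : measurable D ->
  (forall n, (1 <= n < m)%N -> mu.-integrable D (EFin \o f n)) ->
  mu.-integrable D (fun r => (\sum_(1 <= n < m) f n r)%:E) /\
  \int[mu]_(r in D) (\sum_(1 <= n < m) f n r) = \sum_(1 <= n < m) \int[mu]_(r in D) f n r.
Proof.
move=> mD; elim: m => [|[|m] IH] fi; [| |have [|i1 e1] := IH].
1,2: rewrite big_geq//; split; [by under eq_fun do rewrite big_geq//; exact: integrable0|].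
1,2: by under eq_Rintegral do rewrite big_geq//; rewrite /Rintegral integral0.
  by move=> n /andP[n1 nm]; apply: fi; rewrite n1/= (ltn_trans nm).
have i2 := fi m.+1 (ltnSn _).
split.
  by under eq_fun do rewrite big_nat_recr//=; exact: integrableRD.
under eq_Rintegral do rewrite big_nat_recr//=.
by rewrite RintegralD// e1 [in RHS]big_nat_recr.
Qed.

(* Minkowski's integral inequality, obtained by pairing the left-hand vector with
   itself; the damping factors are at most 1, so a single kernel majorant serves
   all modes. *)
Lemma conv_l2_le (m : nat) (T s B : R) (k kb : R -> R) (w : nat -> R -> R) :
  0 <= B -> measurable_fun setT (k \_ Rp) ->
  (forall n, measurable_fun setT (w n \_ Rp)) ->
  (forall t, 0 < t < T -> `|k t| <= kb t) -> (forall t, 0 <= kb t) ->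
  laplace_integrable kb s ->
  {ae mu, forall t, 0 < t < T -> l2 m (w ^~ t) <= B * expR (s * t)} ->
  forall t, 0 < t < T ->
    l2 m (fun n => conv (damp n k) (w n) t) <= laplace kb s * B * expR (s * t).
Proof.
move=> B0 mk mw kkb kb0 kbi wB t /andP[t0 tT].
pose a n := conv (damp n k) (w n) t.
pose f n r := (damp n k \_ Rp) r * (w n \_ Rp) (t - r).
pose G r := expR (- (s * r)) * (kb \_ Rp) r * (B * expR (s * t)).
have [Gi0 Ge0] := laplace_integrableT kbi.
have Gi : mu.-integrable setT (EFin \o G).
  apply: (@eqR_integrable _ _ (fun r => ((B * expR (s * t)) * (expR (- (s * r)) * (kb \_ Rp) r))%:E)) => //.
    by move=> r _; rewrite /G mulrC.
  exact: integrableRZl.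
have GE : \int[mu]_r G r = laplace kb s * B * expR (s * t).
  by rewrite /G RintegralZr// Ge0 mulrA.
have G_ge0 r : 0 <= G r.
  rewrite mulr_ge0//; last by rewrite mulr_ge0// expR_ge0.
  by rewrite mulr_ge0 ?expR_ge0// patchE; case: ifP.
have mf n : measurable_fun setT (f n).
  apply: measurable_funM; last first.
    by apply: (measurableT_comp (mw n)); exact: measurable_funB.
  apply: (eq_measurable_fun (fun r : R => expR (- (n%:R ^+ 2 * r)) * (k \_ Rp) r)).
    by move=> r _; rewrite !patchE; case: ifP => //; rewrite mulr0.
  apply: measurable_funM => //; apply: measurableT_comp => //.
  by apply: measurableT_comp => //; exact: measurable_funM.
(* A single null set serves all vectors [c]: signed coordinate vectors yield integrability of each
   [f n], and [c = a] yields the estimate itself. *)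
have key : {ae mu, forall r, forall c : nat -> R,
    \sum_(1 <= n < m) c n * f n r <= l2 m c * G r}.
  apply: ae_imply (ae_subl t wB) => r wr c.
  have null : (forall n, f n r = 0) -> \sum_(1 <= n < m) c n * f n r <= l2 m c * G r.
    move=> f0; rewrite big1; last by move=> n _; rewrite f0 mulr0.
    by apply: mulr_ge0; [exact: l2_ge0|exact: G_ge0].
  (* Causality: only [0 < r < t] contributes, so bounds on []0, T[] for kernel and data suffice. *)
  have [r0|r0] := leP r 0.
    apply: null => n; rewrite /f patchE memNset ?mul0r//= in_itv/= andbT.
    by apply/negP; rewrite -leNgt.
  have [tr|tr] := leP t r.
    apply: null => n; rewrite /f [X in _ * X]patchE memNset ?mulr0//= in_itv/= andbT.
    by apply/negP; rewrite -leNgt subr_le0.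
  have {}wr := wr _; rewrite subr_gt0 tr/= in wr.
  have {}wr : l2 m (w ^~ (t - r)) <= B * expR (s * (t - r)).
    by apply: wr; rewrite ltrBlDr (lt_trans tT)// ltrDl.
  have fE n : f n r = expR (- (n%:R ^+ 2 * r)) * k r * w n (t - r).
    by rewrite /f !patchE !mem_set//= in_itv/= andbT ?subr_gt0.
  have kr : `|k r| <= kb r by apply: kkb; rewrite r0 (lt_trans tr).
  apply: (@le_trans _ _ (\sum_(1 <= n < m) `|c n| * (kb r * `|w n (t - r)|))).
    apply: ler_sum => n _; rewrite fE (le_trans (ler_norm _))// normrM ler_wpM2l//.
    rewrite normrM ler_wpM2r// normrM -[leRHS]mul1r ler_pM//.
    by rewrite ger0_norm ?expR_ge0// expR_le1 oppr_le0 mulr_ge0 ?sqr_ge0// ltW.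
  under eq_bigr => n _ do rewrite mulrCA.
  rewrite -mulr_sumr.
  apply: (@le_trans _ _ (kb r * (l2 m c * l2 m (w ^~ (t - r))))).
    rewrite ler_wpM2l//; apply: le_trans (l2_cauchy_schwarz _ _ _) _.
    by rewrite !l2_norm.
  rewrite mulrCA ler_wpM2l ?l2_ge0// /G patchE mem_set/= ?in_itv/= ?r0//.
  rewrite (_ : _ * kb r * _ = kb r * (B * (expR (s * t) * expR (- (s * r))))); last by ring.
  rewrite ler_wpM2l// (le_trans wr)// -expRD; rewrite le_eqVlt; apply/orP; left; apply/eqP.
  by congr (_ * expR _); ring.
have fi n : (1 <= n < m)%N -> mu.-integrable setT (EFin \o f n).
  move=> nm; apply: integrable_ae_le Gi _ => //.
  apply: ae_imply key => r h.
  have h1 (e : R) : `|e| = 1 -> e * f n r <= G r.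
    move=> e1; have := h (fun i => if i == n then e else 0).
    rewrite (bigD1_seq n) ?mem_index_iota ?iota_uniq//= eqxx big1 ?addr0; last first.
      by move=> i /negPf ->; rewrite mul0r.
    move=> /le_trans; apply; rewrite -[leRHS]mul1r ler_wpM2r//.
    rewrite /l2 (bigD1_seq n) ?mem_index_iota ?iota_uniq//= eqxx big1 ?addr0; last first.
      by move=> i /negPf ->; rewrite expr0n.
    by rewrite sqrtr_sqr e1.
  have := h1 1 (normr1 _); have := h1 (- 1) (normrN1 _).
  by rewrite mul1r mulN1r ler_norml => h2 h3; rewrite h3 andbT lerNl.
have cfi n : (1 <= n < m)%N -> mu.-integrable setT (EFin \o (fun r => a n * f n r)).
  by move=> nm; apply: integrableRZl => //; exact: fi.
have [si se] := Rintegral_sum_nat measurableT cfi.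
have E : l2 m a ^+ 2 = \int[mu]_r (\sum_(1 <= n < m) a n * f n r).
  rewrite se sqr_l2; apply: eq_big_nat => n nm.
  by rewrite RintegralZl//; exact: fi.
have : l2 m a ^+ 2 <= l2 m a * (laplace kb s * B * expR (s * t)).
  rewrite E -GE -RintegralZl//; apply: le_Rintegral_ae => //.
    by apply: integrableRZl.
  by apply: ae_imply key => r h; exact: h.
have [->|a0] := eqVneq (l2 m a) 0.
  move=> _; rewrite !mulr_ge0 ?expR_ge0// Rintegral_ge0// => r _.
  by rewrite mulr_ge0 ?expR_ge0.
by rewrite expr2 ler_pM2l// lt_neqAle eq_sym a0 l2_ge0.
Qed.
End ConvolutionBound.

(** * Optimization of the weight *)

Section Numeric.
Context {R : realType}.

Lemma expR_le_invB (v : R) : v < 1 -> expR v <= (1 - v)^-1.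
Proof.
move=> v1; rewrite -[leLHS]invrK -expRN lef_pV2 ?posrE ?expR_gt0 ?subr_gt0//.
exact: expR_ge1Dx.
Qed.

Definition contraction (c E : R) : R := (4 + c * E) * E ^+ 2 / (1 - E ^+ 2) ^+ 2.

Definition nnwr_factor (k : nat) (x : R) : R :=
  (Num.sqrt 6 / (1 - expR (- ((2 * k%:R + 1) * x)))) ^+ (2 * k) * expR (- (k%:R ^+ 2 * x)).

(* Writing the bound as a [k]-th power reduces it to an inequality per step;
   [y = (k + d) x] leaves the defect [d ^ 2 x] in the exponent. *)
Lemma contraction_le (c d x : R) (k : nat) : (1 <= k)%N -> 0 < x -> 0 < k%:R + d -> 0 <= c ->
  expR (d ^+ 2 * x / k%:R) * (4 + c * expR (- ((k%:R + d) * x))) *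
    (1 - expR (- ((2 * k%:R + 1) * x))) ^+ 2 <=
  6 * (1 - expR (- ((k%:R + d) * x)) ^+ 2) ^+ 2 ->
  expR (((k%:R + d) * x) ^+ 2 / x) * contraction c (expR (- ((k%:R + d) * x))) ^+ k <= nnwr_factor k x.
Proof.
move=> k1 x0 kd0 c0 h.
have k0 : 0 < k%:R :> R by rewrite ltr0n.
set E := expR (- ((k%:R + d) * x)) in h *.
set q := expR (- ((2 * k%:R + 1) * x)) in h *.
have E0 : 0 < E by exact: expR_gt0.
have E1 : E < 1 by rewrite /E expR_lt1 oppr_lt0 mulr_gt0.
have q1 : q < 1 by rewrite /q expR_lt1 oppr_lt0 mulr_gt0// ltr_wpDl// mulr_ge0// ltW.
have EE1 : 0 < 1 - E ^+ 2 by rewrite subr_gt0 exprn_ilt1// ltW.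
have -> : nnwr_factor k x = (6 / (1 - q) ^+ 2) ^+ k * expR (- (k%:R ^+ 2 * x)).
  by rewrite /nnwr_factor exprM expr_div_n sqr_sqrtr.
have -> : expR (((k%:R + d) * x) ^+ 2 / x) = expR (((k%:R + d) ^+ 2 * x) / k%:R) ^+ k.
  rewrite -expRM_natl; congr expR; field; by rewrite !gt_eqF.
have -> : expR (- (k%:R ^+ 2 * x)) = expR (- (k%:R * x)) ^+ k.
  by rewrite -expRM_natl; congr expR; ring.
rewrite -!exprMn; apply: lerXn2r; rewrite ?nnegrE.
- rewrite mulr_ge0 ?expR_ge0// /contraction divr_ge0 ?exprn_ge0 ?(ltW EE1)//.
  by rewrite mulr_ge0 ?exprn_ge0 ?addr_ge0 ?mulr_ge0 ?(ltW E0).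
- by rewrite mulr_ge0 ?expR_ge0// divr_ge0 ?exprn_ge0// subr_ge0 ltW.
have -> : expR ((k%:R + d) ^+ 2 * x / k%:R) =
    expR (d ^+ 2 * x / k%:R) * (expR (- (k%:R * x)) * (E ^+ 2)^-1).
  rewrite /E -expRM_natl -expRN -!expRD; congr expR; field; by rewrite gt_eqF.
rewrite /contraction.
have -> : expR (d ^+ 2 * x / k%:R) * (expR (- (k%:R * x)) / E ^+ 2) *
    ((4 + c * E) * E ^+ 2 / (1 - E ^+ 2) ^+ 2) =
    expR (d ^+ 2 * x / k%:R) * (4 + c * E) / (1 - E ^+ 2) ^+ 2 * expR (- (k%:R * x)).
  by field; rewrite !gt_eqF// exprn_gt0.
rewrite ler_pM2r ?expR_gt0//.
rewrite ler_pdivrMr ?exprn_gt0// [leRHS]mulrAC ler_pdivlMr ?exprn_gt0 ?subr_gt0//.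
Qed.

(* With [r = expR (- (2 / 3) Y)], [Y = (k + 1 / 2) x]: the case [y = 4 / 3 Y] of
   [contraction_small_time]. *)
Let ratio_bound (r : R) : 0 <= r -> r <= 1 ->
  (1 + r ^+ 2) * (1 - r ^+ 3) ^+ 2 <= 9 / 8 * (1 - r ^+ 4) ^+ 2.
Proof.
move=> r0 r1.
rewrite -subr_ge0.
have -> : 9 / 8 * (1 - r ^+ 4) ^+ 2 - (1 + r ^+ 2) * (1 - r ^+ 3) ^+ 2 =
  (1 - r) ^+ 2 * ((1 + r ^+ 2) * (((1 + r) ^+ 2 * (1 + r ^+ 2)) / 8 - r ^+ 2)) by field.
have h1 : 4 * r <= (1 + r) ^+ 2 by have := sqr_ge0 (1 - r); nra.
have h2 : 2 * r <= 1 + r ^+ 2 by have := sqr_ge0 (1 - r); nra.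
apply: mulr_ge0; first exact: sqr_ge0.
apply: mulr_ge0; first by rewrite addr_ge0 ?sqr_ge0.
rewrite subr_ge0.
rewrite ler_pdivlMr// (_ : r ^+ 2 * 8 = (4 * r) * (2 * r)); last by ring.
by rewrite ler_pM// mulr_ge0.
Qed.

(** With [x = h_min ^ 2 / T] this is the range [T >= 4 h_min ^ 2]. No single offset [d] works for
    every [k] with [c = 4]: a larger [d] lowers [E] but costs [d ^ 2 x / k] in the exponent. *)
Lemma contraction_small_time (x : R) (k : nat) : (1 <= k)%N -> 0 < x -> x <= 1 / 4 ->
  exists2 y, 0 < y & expR (y ^+ 2 / x) * contraction 4 (expR (- y)) ^+ k <= nnwr_factor k x.
Proof.
move=> k1 x0 x4.
have k0 : 0 < k%:R :> R by rewrite ltr0n.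
have k1' : 1 <= k%:R :> R by rewrite ler1n.
have [hx|hx] := leP ((k%:R + 2) ^+ 2 * x) (9 / 4 * k%:R).
  (* This [d] makes both exponentials powers of one [r], namely [E = r ^ 2] and [r ^ 3]. The case
     hypothesis says exactly [d ^ 2 x / k <= 1 / 4]; then [exp (1 / 4) <= 4 / 3], and
     [4 / 3 * 4 * 9 / 8 = 6]. *)
  pose d : R := (k%:R + 2) / 3.
  have kd0 : 0 < k%:R + d by rewrite /d; lra.
  exists ((k%:R + d) * x); first by rewrite mulr_gt0.
  apply: contraction_le => //.
  have e1 : expR (d ^+ 2 * x / k%:R) <= 4 / 3.
    have h : d ^+ 2 * x / k%:R <= 1 / 4.
      by rewrite ler_pdivrMr// /d; move: hx; rewrite !expr2; lra.
    apply: (le_trans (expR_le_invB _)); first by lra.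
    by rewrite -[leRHS]invrK lef_pV2 ?posrE ?invr_gt0; lra.
  pose r := expR (- ((2 * k%:R + 1) / 3 * x)).
  have r0 : 0 <= r by exact: expR_ge0.
  have r1 : r <= 1 by rewrite /r expR_le1 oppr_le0 mulr_ge0 ?(ltW x0)//; lra.
  have -> : expR (- ((k%:R + d) * x)) = r ^+ 2.
    by rewrite /r -expRM_natl; congr expR; rewrite /d; field.
  have -> : expR (- ((2 * k%:R + 1) * x)) = r ^+ 3.
    by rewrite /r -expRM_natl; congr expR; field.
  have := ratio_bound r0 r1; rewrite -exprM => h.
  apply: (@le_trans _ _ (4 / 3 * (4 * ((1 + r ^+ 2) * (1 - r ^+ 3) ^+ 2)))).
    rewrite -mulrA ler_pM ?expR_ge0//.
      by rewrite mulr_ge0 ?sqr_ge0// addr_ge0// mulr_ge0// sqr_ge0.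
    by rewrite le_eqVlt; apply/orP; left; apply/eqP; ring.
  apply: (@le_trans _ _ (4 / 3 * (4 * (9 / 8 * (1 - r ^+ 4) ^+ 2)))).
    by rewrite ler_pM2l// ler_pM2l.
  by rewrite le_eqVlt; apply/orP; left; apply/eqP; field.
(* Now [exp (- ((2 k + 1) x)) = E ^ 2], so the squared factors on both sides coincide and only
   [exp (x / (4 k)) (4 + 4 E) <= 6] remains. *)
pose d : R := 1 / 2.
have kd0 : 0 < k%:R + d by rewrite /d; lra.
exists ((k%:R + d) * x); first by rewrite mulr_gt0.
apply: contraction_le => //.
have -> : expR (- ((2 * k%:R + 1) * x)) = expR (- ((k%:R + d) * x)) ^+ 2.
  by rewrite -expRM_natl; congr expR; rewrite /d; field.
rewrite ler_wpM2r ?sqr_ge0//.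
(* For [1 <= k <= 4] one has [(k + 2) ^ 2 <= 9 k], which together with [x <= 1 / 4] contradicts the
   case hypothesis. *)
have k5 : 5 <= k%:R :> R.
  rewrite ler_nat ltnNge; apply/negP => k4; move: hx; apply/negP; rewrite -leNgt.
  have k4' : k%:R <= 4 :> R by rewrite ler_nat.
  apply: (@le_trans _ _ ((k%:R + 2) ^+ 2 * (1 / 4))).
    by rewrite ler_wpM2l ?sqr_ge0.
  by rewrite expr2; nra.
have Y1 : 1 <= (k%:R + d) * x.
  have : (k%:R + 2) ^+ 2 <= 9 / 4 * k%:R * (k%:R + d) by rewrite expr2 /d; nra.
  move=> h; have k2 : 0 < (k%:R + 2) ^+ 2 :> R by rewrite exprn_gt0//; lra.
  rewrite -(ler_pM2l k2) mulr1 (le_trans h)// mulrA [leRHS]mulrAC.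
  by rewrite ler_wpM2r ?(ltW kd0)// ltW.
have e1 : expR (d ^+ 2 * x / k%:R) <= 80 / 79.
  have h : d ^+ 2 * x / k%:R <= 1 / 80 by rewrite ler_pdivrMr// /d; nra.
  apply: (le_trans (expR_le_invB _)); first by lra.
  by rewrite -[leRHS]invrK lef_pV2 ?posrE ?invr_gt0; lra.
have e2 : expR (- ((k%:R + d) * x)) <= 4 / 9.
  rewrite (_ : - _ = 2%:R * (- ((k%:R + d) * x / 2))); last by field.
  rewrite expRM_natl (_ : 4 / 9 = (2 / 3) ^+ 2); last by field.
  rewrite lerXn2r ?nnegrE ?expR_ge0//.
  apply: (le_trans (expR_le_invB _)); first by lra.
  by rewrite -[leRHS]invrK lef_pV2 ?posrE ?invr_gt0; lra.
apply: (@le_trans _ _ (80 / 79 * (4 + 4 * (4 / 9)))); last by lra.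
have E0 := expR_ge0 (- ((k%:R + d) * x)).
by apply: ler_pM => //; lra.
Qed.

(** Here [c = 2]. The offset [d = 1 / 2] works until its cost [x / (4 k)] becomes too large; beyond
    [x = 11 / 10 k] the exponentials are so small that [d = 0] suffices. The bound [k x <= y] serves
    to make [y] positive. *)
Lemma contraction_large_time (x : R) (k : nat) : (1 <= k)%N -> 0 < x ->
  exists2 y, k%:R * x <= y & expR (y ^+ 2 / x) * contraction 2 (expR (- y)) ^+ k <= nnwr_factor k x.
Proof.
move=> k1 x0.
have k0 : 0 < k%:R :> R by rewrite ltr0n.
have k1' : 1 <= k%:R :> R by rewrite ler1n.
have [hx|hx] := leP (10 * x) (11 * k%:R).
  pose d : R := 1 / 2.
  have kd0 : 0 < k%:R + d by rewrite /d; lra.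
  exists ((k%:R + d) * x); first by rewrite ler_wpM2r ?(ltW x0)// lerDl /d; lra.
  apply: contraction_le => //.
  have -> : expR (- ((2 * k%:R + 1) * x)) = expR (- ((k%:R + d) * x)) ^+ 2.
    by rewrite -expRM_natl; congr expR; rewrite /d; field.
  rewrite ler_wpM2r ?sqr_ge0//.
  pose v := d ^+ 2 * x / k%:R; rewrite -/v.
  have v1 : v <= 11 / 40 by rewrite /v ler_pdivrMr// /d; lra.
  have v0 : 0 <= v by rewrite divr_ge0 ?mulr_ge0 ?sqr_ge0// ltW.
  pose r := expR (- v).
  have r1 : r <= 1 by rewrite expR_le1 oppr_le0.
  have r2 : 29 / 40 <= r by apply: le_trans (expR_ge1Dx _); lra.
  have r0 : 0 < r by exact: expR_gt0.
  have -> : expR v = r^-1 by rewrite /r expRN invrK.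
  (* [(k + 1 / 2) x >= 6 v] amounts to [(k + 1 / 2) k >= 3 / 2]. What remains is
     [4 + 2 r ^ 6 <= 6 r], an equality at [r = 1] that holds down to [r = 29 / 40], the reach of the
     threshold 11 / 10. *)
  have E6 : expR (- ((k%:R + d) * x)) <= r ^+ 6.
    rewrite /r -expRM_natl ler_expR mulrN lerN2 /v mulrA ler_pdivrMr// /d.
    have h6 : 6 / 4 <= (k%:R + 1 / 2) * k%:R :> R by nra.
    by have := ler_wpM2r (ltW x0) h6; lra.
  rewrite mulrC ler_pdivrMr//.
  apply: (@le_trans _ _ (4 + 2 * r ^+ 6)); first by rewrite lerD2l ler_pM2l.
  rewrite -subr_ge0 (_ : _ - _ = 2 * ((1 - r) * (r + r ^+ 2 + r ^+ 3 + r ^+ 4 + r ^+ 5 - 2))); last by ring.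
  rewrite !mulr_ge0 ?subr_ge0//.
  have p2 : (29 / 40) ^+ 2 <= r ^+ 2 by rewrite lerXn2r ?nnegrE ?(ltW r0)//; lra.
  have p3 : (29 / 40) ^+ 3 <= r ^+ 3 by rewrite lerXn2r ?nnegrE ?(ltW r0)//; lra.
  have p4 : (29 / 40) ^+ 4 <= r ^+ 4 by rewrite lerXn2r ?nnegrE ?(ltW r0)//; lra.
  have p5 : (29 / 40) ^+ 5 <= r ^+ 5 by rewrite lerXn2r ?nnegrE ?(ltW r0)//; lra.
  by lra.
(* Now [k x >= 11 / 10]. As [(2 k + 1) x <= 3 k x], the factor [1 - exp (- ((2 k + 1) x))] is at
   most [1 - q ^ 3], and the claim becomes polynomial in [q]. *)
exists ((k%:R + 0) * x); first by rewrite addr0.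
apply: contraction_le => //; first by rewrite addr0.
rewrite expr0n/= !mul0r expR0 mul1r addr0.
set q := expR (- (k%:R * x)).
have q0 : 0 < q by exact: expR_gt0.
have q1 : q <= 19 / 50.
  have kx : 11 / 10 <= k%:R * x by nra.
  rewrite /q (_ : - _ = 4%:R * (- (k%:R * x / 4))); last by field.
  rewrite expRM_natl.
  apply: (@le_trans _ _ ((40 / 51) ^+ 4)); last by lra.
  rewrite lerXn2r ?nnegrE ?expR_ge0//.
  apply: (le_trans (expR_le_invB _)); first by lra.
  by rewrite -[leRHS]invrK lef_pV2 ?posrE ?invr_gt0; lra.
have e3 : q ^+ 3 <= expR (- ((2 * k%:R + 1) * x)).
  by rewrite /q -expRM_natl ler_expR mulrN lerN2; nra.
have e1 : expR (- ((2 * k%:R + 1) * x)) <= 1.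
  by rewrite expR_le1 oppr_le0 mulr_ge0 ?(ltW x0)//; lra.
apply: (@le_trans _ _ ((4 + 2 * q) * (1 - q ^+ 3) ^+ 2)).
  rewrite ler_wpM2l ?addr_ge0 ?mulr_ge0 ?(ltW q0)// lerXn2r ?nnegrE ?subr_ge0//.
    exact: le_trans e1.
  by rewrite lerD2l lerN2.
have -> : 1 - q ^+ 3 = (1 - q) * (1 + q + q ^+ 2) by ring.
have -> : 1 - q ^+ 2 = (1 - q) * (1 + q) by ring.
rewrite !exprMn mulrCA [leRHS]mulrCA ler_wpM2l ?sqr_ge0//.
have hq : 1 + q + q ^+ 2 <= 21 / 19 * (1 + q) by nra.
apply: (@le_trans _ _ ((4 + 2 * q) * (21 / 19 * (1 + q)) ^+ 2)).
  rewrite ler_wpM2l ?addr_ge0 ?mulr_ge0 ?(ltW q0)// lerXn2r ?nnegrE//.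
    by rewrite !addr_ge0 ?sqr_ge0 ?(ltW q0).
  by rewrite mulr_ge0 ?addr_ge0 ?(ltW q0)//; lra.
rewrite exprMn mulrA ler_wpM2r ?sqr_ge0//; lra.
Qed.
End Numeric.

(** * Completeness of the sines in L^2(0, pi) *)

Section SineSystem.
Context {R : realType}.
Local Notation mu := (@lebesgue_measure R).
Local Notation D := (`]0%R, pi[%classic : set R).

Definition sine (n : nat) (y : R) : R := sin (n%:R * y).

Definition square_integrable (v : R -> R) : Prop :=
  measurable_fun D v /\ mu.-integrable D (fun y => (v y ^+ 2)%:E).

Lemma measurable_0pi : measurable D. Proof. exact: measurable_itv. Qed.
Hint Resolve measurable_0pi : core.

Lemma lebesgue_measure_0pi : mu D = pi%:E.
Proof. by rewrite lebesgue_measure_itv/= lte_fin pi_gt0 oppr0 adde0. Qed.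

Lemma le_integrableR (A : set R) (f g : R -> R) : measurable A -> measurable_fun A f ->
  (forall y, A y -> `|f y| <= g y) -> mu.-integrable A (EFin \o g) ->
  mu.-integrable A (EFin \o f).
Proof.
move=> mA mf fg; apply: le_integrable => //; first exact/measurable_EFinP.
by move=> y Ay; rewrite lee_fin (le_trans (fg y Ay))// ler_norm.
Qed.

Lemma bounded_integrable_0pi (f : R -> R) (M : R) : measurable_fun D f ->
  (forall y, D y -> `|f y| <= M) -> mu.-integrable D (EFin \o f).
Proof.
move=> mf fM; apply: (@le_integrableR _ _ (cst M)) => //.
apply/integrableP; split; first by apply/measurable_EFinP; exact: measurable_cst.
rewrite (eq_integral (cst `|M|%:E))// integral_cst//.
by rewrite [X in (_ * X)%E]lebesgue_measure_0pi -EFinM ltry.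
Qed.

Lemma square_integrableM (f g : R -> R) : square_integrable f -> square_integrable g ->
  mu.-integrable D (fun y => (f y * g y)%:E).
Proof.
move=> [mf fi] [mg gi].
apply: (@le_integrableR _ _ (fun y => f y ^+ 2 + g y ^+ 2)) => //.
- exact: measurable_funM.
- move=> y _; rewrite normrM.
  rewrite -(real_normK (num_real (f y))) -(real_normK (num_real (g y))).
  have := sqr_ge0 (`|f y| - `|g y|); have := sqr_ge0 (`|f y| + `|g y|).
  by rewrite !expr2; lra.
- exact: integrableRD.
Qed.

Lemma square_integrableD (f g : R -> R) : square_integrable f -> square_integrable g ->
  square_integrable (fun y => f y + g y).
Proof.
move=> fs gs; have fgi := square_integrableM fs gs; have [mf fi] := fs; have [mg gi] := gs.
split; first exact: measurable_funD.
apply: (@eqR_integrable _ _ (fun y => (f y ^+ 2 + (2 * (f y * g y) + g y ^+ 2))%:E)) => //.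
  by move=> y _; congr EFin; ring.
apply: integrableRD => //; apply: integrableRD => //; exact: integrableRZl.
Qed.

Lemma square_integrableZ (c : R) (f : R -> R) : square_integrable f ->
  square_integrable (fun y => c * f y).
Proof.
move=> [mf fi]; split; first exact: measurable_funM.
apply: (@eqR_integrable _ _ (fun y => (c ^+ 2 * f y ^+ 2)%:E)) => //.
  by move=> y _; rewrite exprMn.
exact: integrableRZl.
Qed.

Lemma square_integrableB (f g : R -> R) : square_integrable f -> square_integrable g ->
  square_integrable (fun y => f y - g y).
Proof.
move=> fs gs; have [m i] := square_integrableD fs (square_integrableZ (-1) gs).
have E y : f y - g y = f y + (- 1) * g y by rewrite mulN1r.
split; first by apply: eq_measurable_fun m => y _; rewrite E.
by apply: eqR_integrable i => // y _; rewrite E.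
Qed.

Lemma square_integrable_bounded (f : R -> R) (M : R) : measurable_fun D f ->
  (forall y, D y -> `|f y| <= M) -> square_integrable f.
Proof.
move=> mf fM; split => //; apply: (@bounded_integrable_0pi _ (M ^+ 2)); first exact: measurable_funX.
move=> y Dy; rewrite normrX lerXn2r ?nnegrE//; last exact: fM.
by apply: le_trans (fM _ Dy).
Qed.

Lemma square_integrable_sum (m : nat) (f : nat -> R -> R) :
  (forall n, square_integrable (f n)) ->
  square_integrable (fun y => \sum_(1 <= n < m) f n y).
Proof.
move=> fs; have z : square_integrable (fun=> 0).
  by apply: (@square_integrable_bounded _ 0) => // y _; rewrite normr0.
elim: m => [|[|m] IH].
- by under eq_fun do rewrite big_geq//.
- by under eq_fun do rewrite big_geq//.
- by under eq_fun do rewrite big_nat_recr//=; exact: square_integrableD.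
Qed.

Lemma continuous_sine n : continuous (sine n).
Proof.
move=> y; apply: (cvg_comp (fun y => n%:R * y) sin _ (@continuous_sin _ _)).
by apply: cvgM; [exact: cvg_cst|exact: cvg_id].
Qed.

Lemma square_integrable_sine n : square_integrable (sine n).
Proof.
apply: (@square_integrable_bounded _ 1).
  by apply: measurable_funTS; exact: continuous_measurable_fun (@continuous_sine n).
move=> y _; rewrite ler_norml; apply/andP; split; [exact: sin_geN1|exact: sin_le1].
Qed.

Lemma Rintegral_0pi_closed (f : R -> R) : measurable_fun [set: R] f ->
  \int[mu]_(y in D) f y = \int[mu]_(y in `[0, pi]) f y.
Proof.
move=> mf; rewrite /Rintegral integral_itv_bndo_bndc; last first.
  by apply/measurable_EFinP; exact: measurable_funTS.
by rewrite integral_itv_obnd_cbnd//; apply/measurable_EFinP; exact: measurable_funTS.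
Qed.

Lemma Rintegral_cos n : \int[mu]_(y in D) cos (n%:R * y) = if n == 0%N then pi else 0.
Proof.
case: n => [|n] /=.
  under eq_Rintegral do rewrite mul0r cos0.
  by rewrite Rintegral_cst// mul1r [X in fine X]lebesgue_measure_0pi.
pose F (y : R) := n.+1%:R^-1 * sin (n.+1%:R * y).
have n0 : n.+1%:R != 0 :> R by rewrite pnatr_eq0.
have ccos : continuous (fun y : R => cos (n.+1%:R * y)).
  move=> y; apply: (cvg_comp (fun y => n.+1%:R * y) cos _ (@continuous_cos _ _)).
  by apply: cvgM; [exact: cvg_cst|exact: cvg_id].
have dF (y : R) : is_derive y 1 F (cos (n.+1%:R * y)).
  have d1 : is_derive y 1 (fun y : R => n.+1%:R * y) (n.+1%:R * 1).
    exact: (@is_deriveZ _ _ _ _ n.+1%:R _ _ _ (is_derive_id y 1)).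
  have d2 := @is_derive1_comp _ sin _ y _ _ (is_derive_sin (n.+1%:R * y)) d1.
  have d3 := @is_deriveZ _ _ _ _ (n.+1%:R^-1) _ _ _ d2.
  apply: (is_derive_eq d3).
  by rewrite mulr1 /GRing.scale /= mulrCA mulVf// mulr1.
have cF : continuous F.
  move=> y; have [d _] := dF y.
  by apply/differentiable_continuous/derivable1_diffP.
have I : (\int[mu]_(y in `[0%R, pi]) (cos (n.+1%:R * y))%:E = (F pi)%:E - (F 0%R)%:E)%E.
  apply: continuous_FTC2; first exact: pi_gt0.
  - by apply: continuous_subspaceT => y; exact: ccos.
  - split.
    + by move=> y _; have [] := dF y.
    + by apply: cvg_at_right_filter; exact: cF.
    + by apply: cvg_at_left_filter; exact: cF.
  - by move=> y _; rewrite derive1E; have [_ ->] := dF y.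
rewrite Rintegral_0pi_closed; last exact: continuous_measurable_fun ccos.
rewrite /Rintegral I /F mulr0 sin0 mulr0 /=.
have -> : sin (n.+1%:R * pi) = 0 :> R.
  elim: (n.+1) => [|k IH]; first by rewrite mul0r sin0.
  by rewrite -natr1 mulrDl mul1r sinDpi IH oppr0.
by rewrite mulr0 subr0.
Qed.

Lemma sine_orthogonal n m : (1 <= n)%N -> (1 <= m)%N ->
  \int[mu]_(y in D) (sine n y * sine m y) = if n == m then pi / 2 else 0.
Proof.
wlog nm : n m / (n <= m)%N => [H n1 m1|n1 m1].
  have [nm|/ltnW mn] := leqP n m; first exact: H.
  rewrite eq_sym -H//; by apply: eq_Rintegral => y _; rewrite mulrC.
have bc k : mu.-integrable D (fun y : R => (cos (k%:R * y))%:E).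
  apply: (@bounded_integrable_0pi _ 1).
    apply: measurable_funTS; apply: continuous_measurable_fun => y.
    apply: (cvg_comp (fun y => k%:R * y) cos _ (@continuous_cos _ _)).
    by apply: cvgM; [exact: cvg_cst|exact: cvg_id].
  by move=> y _; rewrite ler_norml cos_geN1 cos_le1.
transitivity (\int[mu]_(y in D) (2^-1 * cos ((m - n)%:R * y) - 2^-1 * cos ((m + n)%:R * y))).
  apply: eq_Rintegral => y _.
  by rewrite /sine natrB// natrD mulrBl mulrDl cosB cosD; field.
have Z k : \int[mu]_(y in D) (2^-1 * cos (k%:R * y)) = 2^-1 * (if k == 0%N then pi else 0).
  have := @RintegralZl _ _ R mu D (fun y => cos (k%:R * y)) 2^-1 measurable_0pi (bc k).
  by rewrite Rintegral_cos.
rewrite RintegralB//; [|exact: integrableRZl|exact: integrableRZl].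
rewrite !Z subn_eq0 addn_eq0 eqn0Ngt m1/= mulr0 subr0.
rewrite [in RHS]eqn_leq nm/=; case: ifP => _; last by rewrite mulr0.
by rewrite mulrC.
Qed.

Definition sine_poly (m : nat) (b : nat -> R) (y : R) := \sum_(1 <= n < m) b n * sine n y.

Lemma square_integrable_sine_poly m b : square_integrable (sine_poly m b).
Proof.
by apply: square_integrable_sum => n; apply: square_integrableZ; exact: square_integrable_sine.
Qed.

Lemma sin_coefE (v : R -> R) n :
  \int[mu]_(y in D) (v y * sine n y) = pi / 2 * sin_coef v n.
Proof.
have p0 : pi != 0 :> R by rewrite gt_eqF// pi_gt0.
by rewrite /sin_coef mulrA (_ : pi / 2 * (2 / pi) = 1) ?mul1r// mulrA divfK// divff.
Qed.

(** The least-squares identity, by orthogonality and induction on [m]. Taking [b] to be the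
    coefficients of [v] gives Bessel's inequality; any accurate [b] bounds the defect in Parseval's
    identity. *)
Lemma Rintegral_sub_sine_poly (v : R -> R) m b : square_integrable v ->
  \int[mu]_(y in D) ((v y - sine_poly m b y) ^+ 2) =
  \int[mu]_(y in D) (v y ^+ 2) - pi / 2 * l2 m (sin_coef v) ^+ 2 +
  pi / 2 * l2 m (fun n => b n - sin_coef v n) ^+ 2.
Proof.
move=> vs; rewrite !sqr_l2.
elim: m => [|[|m] IH].
1,2: rewrite !big_geq// mulr0 subr0 addr0; apply: eq_Rintegral => y _;
     by rewrite /sine_poly big_geq// subr0.
have vi := vs.2.
have s1 := square_integrable_sine m.+1.
have S1 := square_integrable_sine_poly m.+1 b.
have vS := square_integrableB vs S1.
have orth : \int[mu]_(y in D) (sine_poly m.+1 b y * sine m.+1 y) = 0.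
  have fi n : (1 <= n < m.+1)%N -> mu.-integrable D (EFin \o (fun y => b n * (sine n y * sine m.+1 y))).
    move=> _; apply: integrableRZl => //.
    exact: square_integrableM (square_integrable_sine _) (square_integrable_sine _).
  have [_ e] := Rintegral_sum_nat measurable_0pi fi.
  transitivity (\int[mu]_(y in D) (\sum_(1 <= n < m.+1) b n * (sine n y * sine m.+1 y))).
    by apply: eq_Rintegral => y _; rewrite /sine_poly mulr_suml; apply: eq_bigr => n _; rewrite mulrA.
  rewrite e big_nat_cond big1// => n; rewrite andbT => /andP[n1 nm].
  rewrite RintegralZl//; last exact: square_integrableM (square_integrable_sine _) (square_integrable_sine _).
  by rewrite sine_orthogonal// (ltn_eqF nm) mulr0.
have vsi := square_integrableM vs s1; have Ssi := square_integrableM S1 s1.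
have ssi := square_integrableM s1 s1.
transitivity (\int[mu]_(y in D) ((v y - sine_poly m.+1 b y) ^+ 2 + (- (2 * b m.+1) * (v y * sine m.+1 y - sine_poly m.+1 b y * sine m.+1 y)
    + b m.+1 ^+ 2 * (sine m.+1 y * sine m.+1 y)))).
  by apply: eq_Rintegral => y _; rewrite {1}/sine_poly big_nat_recr//= -/(sine_poly m.+1 b y); ring.
rewrite RintegralD//; [|exact: vS.2|]; last first.
  apply: integrableRD => //; apply: integrableRZl => //; exact: integrableRB.
rewrite RintegralD//; try (apply: integrableRZl => //; exact: integrableRB).
rewrite !RintegralZl//; try exact: integrableRB.
rewrite RintegralB// orth sine_orthogonal// eqxx subr0 sin_coefE IH.
by rewrite !(@big_nat_recr _ _ _ m.+1)//=; field.
Qed.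

Lemma bessel (v : R -> R) m : square_integrable v ->
  pi / 2 * l2 m (sin_coef v) ^+ 2 <= \int[mu]_(y in D) (v y ^+ 2).
Proof.
move=> vs; have := Rintegral_sub_sine_poly m (sin_coef v) vs.
rewrite (_ : l2 m (fun n => _ - _) = 0); last first.
  by rewrite /l2 big1 ?sqrtr0// => n _; rewrite subrr expr0n.
rewrite expr0n/= mulr0 addr0 => h; rewrite -subr_ge0 -h.
by apply: Rintegral_ge0 => y _; exact: sqr_ge0.
Qed.

(** The half of Parseval's identity that needs completeness, here a hypothesis on [v]: the distance
    to an approximant dominates what the first [m] coefficients miss. *)
Lemma Rintegral_le_of_sine_approx (v : R -> R) (C : R) : square_integrable v ->
  (forall m, pi / 2 * l2 m (sin_coef v) ^+ 2 <= C) ->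
  (forall e, 0 < e -> exists m b, \int[mu]_(y in D) ((v y - sine_poly m b y) ^+ 2) <= e) ->
  \int[mu]_(y in D) (v y ^+ 2) <= C.
Proof.
move=> vs vC va; apply/ler_addgt0Pr => e e0.
have [m [b]] := va e e0; rewrite Rintegral_sub_sine_poly// => h.
have := vC m; have : 0 <= pi / 2 * l2 m (fun n => b n - sin_coef v n) ^+ 2.
  by rewrite mulr_ge0 ?sqr_ge0// divr_ge0// pi_ge0.
by lra.
Qed.
End SineSystem.

(** * Bernstein's approximation theorem *)

Section Bernstein.
Context {R : realType}.
Implicit Types (F G : nat -> R) (x : R).

(* The expectation of [F] at the number of successes among [n] independent
   trials of probability [x]. *)
Fixpoint bern n F x : R :=
  if n is n'.+1 then x * bern n' (fun k => F k.+1) x + (1 - x) * bern n' F x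
  else F 0%N.

Lemma bern_le n F G x : 0 <= x -> x <= 1 -> (forall k, F k <= G k) ->
  bern n F x <= bern n G x.
Proof.
move=> x0 x1; elim: n F G => [|n IH] F G FG /=; first exact: FG.
by rewrite lerD// ler_wpM2l ?subr_ge0// IH.
Qed.

Lemma bern_lin n (a b : R) F G x :
  bern n (fun k => a * F k + b * G k) x = a * bern n F x + b * bern n G x.
Proof. by elim: n F G => [|n IH] F G //=; rewrite !IH; ring. Qed.

Lemma bern_cst n (c : R) x : bern n (fun=> c) x = c.
Proof. by elim: n => [|n IH] //=; rewrite IH; ring. Qed.

(** Squared bias plus binomial variance. The centre [c] is arbitrary because the induction moves it
    to [c - 1]. *)
Lemma bern_variance n (c : R) x :
  bern n (fun k => (k%:R - c) ^+ 2) x = (n%:R * x - c) ^+ 2 + n%:R * (x * (1 - x)).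
Proof.
elim: n c => [|n IH] c /=; first by ring.
have E : (fun k : nat => (k.+1%:R - c) ^+ 2) = (fun k => (k%:R - (c - 1)) ^+ 2).
  by apply/funext => k; rewrite -natr1; congr (_ ^+ 2); ring.
by rewrite E !IH -[n.+1%:R]natr1; ring.
Qed.

(** Chebyshev's argument without probabilities: a parabola above the deviation of [F] is averaged
    exactly. *)
Lemma bern_dist n (a b c d : R) F x : 0 <= x -> x <= 1 ->
  (forall k, `|F k - a| <= b + c * (k%:R - d) ^+ 2) ->
  `|bern n F x - a| <= b + c * ((n%:R * x - d) ^+ 2 + n%:R * (x * (1 - x))).
Proof.
move=> x0 x1 h.
have E (e1 e2 : R) : bern n (fun k => e1 + e2 * (k%:R - d) ^+ 2) x =
    e1 + e2 * ((n%:R * x - d) ^+ 2 + n%:R * (x * (1 - x))).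
  have := bern_lin n e1 e2 (fun=> 1) (fun k => (k%:R - d) ^+ 2) x.
  by rewrite bern_cst bern_variance mulr1 => <-; congr bern; apply/funext => k; rewrite mulr1.
rewrite ler_distl.
have -> : a - (b + c * ((n%:R * x - d) ^+ 2 + n%:R * (x * (1 - x)))) =
  (a - b) + (- c) * ((n%:R * x - d) ^+ 2 + n%:R * (x * (1 - x))) by ring.
rewrite addrA -!E; apply/andP; split; apply: bern_le => // k; have := h k; rewrite ler_distl => /andP[]; lra.
Qed.

Lemma bern_bounded n F x (M : R) : 0 <= x -> x <= 1 -> (forall k, `|F k| <= M) ->
  `|bern n F x| <= M.
Proof.
move=> x0 x1 h; have := @bern_dist n 0 M 0 0 F x x0 x1.
rewrite subr0 mul0r addr0; apply => k.
by rewrite subr0 mul0r addr0.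
Qed.

(** Pointwise convergence, requiring continuity at [z] alone; [(1 + z) / 2] carries [[-1, 1]], the
    range of [cos], to [[0, 1]]. *)
Lemma bern_cvg (phi : R -> R) (M z : R) : (forall y, `|phi y| <= M) ->
  -1 < z < 1 -> {for z, continuous phi} ->
  bern n.+1 (fun k => phi (2 * k%:R / n.+1%:R - 1)) ((1 + z) / 2) @[n --> \oo] --> phi z.
Proof.
move=> phiM /andP[z1 z2] cphi; apply/cvgrPdist_le => e e0.
have M0 : 0 <= M by exact: le_trans (phiM 0).
have e20 : 0 < e / 2 by rewrite divr_gt0.
have := cphi; move/cvgrPdist_le => /(_ _ e20)/nbhs_ballP[d /= d0 dphi].
near=> n; rewrite distrC.
set N : R := n.+1%:R.
have N0 : 0 < N by rewrite ltr0n.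
(* With this [c] the parabola at [k] equals [2 M (dist / d) ^ 2], where [dist] is the distance from
   [z] to the node [2 k / N - 1]; beyond distance [d] it exceeds the trivial bound [2 M]. *)
pose c := 8 * M / (d ^+ 2 * N ^+ 2).
have x0 : 0 <= (1 + z) / 2 by rewrite divr_ge0//; lra.
have x1 : (1 + z) / 2 <= 1 by rewrite ler_pdivrMr//; lra.
apply: (le_trans (@bern_dist n.+1 (phi z) (e / 2) c (N * ((1 + z) / 2)) _ _ x0 x1 _)).
  move=> k; have [dk|dk] := ltP `|z - (2 * k%:R / N - 1)| d.
    rewrite distrC; apply: (le_trans (dphi _ dk)); rewrite lerDl mulr_ge0 ?sqr_ge0//.
    by rewrite /c divr_ge0// mulr_ge0// ?sqr_ge0.
  apply: (@le_trans _ _ (M + M)).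
    by apply: (le_trans (ler_normB _ _)); apply: lerD; exact: phiM.
  rewrite ler_wpDl ?(ltW e20)//.
  have -> : c * (k%:R - N * ((1 + z) / 2)) ^+ 2 = 2 * M * (`|z - (2 * k%:R / N - 1)| / d) ^+ 2.
    rewrite /c expr_div_n real_normK ?num_real//; field; by rewrite !gt_eqF.
  have : 1 <= (`|z - (2 * k%:R / N - 1)| / d) ^+ 2.
    by rewrite -[leLHS](expr1n _ 2) lerXn2r ?nnegrE ?divr_ge0 ?(ltW d0)// ler_pdivlMr// mul1r.
  by move=> h; have := ler_wpM2l M0 h; lra.
rewrite subrr expr0n/= add0r.
have -> : c * (N * ((1 + z) / 2 * (1 - (1 + z) / 2))) = 2 * M * (1 - z ^+ 2) / d ^+ 2 * N^-1.
  by rewrite /c; field; rewrite !gt_eqF.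
have h1 : 2 * M * (1 - z ^+ 2) / d ^+ 2 * N^-1 <= 2 * M / d ^+ 2 * N^-1.
  rewrite ler_wpM2r ?invr_ge0 ?(ltW N0)// ler_wpM2r ?invr_ge0 ?sqr_ge0//.
  by rewrite ler_piMr ?mulr_ge0// gerBl sqr_ge0.
have h2 : 2 * M / d ^+ 2 * N^-1 <= e / 2.
  rewrite ler_pdivrMr// -ler_pdivrMl//.
  apply: (@le_trans _ _ n%:R); last by rewrite ler_nat.
  by near: n; exact: nbhs_infty_ger.
by rewrite [leRHS]splitr lerD2l; exact: le_trans h1 h2.
Unshelve. all: by end_near. Qed.
End Bernstein.

(** * Density of the sine polynomials *)

Section SineDensity.
Context {R : realType}.
Local Notation mu := (@lebesgue_measure R).
Local Notation D := (`]0%R, pi[%classic : set R).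
Hint Resolve measurable_0pi : core.

Definition is_sine_poly (f : R -> R) : Prop := exists m b, f = sine_poly m b.

Lemma sine_poly_widen m m' b : (m <= m')%N ->
  sine_poly m b = sine_poly m' (fun n => if (n < m)%N then b n else 0) :> (R -> R).
Proof.
move=> mm'; apply/funext => y; rewrite /sine_poly.
have [m1|m1] := leqP 1 m; last first.
  have -> : m = 0%N by case: m m1 mm'.
  rewrite big_geq// big1// => n _; by rewrite mul0r.
rewrite [RHS](@big_cat_nat _ _ _ m)//= [X in _ = _ + X]big_nat_cond.
rewrite [X in _ = _ + X]big1 ?addr0; last first.
  by move=> n; rewrite andbT => /andP[mn _]; rewrite ltnNge mn mul0r.
by apply: eq_big_nat => n /andP[_ ->].
Qed.

Lemma is_sine_polyD f g : is_sine_poly f -> is_sine_poly g ->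
  is_sine_poly (fun y => f y + g y).
Proof.
move=> [m [b ->]] [m' [b' ->]]; rewrite (sine_poly_widen b (leq_maxl m m')).
rewrite (sine_poly_widen b' (leq_maxr m m')).
eexists; exists (fun n => (if (n < m)%N then b n else 0) + (if (n < m')%N then b' n else 0)).
apply/funext => y; rewrite /sine_poly -big_split/=.
by apply: eq_bigr => n _; rewrite mulrDl.
Qed.

Lemma is_sine_polyZ c f : is_sine_poly f -> is_sine_poly (fun y => c * f y).
Proof.
move=> [m [b ->]]; exists m, (fun n => c * b n); apply/funext => y.
by rewrite /sine_poly mulr_sumr; apply: eq_bigr => n _; rewrite mulrA.
Qed.

Lemma is_sine_poly_sine n : is_sine_poly (sine n).
Proof.
exists n.+1, (fun k => (k == n)%:R); apply/funext => y; rewrite /sine_poly.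
case: n => [|n]; first by rewrite big_geq// /sine mul0r sin0.
rewrite big_nat_recr//= eqxx mul1r big_nat_cond big1 ?add0r// => k.
by rewrite andbT => /andP[_ kn]; rewrite (ltn_eqF kn) mul0r.
Qed.

Lemma is_sine_poly_sum m (f : nat -> R -> R) : (forall n, is_sine_poly (f n)) ->
  is_sine_poly (fun y => \sum_(1 <= n < m) f n y).
Proof.
move=> h; have z : is_sine_poly (fun=> 0).
  by exists 0%N, (fun=> 0); apply/funext => y; rewrite /sine_poly big_geq.
elim: m => [|[|m] IH].
- by under eq_fun do rewrite big_geq//.
- by under eq_fun do rewrite big_geq//.
- by under eq_fun do rewrite big_nat_recr//=; exact: is_sine_polyD.
Qed.

Lemma is_sine_poly_mul_cos f : is_sine_poly f -> is_sine_poly (fun y : R => f y * cos y).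
Proof.
move=> [m [b ->]].
have -> : (fun y : R => sine_poly m b y * cos y) =
   (fun y : R => \sum_(1 <= n < m) (b n * (sine n y * cos y))).
  by apply/funext => y; rewrite /sine_poly mulr_suml; apply: eq_bigr => n _; rewrite mulrA.
apply: is_sine_poly_sum => n; apply: is_sine_polyZ.
case: n => [|n].
  have -> : (fun y : R => sine 0 y * cos y) = sine 0; last exact: is_sine_poly_sine.
  by apply/funext => y; rewrite /sine mul0r sin0 mul0r.
have -> : (fun y : R => sine n.+1 y * cos y) = (fun y : R => 2^-1 * sine n.+2 y + 2^-1 * sine n y).
  apply/funext => y; rewrite /sine -[n.+2%:R]natr1.
  have -> : n%:R * y = n.+1%:R * y - y by rewrite -[n.+1%:R]natr1; ring.
  by rewrite mulrDl mul1r sinD sinB; field.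
by apply: is_sine_polyD; apply: is_sine_polyZ; exact: is_sine_poly_sine.
Qed.

(* Since [2 cos y * sin (n y) = sin ((n + 1) y) + sin ((n - 1) y)], [sin] times a
   polynomial in [cos] is a sine polynomial. *)
Lemma is_sine_poly_bern n (F : nat -> R) :
  is_sine_poly (fun y : R => sin y * bern n F ((1 + cos y) / 2)).
Proof.
elim: n F => [|n IH] F /=.
  have -> : (fun y : R => sin y * F 0%N) = (fun y : R => F 0%N * sine 1 y).
    by apply/funext => y; rewrite /sine mul1r mulrC.
  exact/is_sine_polyZ/is_sine_poly_sine.
pose f (y : R) := sin y * bern n (fun k => F k.+1) ((1 + cos y) / 2).
pose g (y : R) := sin y * bern n F ((1 + cos y) / 2).
have fs : is_sine_poly f by exact: IH.
have gs : is_sine_poly g by exact: IH.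
have -> : (fun y : R => sin y * ((1 + cos y) / 2 * bern n (fun k => F k.+1) ((1 + cos y) / 2) +
    (1 - (1 + cos y) / 2) * bern n F ((1 + cos y) / 2))) =
  (fun y : R => (2^-1 * f y + 2^-1 * (f y * cos y)) + (2^-1 * g y + (- 2^-1) * (g y * cos y))).
  by apply/funext => y; rewrite /f /g; field.
have fc := is_sine_poly_mul_cos fs; have gc := is_sine_poly_mul_cos gs.
by apply: is_sine_polyD; apply: is_sine_polyD; apply: is_sine_polyZ.
Qed.

Definition sine_approximable (v : R -> R) : Prop :=
  forall e, 0 < e -> exists m b, \int[mu]_(y in D) ((v y - sine_poly m b y) ^+ 2) <= e.

Lemma is_sine_poly_approximable f : is_sine_poly f -> sine_approximable f.
Proof.
move=> [m [b ->]] e e0; exists m, b.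
by under eq_Rintegral do rewrite subrr expr0n/=; rewrite Rintegral_cst// mul0r ltW.
Qed.

Lemma sine_approximable_closed v : square_integrable v ->
  (forall e, 0 < e -> exists u, [/\ square_integrable u, sine_approximable u &
     \int[mu]_(y in D) ((v y - u y) ^+ 2) <= e]) -> sine_approximable v.
Proof.
move=> vs h e e0; have e40 : 0 < e / 4 by rewrite divr_gt0.
have [u [us ua vu]] := h _ e40.
have [m [b ub]] := ua _ e40; exists m, b.
have Ss := square_integrable_sine_poly m b.
have i1 := (square_integrableB vs us).2; have i2 := (square_integrableB us Ss).2.
have i3 := (square_integrableB vs Ss).2.
apply: (@le_trans _ _ (\int[mu]_(y in D) (2 * (v y - u y) ^+ 2 + 2 * (u y - sine_poly m b y) ^+ 2))).
  apply: le_Rintegral => //.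
    by apply: integrableRD => //; exact: integrableRZl.
  move=> y _; have := sqr_ge0 ((v y - u y) - (u y - sine_poly m b y)).
  by rewrite !expr2; lra.
rewrite RintegralD//; try exact: integrableRZl.
by rewrite !RintegralZl//; lra.
Qed.

Lemma sine_approximable_cvg (v : R -> R) (u : nat -> R -> R) (g : R -> R) :
  square_integrable v -> (forall n, square_integrable (u n)) ->
  (forall n, sine_approximable (u n)) ->
  (forall y, D y -> u n y @[n --> \oo] --> v y) ->
  mu.-integrable D (EFin \o g) -> (forall n y, D y -> (v y - u n y) ^+ 2 <= g y) ->
  sine_approximable v.
Proof.
move=> vs us ua uv gi ug; apply: sine_approximable_closed => // e e0.
have [||||||_] := @dominated_cvg_Rintegral _ D (fun n y => (v y - u n y) ^+ 2) (cst 0) g.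
- exact: measurable_0pi.
- by move=> n; have [] := square_integrableB vs (us n); move=> m _; exact: measurable_funX.
- exact: measurable_cst.
- apply: aeW => y Dy; rewrite -[X in _ --> X](_ : (v y - v y) ^+ 2 = _); last first.
    by rewrite subrr expr0n.
  apply: (cvg_comp (fun n => v y - u n y) (fun z => z ^+ 2) _ (@exprn_continuous _ 2 _)).
  by apply: cvgB; [exact: cvg_cst|exact: uv].
- exact: gi.
- by move=> n y Dy; rewrite ger0_norm ?sqr_ge0//; exact: ug.
rewrite Rintegral_cst// mul0r => /cvgrPdist_le/(_ _ e0)[n _ /(_ n (leqnn n))].
rewrite /= sub0r normrN => h; exists (u n); split => //.
by apply: le_trans h; exact: ler_norm.
Qed.

(** Truncation to [[-a, a]] for [a >= 0]; in this form the Lipschitz constant 1 follows from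
    triangle inequalities. *)
Definition clip (a x : R) : R := (`|x + a| - `|x - a|) / 2.

Lemma clip_lip a x y : `|clip a x - clip a y| <= `|x - y|.
Proof.
have -> : clip a x - clip a y = ((`|x + a| - `|y + a|) - (`|x - a| - `|y - a|)) / 2.
  by rewrite /clip; field.
rewrite normrM (ger0_norm (_ : 0 <= 2^-1)) ?invr_ge0// ler_pdivrMr// mulr_natr mulr2n.
apply: (le_trans (ler_normB _ _)); apply: lerD; apply: (le_trans (ler_dist_dist _ _)).
- by rewrite (_ : x + a - (y + a) = x - y)//; ring.
- by rewrite (_ : x - a - (y - a) = x - y)//; ring.
Qed.

Lemma norm_clip_le a x : 0 <= a -> `|clip a x| <= a.
Proof.
move=> a0; rewrite normrM (ger0_norm (_ : 0 <= 2^-1)) ?invr_ge0// ler_pdivrMr//.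
apply: (le_trans (ler_dist_dist _ _)).
rewrite (_ : x + a - (x - a) = a * 2); last by ring.
by rewrite ger0_norm// mulr_ge0.
Qed.

Lemma clip_id a x : `|x| <= a -> clip a x = x.
Proof.
rewrite ler_norml => /andP[h1 h2]; rewrite /clip ger0_norm; last by lra.
by rewrite ler0_norm; [field|lra].
Qed.

Lemma norm_sub_clip a x : 0 <= a -> `|x - clip a x| <= `|x|.
Proof.
move=> a0; rewrite ler_norml /clip.
by case: (ger0P (x + a)); case: (ger0P (x - a)); case: (ger0P x); lra.
Qed.

Lemma continuous_clip a : continuous (clip a).
Proof.
move=> x; apply/cvgrPdist_le => e e0; near=> y.
apply: (le_trans (clip_lip _ _ _)); near: y.
exact: (@cvgr_dist_le _ _ _ _ _ id x).
Unshelve. all: by end_near. Qed.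

Lemma measurable_clip a (v : R -> R) : measurable_fun D v -> measurable_fun D (fun y => clip a (v y)).
Proof.
move=> mv; apply: (measurableT_comp _ mv).
exact: continuous_measurable_fun (@continuous_clip a).
Qed.

(** Bernstein polynomials of [phi] in the variable [cos y] become sine polynomials once multiplied
    by [sin y]; bounded pointwise convergence passes to the mean square. *)
Lemma sin_cos_approximable (phi : R -> R) (M : R) : (forall z, `|phi z| <= M) ->
  (forall z, -1 < z < 1 -> {for z, continuous phi}) ->
  sine_approximable (fun y => sin y * phi (cos y)).
Proof.
move=> phiM cphi; have M0 : 0 <= M by exact: le_trans (phiM 0).
have cosin (y : R) : D y -> -1 < cos y < 1.
  rewrite /= in_itv/= => /andP[y0 yp].
  by rewrite -cospi -cos0 !ltr_cos// ?y0 ?yp// in_itv/= ?lexx ?pi_ge0 ?(ltW y0) ?(ltW yp).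
pose B n (y : R) := bern n.+1 (fun k => phi (2 * k%:R / n.+1%:R - 1)) ((1 + cos y) / 2).
have BM n y : `|B n y| <= M.
  have := cos_geN1 y; have := cos_le1 y => c1 c2.
  by apply: bern_bounded => //; lra.
have sB n : is_sine_poly (fun y : R => sin y * B n y) by exact: is_sine_poly_bern.
have sqB n : square_integrable (fun y : R => sin y * B n y).
  by have [m [b ->]] := sB n; exact: square_integrable_sine_poly.
have BC (y : R) : D y -> sin y * B n y @[n --> \oo] --> sin y * phi (cos y).
  move=> Dy; apply: cvgM; first exact: cvg_cst.
  exact: (bern_cvg phiM (cosin y Dy) (cphi _ (cosin y Dy))).
have sl (y : R) : `|sin y| <= 1 by rewrite ler_norml sin_geN1 sin_le1.
have vb (y : R) : D y -> `|sin y * phi (cos y)| <= M.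
  by move=> _; rewrite normrM -[leRHS]mul1r ler_pM.
have mv : measurable_fun D (fun y : R => sin y * phi (cos y)).
  by apply: measurable_fun_cvg BC => n; have [] := sqB n.
apply: (@sine_approximable_cvg _ (fun n y => sin y * B n y) (cst ((M + M) ^+ 2))) => //.
- exact: square_integrable_bounded mv vb.
- by move=> n; exact: is_sine_poly_approximable.
- by apply: (@bounded_integrable_0pi _ _ ((M + M) ^+ 2)) => // y _; rewrite ger0_norm// sqr_ge0.
- move=> n y Dy /=; rewrite -real_normK ?num_real// lerXn2r ?nnegrE ?addr_ge0//.
  apply: (le_trans (ler_normB _ _)); apply: lerD; first exact: vb.
  by rewrite normrM -[leRHS]mul1r ler_pM.
Qed.

(** To write [h] as [sin y] times a function of [cos y] one must divide by [sin y], which vanishes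
    at the ends. Dividing by [sin y + 1 / (n + 1)] keeps the quotient bounded and recovers [h] in
    the limit; [Num.sqrt (1 - z ^ 2)] is [sin y] at [z = cos y]. *)
Lemma continuous_sine_approximable (h : R -> R) (M : R) : continuous h ->
  (forall y, `|h y| <= M) -> sine_approximable h.
Proof.
move=> ch hM; have M0 : 0 <= M by exact: le_trans (hM 0).
have sin0 (y : R) : D y -> 0 < sin y.
  by rewrite /= in_itv/= => /sin_gt0_pi.
have n0 n : 0 < n.+1%:R^-1 :> R by rewrite invr_gt0.
pose phi n z := h (acos z) / (Num.sqrt (1 - z ^+ 2) + n.+1%:R^-1).
have pos n (z : R) : 0 < Num.sqrt (1 - z ^+ 2) + n.+1%:R^-1.
  by rewrite ltr_wpDl ?sqrtr_ge0.
have phiM n z : `|phi n z| <= M * n.+1%:R.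
  rewrite normrM ler_pM// normfV ger0_norm; last by rewrite addr_ge0 ?sqrtr_ge0 ?(ltW (n0 n)).
  by rewrite -[leRHS]invrK lef_pV2 ?posrE// lerDr sqrtr_ge0.
have E n (y : R) : D y -> sin y * phi n (cos y) = h y * (sin y / (sin y + n.+1%:R^-1)).
  move=> Dy; have := Dy; rewrite /= in_itv/= => /andP[y0 yp].
  rewrite /phi cosK ?in_itv/= ?(ltW y0) ?(ltW yp)//.
  rewrite -sin2cos2 sqrtr_sqr ger0_norm ?(ltW (sin0 y Dy))//.
  by rewrite mulrCA.
have cphi n z : -1 < z < 1 -> {for z, continuous (phi n)}.
  move=> z1; apply: cvgM.
    apply: (cvg_comp acos h); last exact: ch.
    by apply: continuous_acos.
  apply: cvgV; first by rewrite gt_eqF.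
  apply: cvgD; last exact: cvg_cst.
  apply: (cvg_comp (fun z => 1 - z ^+ 2) Num.sqrt); last exact: sqrt_continuous.
  by apply: cvgB; [exact: cvg_cst|exact: exprn_continuous].
have mh : measurable_fun D h by apply: measurable_funTS; exact: continuous_measurable_fun.
have frac n (y : R) : D y -> 0 <= sin y / (sin y + n.+1%:R^-1) <= 1.
  move=> Dy; have sy := sin0 y Dy; rewrite divr_ge0 ?addr_ge0 ?(ltW sy) ?(ltW (n0 n))//=.
  by rewrite ler_pdivrMr ?addr_gt0// mul1r lerDl (ltW (n0 n)).
have sq n : square_integrable (fun y : R => sin y * phi n (cos y)).
  apply: (@square_integrable_bounded _ _ M).
    apply: (@eq_measurable_fun _ _ _ _ _ (fun y : R => h y * (sin y / (`|sin y| + n.+1%:R^-1)))).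
      by move=> y; rewrite inE => Dy; rewrite (E n y Dy) (ger0_norm (ltW (sin0 y Dy))).
    apply: measurable_funM => //; apply: measurable_funTS.
    apply: continuous_measurable_fun => y; apply: cvgM; first exact: continuous_sin.
    apply: cvgV; first by rewrite gt_eqF// ltr_wpDl.
    apply: cvgD; last exact: cvg_cst.
    by apply: cvg_norm; exact: continuous_sin.
  move=> y Dy; rewrite E// normrM -[leRHS]mulr1; have /andP[f0 f1] := frac n y Dy.
  by rewrite ler_pM// ger0_norm.
apply: (@sine_approximable_cvg _ (fun n y => sin y * phi n (cos y)) (cst (M ^+ 2))) => //.
- by apply: (@square_integrable_bounded _ _ M).
- by move=> n; apply: (@sin_cos_approximable (phi n) (M * n.+1%:R)) => // z; exact: cphi.
- move=> y Dy.
  have C : h y * (sin y / (sin y + n.+1%:R^-1)) @[n --> \oo] --> h y * (sin y / (sin y + 0)).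
    apply: cvgM; first exact: cvg_cst.
    apply: cvgM; first exact: cvg_cst.
    apply: cvgV; first by rewrite addr0 gt_eqF// sin0.
    by apply: cvgD; [exact: cvg_cst|exact: cvg_harmonic].
  rewrite addr0 divff ?mulr1 in C; last by rewrite gt_eqF// sin0.
  by under eq_cvg do rewrite E//.
- by apply: (@bounded_integrable_0pi _ _ (M ^+ 2)) => // y _; rewrite ger0_norm// sqr_ge0.
- move=> n y Dy /=; rewrite E// -real_normK ?num_real// lerXn2r ?nnegrE//.
  rewrite -[X in X - _]mulr1 -mulrBr normrM -[leRHS]mulr1; have /andP[f0 f1] := frac n y Dy.
  by rewrite ler_pM// ger0_norm; lra.
Qed.

(** Continuous functions approximate [v] in mean. Clipped at [M], they do so in mean square, since
    the squared error is at most [2 M] times the error. *)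
Lemma bounded_sine_approximable (v : R -> R) (M : R) : measurable_fun D v ->
  (forall y, `|v y| <= M) -> sine_approximable v.
Proof.
move=> mv vM; have M0 : 0 <= M by exact: le_trans (vM 0).
have vs : square_integrable v by exact: (@square_integrable_bounded _ _ M).
have Dfin : (mu D < +oo)%E by rewrite lebesgue_measure_0pi ltry.
have vi : mu.-integrable D (EFin \o v) by exact: (@bounded_integrable_0pi _ _ M).
have [f [cf fi fv]] := approximation_continuous_integrable measurable_0pi Dfin vi.
apply: sine_approximable_closed => // e e0.
have mc n : measurable_fun [set: R] (f n) by exact: continuous_measurable_fun.
have ck n : continuous (fun y => clip M (f n y)).
  by move=> y; apply: (cvg_comp (f n) (clip M)); [exact: cf|exact: continuous_clip].
have cs n : square_integrable (fun y => clip M (f n y)).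
  apply: (@square_integrable_bounded _ _ M).
    by apply: measurable_funTS; exact: continuous_measurable_fun.
  by move=> y _; exact: norm_clip_le.
(* The added 1 covers [M = 0]. *)
have e1 : 0 < e / (2 * M + 1) by rewrite divr_gt0// ltr_wpDl// mulr_ge0.
move: fv => /fine_cvgP[_ /cvgrPdist_le /(_ _ e1)[n _ /(_ n (leqnn n))]].
rewrite /= sub0r normrN => h; exists (fun y => clip M (f n y)); split => //.
  exact: (@continuous_sine_approximable _ M (ck n) (fun y => norm_clip_le _ M0)).
have I1 : mu.-integrable D (EFin \o (fun y => `|v y - f n y|)).
  by have := integrable_norm (integrableRB measurable_0pi vi (fi n)).
have h' : \int[mu]_(y in D) `|v y - f n y| <= e / (2 * M + 1).
  by apply: le_trans h; exact: ler_norm.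
have I2 : \int[mu]_(y in D) ((v y - clip M (f n y)) ^+ 2) <= \int[mu]_(y in D) (2 * M * `|v y - f n y|).
  apply: le_Rintegral => //.
  - exact: (square_integrableB vs (cs n)).2.
  - exact: integrableRZl.
  - move=> y _; rewrite -real_normK ?num_real// expr2 ler_pM//.
      apply: (le_trans (ler_normB _ _)); rewrite mulr_natl mulr2n; apply: lerD => //.
      exact: norm_clip_le.
    by rewrite -{1}(clip_id (vM y)); exact: clip_lip.
apply: (le_trans I2); rewrite RintegralZl//; apply: (le_trans (ler_wpM2l _ h')); first by rewrite mulr_ge0.
by rewrite mulrCA ler_piMr ?(ltW e0)// ler_pdivrMr ?mul1r ?lerDl// ltr_wpDl// mulr_ge0.
Qed.

Lemma square_integrable_approximable (v : R -> R) : square_integrable v -> sine_approximable v.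
Proof.
move=> vs; have [mv vi] := vs.
pose u n y := clip n%:R (v y).
have un n y : `|u n y| <= n%:R by exact: norm_clip_le.
apply: (@sine_approximable_cvg _ u (fun y => v y ^+ 2)) => //.
- by move=> n; apply: (@square_integrable_bounded _ _ n%:R) => //; exact: measurable_clip.
- by move=> n; apply: (@bounded_sine_approximable (u n) n%:R) => //; exact: measurable_clip.
- move=> y _; apply: cvg_near_cst; near=> n; rewrite /u clip_id//.
  by near: n; exact: nbhs_infty_ger.
- move=> n y _; rewrite -real_normK ?num_real// -(real_normK (num_real (v y))) lerXn2r ?nnegrE//.
  exact: norm_sub_clip.
Unshelve. all: by end_near. Qed.
End SineDensity.

(** * Norms in terms of sine coefficients *)

Section Norms.
Context {R : realType}.
Local Notation mu := (@lebesgue_measure R).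
Local Notation D := (`]0%R, pi[%classic : set R).
Hint Resolve measurable_0pi : core.

Lemma L2normE (v : R -> R) : L2norm v = sqrte (\int[mu]_(y in D) (v y ^+ 2)%:E)%E.
Proof.
rewrite /L2norm unlock /Lnorm poweR12_sqrt; last by apply: integral_ge0 => y _; exact: poweR_ge0.
congr sqrte; rewrite [RHS]integral_mkcond; apply: eq_integral => y _ /=.
rewrite /patch; case: ifPn => _ /=; rewrite powR_mulrn ?normr_ge0//.
  by rewrite real_normK// num_real.
by rewrite normr0 expr0n.
Qed.

Lemma L2norm_square_integrable (v : R -> R) : measurable_fun D v -> (L2norm v < +oo)%E ->
  square_integrable v.
Proof.
move=> mv; rewrite L2normE => h; split => //; apply/integrableP; split.
  by apply/measurable_EFinP; exact: measurable_funX.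
rewrite (_ : (\int[mu]_(x in D) `|(v x ^+ 2)%:E|)%E = \int[mu]_(x in D) (v x ^+ 2)%:E)%E; last first.
  by apply: eq_integral => y _ /=; rewrite ger0_norm// sqr_ge0.
by move: h; case: (\int[mu]_(x in D) (v x ^+ 2)%:E)%E => //= r _; rewrite ltry.
Qed.

Lemma square_integrable_L2norm (v : R -> R) : square_integrable v ->
  L2norm v = (Num.sqrt (\int[mu]_(y in D) (v y ^+ 2)))%:E.
Proof.
move=> [mv vi]; rewrite L2normE /Rintegral -[in LHS](fineK (integrable_fin_num _ vi))//.
Qed.

Lemma L2norm_le (v : R -> R) (B : R) : 0 <= B -> square_integrable v ->
  (L2norm v <= B%:E)%E = (\int[mu]_(y in D) (v y ^+ 2) <= B ^+ 2).
Proof.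
move=> B0 vs; rewrite square_integrable_L2norm// lee_fin.
have i0 : 0 <= \int[mu]_(y in D) (v y ^+ 2) by apply: Rintegral_ge0 => y _; exact: sqr_ge0.
by rewrite -[in LHS](ger0_norm B0) -sqrtr_sqr ler_sqrt// sqr_ge0.
Qed.

Lemma l2_sin_coef_le (v : R -> R) (B : R) m : 0 <= B -> square_integrable v ->
  (L2norm v <= B%:E)%E -> l2 m (sin_coef v) <= Num.sqrt (2 / pi) * B.
Proof.
move=> B0 vs; rewrite L2norm_le// => /(le_trans (bessel m vs)) h.
have p0 := pi_gt0 R.
rewrite -(@ler_pXn2r _ 2)// ?nnegrE ?mulr_ge0 ?sqrtr_ge0 ?l2_ge0//.
rewrite exprMn (sqr_sqrtr (divr_ge0 (ler0n _ 2) (ltW p0))).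
rewrite -(@ler_pM2l _ (pi / 2)) ?divr_gt0// [leRHS]mulrA (_ : pi / 2 * (2 / pi) = 1) ?mul1r//.
by rewrite mulrA divfK// divff// gt_eqF.
Qed.

(** The converse of [l2_sin_coef_le], and the place where completeness is used. The factor
    [Num.sqrt (2 / pi)], due to the normalization of [sin_coef], is the same in both directions and
    cancels in the final estimate. *)
Lemma L2norm_le_sin_coef (v : R -> R) (B : R) : 0 <= B -> square_integrable v ->
  (forall m, l2 m (sin_coef v) <= Num.sqrt (2 / pi) * B) -> (L2norm v <= B%:E)%E.
Proof.
move=> B0 vs h; rewrite L2norm_le//; have p0 := pi_gt0 R.
apply: Rintegral_le_of_sine_approx => //; last exact: square_integrable_approximable.
move=> m; have := h m.
rewrite -(@ler_pXn2r _ 2)// ?nnegrE ?mulr_ge0 ?sqrtr_ge0 ?l2_ge0//.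
rewrite exprMn (sqr_sqrtr (divr_ge0 (ler0n _ 2) (ltW p0))).
rewrite -(@ler_pM2l _ (pi / 2)) ?divr_gt0// [leRHS]mulrA (_ : pi / 2 * (2 / pi) = 1) ?mul1r//.
by rewrite mulrA divfK// divff// gt_eqF.
Qed.

Lemma LinfL2normE T (f : R -> R -> R) :
  LinfL2norm T f = ess_sup mu ((fun t => L2norm (f ^~ t)) \_ `]0%R, T[).
Proof.
rewrite /LinfL2norm unlock /Lnorm.
rewrite (_ : (0 < mu setT)%E); last by rewrite -set_itvNyy lebesgue_measure_itv/= ltry.
congr (ess_sup mu _); apply/funext => t /=; rewrite /patch; case: ifPn => _; last by rewrite abse0.
by rewrite gee0_abs// /L2norm Lnorm_ge0.
Qed.

Lemma LinfL2norm_ae T (f : R -> R -> R) :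
  {ae mu, forall t, 0 < t < T -> (L2norm (f ^~ t) <= LinfL2norm T f)%E}.
Proof.
rewrite LinfL2normE; apply: ae_imply (ess_sup_ge mu ((fun t => L2norm (f ^~ t)) \_ `]0%R, T[)) => t + tT.
by rewrite /patch mem_set.
Qed.

Lemma LinfL2norm_le T (f : R -> R -> R) (B : R) : 0 <= B ->
  {ae mu, forall t, 0 < t < T -> (L2norm (f ^~ t) <= B%:E)%E} -> (LinfL2norm T f <= B%:E)%E.
Proof.
move=> B0 h; rewrite LinfL2normE; apply/ess_supP; apply: ae_imply h => t h.
by rewrite /patch; case: ifPn => // /set_mem; exact: h.
Qed.

Lemma LinfL2norm_ge0 T (f : R -> R -> R) : (0 <= LinfL2norm T f)%E.
Proof. by rewrite /LinfL2norm Lnorm_ge0. Qed.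

Lemma measurable_section (A B : set R) (f : R -> R -> R) t : measurable A -> measurable B ->
  measurable_fun (A `*` B) (fun p : R * R => f p.1 p.2) -> B t -> measurable_fun A (f ^~ t).
Proof.
move=> mA mB mf Bt.
apply: (@measurable_comp _ _ _ _ _ _ (A `*` B) (fun p : R * R => f p.1 p.2) A (fun y => (y, t))) => //.
- exact: measurableX.
- by move=> _ [y Ay <-].
- by apply: measurable_funTS; exact: pair2_measurable.
Qed.

End Norms.

(** * The transformed subdomain problems *)

Section LinearODE.
Context {R : realType}.
Implicit Types (f : R -> R) (a b : R).

Lemma derive0_cst_itv f a b : (forall x, a < x < b -> is_derive x 1 f 0) ->
  forall x y, a < x < b -> a < y < b -> f x = f y.
Proof.
move=> df x y; wlog xy : x y / x <= y.
  by move=> H hx hy; have [xy|/ltW yx] := leP x y; [exact: H|apply/esym/H].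
move=> /andP[ax xb] /andP[ay yb].
have dz z : z \in `[x, y] -> is_derive z 1 f 0.
  by rewrite in_itv/= => /andP[xz zy]; apply: df; rewrite (lt_le_trans ax)//= (le_lt_trans zy).
have dz' z : z \in `]x, y[%R -> is_derive z 1 f ((fun=> 0) z).
  by move=> zxy; apply: dz; exact: subset_itv_oo_cc zxy.
have cz : {within `[x, y], continuous f}.
  by apply: derivable_within_continuous => z /dz[].
have [c _] := MVT_segment xy dz' cz.
by rewrite mul0r => /eqP; rewrite subr_eq0 => /eqP.
Qed.

Lemma is_derive_expRM (k x : R) : is_derive x 1 (fun x => expR (k * x)) (k * expR (k * x)).
Proof.
have d1 : is_derive x 1 (fun x : R => k * x) (k * 1) by exact: (@is_deriveZ _ _ _ _ k _ _ _ (is_derive_id x 1)).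
have d2 := @is_derive1_comp _ expR _ x _ _ (is_derive_expR (k * x)) d1.
by apply: (is_derive_eq d2); rewrite mulr1 /GRing.scale/= mulrC.
Qed.

Lemma continuous_expRM (k : R) : continuous (fun x : R => expR (k * x)).
Proof.
move=> x; apply: (cvg_comp (fun x => k * x) expR _ (@continuous_expR _ _)).
by apply: cvgM; [exact: cvg_cst|exact: cvg_id].
Qed.

(** Both [exp (w x) (f' - w f)] and [exp (- w x) (f' + w f)] are constant, and [f] is a combination
    of them. The end points follow by continuity, all that is known of [f] there. *)
Lemma ode_exp f f1 a b (w : R) : 0 < w -> a < b ->
  (forall x, a < x < b -> is_derive x 1 f (f1 x)) ->
  (forall x, a < x < b -> is_derive x 1 f1 (w ^+ 2 * f x)) ->
  {within `[a, b], continuous f} ->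
  exists al be, forall x, a <= x <= b -> f x = al * expR (w * x) + be * expR (- (w * x)).
Proof.
move=> w0 ab df df1 cf.
have first_integral (k : R) : k ^+ 2 = w ^+ 2 ->
    forall x y, a < x < b -> a < y < b ->
    expR (k * x) * (f1 x - k * f x) = expR (k * y) * (f1 y - k * f y).
  move=> kw; apply: (@derive0_cst_itv (fun x => expR (k * x) * (f1 x - k * f x))) => x xab.
  have d1 := @is_deriveZ _ _ _ _ k _ _ _ (df x xab).
  have d2 := is_deriveB (df1 x xab) d1.
  have d3 := @is_deriveM _ _ _ _ x 1 _ _ (is_derive_expRM k x) d2.
  apply: (is_derive_eq d3); rewrite (_ : (f1 - k \*: f) x = f1 x - k * f x)// /GRing.scale/= -kw; ring.
have m1 : a < (a + b) / 2 < b by rewrite !midf_lt.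
have I1 := fun x h => first_integral w erefl x _ h m1.
have I2 := fun x h => first_integral (- w) (sqrrN w) x _ h m1.
set A := expR (w * _) * _ in I1; set B := expR (- w * _) * _ in I2.
have fE x : a < x < b -> f x = B / (2 * w) * expR (w * x) + (- A / (2 * w)) * expR (- (w * x)).
  move=> xab; rewrite -(I1 x xab) -(I2 x xab) !mulNr expRN.
  have e0 := lt0r_neq0 (expR_gt0 (w * x)); have w0' := lt0r_neq0 w0.
  by field; rewrite ?e0 ?w0'.
exists (B / (2 * w)), (- A / (2 * w)); move=> x /andP[ax xb].
have [_ ca cb] := (continuous_within_itvP _ ab).1 cf.
pose g (x : R) := B / (2 * w) * expR (w * x) + (- A / (2 * w)) * expR (- (w * x)).
have cg : continuous g.
  move=> z; have e (k : R) := @continuous_expRM k z.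
  apply: cvgD; apply: cvgM; try exact: cvg_cst; first exact: e.
  have em : {for z, continuous (fun u : R => expR (- (w * u)))}.
    have E : (fun u : R => expR (- (w * u))) = (fun u : R => expR (- w * u)).
      by apply/funext => u; rewrite mulNr.
    by rewrite E; exact: e.
  exact: em.
have [->|xa] := eqVneq x a.
  have h : g z @[z --> a^'+] --> f a.
    apply: cvg_trans ca; apply: near_eq_cvg; near=> z; rewrite /g -fE//.
    by apply/andP; split; near: z; [exact: nbhs_right_gt|exact: nbhs_right_lt].
  by apply: (cvg_unique _ h) => //; apply: cvg_at_right_filter; exact: cg.
have [->|xb'] := eqVneq x b.
  have h : g z @[z --> b^'-] --> f b.
    apply: cvg_trans cb; apply: near_eq_cvg; near=> z; rewrite /g -fE//.
    by apply/andP; split; near: z; [exact: nbhs_left_gt|exact: nbhs_left_lt].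
  by apply: (cvg_unique _ h) => //; apply: cvg_at_left_filter; exact: cg.
by apply: fE; rewrite !lt_neqAle ax xb xb' eq_sym xa.
Unshelve. all: by end_near. Qed.

End LinearODE.

Section LaplaceDerivatives.
Context {R : realType}.
Local Notation mu := (@lebesgue_measure R).
Local Notation Rp := (`]0%R, +oo[%classic : set R).

Lemma measurable_Rp : measurable Rp. Proof. exact: measurable_itv. Qed.
Hint Resolve measurable_Rp : core.

Lemma measurable_expRMl (k : R) (D : set R) : measurable_fun D (fun t : R => expR (k * t)).
Proof.
apply: measurable_funTS; apply: measurableT_comp => //; exact: measurable_funM.
Qed.

Lemma integrable_expRN (s : R) : 0 < s ->
  mu.-integrable Rp (fun t => (expR (- (s * t)))%:E).
Proof.
move=> s0; have h : mu.-integrable Rp (EFin \o exponential_pdf s).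
  by apply: integrableS (integrable_exponential_pdf s0).
apply: (@eqR_integrable _ _ (fun t : R => (s^-1 * exponential_pdf s t)%:E)) => //; last exact: integrableRZl.
move=> t /=; rewrite in_itv/= andbT => t0.
have -> : exponential_pdf s t = s * expR (- s * t).
  by rewrite /exponential_pdf patchE mem_set//= in_itv/= andbT ltW.
by rewrite mulrA mulVf ?gt_eqF// mul1r mulNr.
Qed.

Lemma laplace_integrable_exp_order (w : R -> R) (M sg s : R) : sg < s ->
  measurable_fun Rp w -> (forall t : R, 0 < t -> `|w t| <= M * expR (sg * t)) ->
  laplace_integrable w s.
Proof.
move=> sgs mw wM; have h := integrable_expRN (_ : 0 < s - sg); rewrite subr_gt0 in h.
have := integrableRZl M measurable_Rp (h sgs); apply: le_integrable => //.
  apply/measurable_EFinP; apply: measurable_funM => //.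
  by have := @measurable_expRMl (- s) Rp; apply: eq_measurable_fun => t _; rewrite mulNr.
move=> t; rewrite /= in_itv/= andbT => t0; rewrite lee_fin normrM ger0_norm ?expR_ge0//.
apply: (le_trans (ler_wpM2l (expR_ge0 _) (wM _ t0))).
apply: le_trans (ler_norm _); rewrite mulrCA -expRD.
by rewrite (_ : - (s * t) + sg * t = - ((s - sg) * t))//; ring.
Qed.

(** The derivative is a limit of difference quotients along a sequence of increments [e n], chosen
    so that [x + e n] stays below [d]. *)
Lemma measurable_partial (V V' : R -> R -> R) (c d x : R) : c < x < d ->
  (forall y, c < y < d -> measurable_fun Rp (V y)) ->
  (forall t : R, 0 < t -> is_derive x 1 (V ^~ t) (V' x t)) -> measurable_fun Rp (V' x).
Proof.
move=> /andP[cx xd] mV dV; pose e n := (d - x) / n.+2%:R.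
have e0 n : 0 < e n by rewrite divr_gt0// subr_gt0.
have ed n : e n < d - x by rewrite ltr_pdivrMr// ltr_pMr ?subr_gt0// ltr1n.
apply: (@measurable_fun_cvg _ _ R Rp (fun n t => (e n)^-1 * (V (e n + x) t - V x t))).
  move=> n; apply: measurable_funM => //; apply: measurable_funB; apply: mV.
    by apply/andP; split; [have := e0 n; lra|have := ed n; lra].
  by rewrite cx.
move=> t; rewrite /= in_itv/= andbT => t0.
have [dv <-] := dV t t0.
have e_cvg : e n @[n --> \oo] --> 0.
  rewrite -[X in _ --> X](mulr0 (d - x)); apply: cvgM; first exact: cvg_cst.
  by rewrite (cvg_shiftS (fun n => n.+1%:R^-1 : R)); exact: cvg_harmonic.
have dv' : h^-1 *: (V (h *: 1 + x) t - V x t) @[h --> 0^'] --> 'D_1 (V ^~ t) x := dv.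
move/cvgr_dnbhsP : dv' => /(_ e) h.
have := h (conj (fun n => lt0r_neq0 (e0 n)) e_cvg).
by under eq_fun do rewrite /GRing.scale/= mulr1.
Qed.

Lemma is_derive_laplace (V V' : R -> R -> R) (c d x s M sg : R) : c < x < d -> sg < s ->
  (forall y, c < y < d -> laplace_integrable (V y) s) ->
  (forall y t : R, c < y < d -> 0 < t -> is_derive y 1 (V ^~ t) (V' y t)) ->
  (forall y t : R, c < y < d -> 0 < t -> `|V' y t| <= M * expR (sg * t)) ->
  is_derive x 1 (fun y => laplace (V y) s) (laplace (V' x) s).
Proof.
move=> cxd sgs Vi dV V'M.
pose f (y t : R) := expR (- (s * t)) * V y t.
have df y t : c < y < d -> 0 < t -> is_derive y 1 (f ^~ t) (expR (- (s * t)) * V' y t).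
  by move=> cyd t0; exact: (@is_deriveZ _ _ _ _ (expR (- (s * t))) _ _ _ (dV y t cyd t0)).
have pE y t : c < y < d -> 0 < t -> partial1of2 f y t = expR (- (s * t)) * V' y t.
  by move=> cyd t0; rewrite partial1of2E; have [_ ->] := df y t cyd t0.
pose G (t : R) := `|M| * expR (- ((s - sg) * t)).
have Gi : mu.-integrable Rp (EFin \o G).
  by apply: integrableRZl => //; apply: integrable_expRN; rewrite subr_gt0.
have G0 t : 0 <= G t by rewrite mulr_ge0// expR_ge0.
have Ix : (`]c, d[%classic : set R) x by rewrite /= in_itv.
have intf y : (`]c, d[%classic : set R) y -> mu.-integrable Rp (EFin \o f y).
  by rewrite /= in_itv; exact: Vi.
have derf y t : (`]c, d[%classic : set R) y -> Rp t -> derivable (f ^~ t) y 1.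
  by rewrite /= !in_itv/= andbT => cyd t0; have [] := df y t cyd t0.
have fG y t : (`]c, d[%classic : set R) y -> Rp t -> `|partial1of2 f y t| <= G t.
  rewrite /= !in_itv/= andbT => cyd t0; rewrite pE// normrM ger0_norm ?expR_ge0//.
  apply: (le_trans (ler_wpM2l (expR_ge0 _) (V'M y t cyd t0))).
  rewrite mulrCA -expRD (_ : - (s * t) + sg * t = - ((s - sg) * t)); last by ring.
  by rewrite ler_wpM2r ?expR_ge0// ler_norm.
have D := @derivable_under_integral R _ _ mu f Rp measurable_Rp x c d Ix intf derf G G0 Gi fG.
apply: DeriveDef; first exact: D.
rewrite -derive1E (@differentiation_under_integral R _ _ mu f Rp measurable_Rp x c d Ix intf derf G G0 Gi fG).
by apply: eq_Rintegral => t; rewrite inE/= in_itv/= andbT => t0; exact: pE.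
Qed.

Lemma cvg_expRN (c : R) : 0 < c -> expR (- (c * n.+2%:R)) @[n --> \oo] --> 0.
Proof.
move=> c0; apply: (@squeeze_cvgr _ _ _ _ (cst 0) (fun n => c^-1 * n.+1%:R^-1)).
- near=> n; rewrite expR_ge0/= expRN -invfM lef_pV2 ?posrE ?mulr_gt0 ?expR_gt0//.
  apply: le_trans (expR_ge1Dx _); apply: (@le_trans _ _ (c * n.+2%:R)); last by rewrite lerDr.
  by rewrite ler_pM2l// ler_nat.
- exact: cvg_cst.
- by rewrite -[X in _ --> X](mulr0 c^-1); apply: cvgM; [exact: cvg_cst|exact: cvg_harmonic].
Unshelve. all: by end_near. Qed.

(** Integration by parts on [[1 / (n + 1), n + 2]], an interval of positive length already for
    [n = 0]. The boundary terms vanish in the limit by the zero initial value and the exponential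
    order. *)
Lemma laplace_derive (w w' : R -> R) (M sg s : R) : sg < s ->
  (forall t : R, 0 < t -> is_derive t 1 w (w' t)) -> (forall t : R, 0 < t -> {for t, continuous w'}) ->
  w t @[t --> 0^'+] --> 0 ->
  (forall t : R, 0 < t -> `|w t| <= M * expR (sg * t)) ->
  (forall t : R, 0 < t -> `|w' t| <= M * expR (sg * t)) ->
  laplace_integrable w' s /\ laplace w' s = s * laplace w s.
Proof.
move=> sgs dw cw' w0 wM w'M.
have cw (t : R) : 0 < t -> {for t, continuous w}.
  by move=> t0; have [d _] := dw t t0; exact/differentiable_continuous/derivable1_diffP.
have mw : measurable_fun Rp w.
  by apply: open_continuous_measurable_fun; [exact: interval_open|move=> t; rewrite inE/= in_itv/= andbT; exact: cw].
have mw' : measurable_fun Rp w'.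
  by apply: open_continuous_measurable_fun; [exact: interval_open|move=> t; rewrite inE/= in_itv/= andbT; exact: cw'].
have iw := laplace_integrable_exp_order sgs mw wM.
have iw' := laplace_integrable_exp_order sgs mw' w'M.
split => //.
pose F (t : R) := expR (- (s * t)) * w t.
pose f (t : R) := expR (- (s * t)) * w' t - s * (expR (- (s * t)) * w t).
have fi : mu.-integrable Rp (EFin \o f).
  by apply: integrableRB => //; exact: integrableRZl.
have eE (t : R) : - (s * t) = - s * t by rewrite mulNr.
have dF (t : R) : 0 < t -> is_derive t 1 F (f t).
  move=> t0; have de : is_derive t 1 (fun t => expR (- (s * t))) (- s * expR (- (s * t))).
    by rewrite eE; under eq_fun do rewrite eE; exact: is_derive_expRM.
  apply: (is_derive_eq (@is_deriveM _ _ _ _ t 1 _ _ de (dw t t0))).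
  by rewrite /f /GRing.scale/=; ring.
have ce (t : R) : {for t, continuous (fun t => expR (- (s * t)))}.
  apply: (cvg_comp (fun x => - (s * x)) expR _ (@continuous_expR _ _)).
  by apply: cvgN; apply: cvgM; [exact: cvg_cst|exact: cvg_id].
have cf (t : R) : 0 < t -> {for t, continuous f}.
  move=> t0; apply: cvgB; first by apply: cvgM; [exact: ce|exact: cw'].
  by apply: cvgM; [exact: cvg_cst|apply: cvgM; [exact: ce|exact: cw]].
have cF (t : R) : 0 < t -> {for t, continuous F} by move=> t0; apply: cvgM; [exact: ce|exact: cw].
suff f0 : \int[mu]_(t in Rp) f t = 0.
  move: f0; rewrite RintegralB//; last exact: integrableRZl.
  by rewrite RintegralZl// => /eqP; rewrite subr_eq0 => /eqP.
pose J n := (`[n.+1%:R^-1, n.+2%:R]%classic : set R).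
have ab n : n.+1%:R^-1 < n.+2%:R :> R.
  by rewrite (@le_lt_trans _ _ 1)// ?ltr1n// invf_le1// ler1n.
have a0 n : 0 < n.+1%:R^-1 :> R by rewrite invr_gt0.
have JR n t : t \in `[n.+1%:R^-1, n.+2%:R] -> 0 < t.
  by rewrite in_itv/= => /andP[h _]; exact: lt_le_trans h.
have mJ n : measurable (J n) by exact: measurable_itv.
have mfJ n : measurable_fun (J n) f.
  case/integrableP : fi => /measurable_EFinP mf _.
  by apply: (measurable_funS measurable_Rp) mf => t /= /JR; rewrite in_itv/= andbT.
have JE n : \int[mu]_t ((f \_ (J n)) t) = F n.+2%:R - F n.+1%:R^-1.
  rewrite -Rintegral_mkcond /Rintegral (@continuous_FTC2 _ f F)//.
  - by apply: continuous_in_subspaceT => t; rewrite inE => /JR; exact: cf.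
  - split.
    + by move=> t /subset_itv_oo_cc/JR/dF[].
    + by apply: cvg_at_right_filter; exact: cF.
    + by apply: cvg_at_left_filter; apply: cF.
  - by move=> t /subset_itv_oo_cc/JR/dF[_ d]; rewrite derive1E.
have fiT : mu.-integrable setT (EFin \o (f \_ Rp)).
  by rewrite -restrict_EFin; apply/(integrable_mkcond _ _).1.
have mfT : measurable_fun [set: R] (f \_ Rp) by case/integrableP : fiT => /measurable_EFinP.
have [||||||_] := @dominated_cvg_Rintegral _ setT (fun n => f \_ (J n)) (f \_ Rp) (fun t => `|(f \_ Rp) t|).
- exact: measurableT.
- by move=> n; exact: (measurable_restrictT f (mJ n)).1 (mfJ n).
- exact: mfT.
- apply: aeW => t _; apply: cvg_near_cst; near=> n; rewrite /patch.
  have [t0|t0] := ltP 0 t; last first.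
    rewrite !memNset//=; first by rewrite in_itv/= andbT ltNge t0.
    by move=> /JR; rewrite ltNge t0.
  rewrite !mem_set//=; first by rewrite in_itv/= andbT.
  rewrite /J/= in_itv/=; apply/andP; split.
    rewrite -[leRHS]invrK lef_pV2 ?posrE ?invr_gt0//.
    by rewrite (@le_trans _ _ n%:R) ?ler_nat//; near: n; exact: nbhs_infty_ger.
  by rewrite (@le_trans _ _ n%:R) ?ler_nat//; [near: n; exact: nbhs_infty_ger|rewrite ltnW].
- by have := integrable_norm fiT.
- move=> n t _; rewrite /patch; case: ifPn => [/set_mem/JR t0|_]; last by rewrite normr0.
  by rewrite mem_set//= in_itv/= andbT.
rewrite -Rintegral_mkcond; under eq_cvg do rewrite JE.
move=> h; suff h0 : F n.+2%:R - F n.+1%:R^-1 @[n --> \oo] --> 0 by exact: cvg_unique h h0.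
rewrite -[X in _ --> X](subr0 0); apply: cvgB.
  apply/norm_cvg0P; apply: (@squeeze_cvgr _ _ _ _ (cst 0) (fun n => M * expR (- ((s - sg) * n.+2%:R)))).
  - near=> n; rewrite normr_ge0/= normrM ger0_norm ?expR_ge0//.
    have n0 : 0 < n.+2%:R :> R by [].
    apply: (le_trans (ler_wpM2l (expR_ge0 _) (wM _ n0))).
    rewrite mulrCA -expRD (_ : - (s * n.+2%:R) + sg * n.+2%:R = - ((s - sg) * n.+2%:R))//; by ring.
  - exact: cvg_cst.
  - rewrite -[X in _ --> X](mulr0 M); apply: cvgM; first exact: cvg_cst.
    by apply: cvg_expRN; rewrite subr_gt0.
have F0 : F t @[t --> 0^'+] --> 0.
  rewrite -[X in _ --> X](mulr0 (expR (- (s * 0)))); apply: cvgM => //.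
  by apply: cvg_at_right_filter; exact: ce.
move/cvg_at_rightP : F0 => /(_ (fun n => n.+1%:R^-1)); apply; split => //.
exact: cvg_harmonic.
Unshelve. all: by end_near. Qed.

(** The transform turns the mode equation into [f'' = (s + n ^ 2) f] on the open interval; the
    boundary condition of [mode_solution] gives continuity up to the ends. *)
Lemma mode_solution_laplace (a b : R) n (W : R -> R -> R) : a < b -> mode_solution a b n W ->
  \forall s \near +oo, exists al be, forall x, a <= x <= b ->
    laplace (W x) s = al * expR (Num.sqrt (s + n%:R ^+ 2) * x) + be * expR (- (Num.sqrt (s + n%:R ^+ 2) * x)).
Proof.
move=> ab [dW cW eqW iW [sg bW] bdW]; near=> s.
have s0 : 0 < s by near: s; apply: nbhs_pinfty_gt; exact: num_real.
have sgs : sg < s by near: s; apply: nbhs_pinfty_gt; exact: num_real.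
have [Wi cL] : (forall x, a <= x <= b -> laplace_integrable (W x) s) /\
    {within `[a, b], continuous (fun x => laplace (W x) s)} by near: s.
have sn0 : 0 < s + n%:R ^+ 2 by rewrite ltr_wpDr ?sqr_ge0.
pose W1 x t := derive1 (W ^~ t) x.
have mid x : a < x < b -> exists c d, [/\ a < c, c < x, x < d & d < b].
  move=> /andP[ax xb]; exists ((a + x) / 2), ((x + b) / 2); split; lra.
have dW1 (x t : R) : a < x < b -> 0 < t -> is_derive x 1 (W ^~ t) (W1 x t).
  by move=> xab t0; have [_ h _] := dW x t xab t0; apply: DeriveDef => //; rewrite -derive1E.
have dW2 (x t : R) : a < x < b -> 0 < t -> is_derive x 1 (W1 ^~ t) (derive1 (W x) t + n%:R ^+ 2 * W x t).
  move=> xab t0; have [_ _ h] := dW x t xab t0; apply: DeriveDef => //; rewrite -derive1E.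
  by have := eqW x t xab t0; rewrite /derive1n/= => /eqP; rewrite addrAC subr_eq0 => /eqP ->.
have mW x : a < x < b -> measurable_fun Rp (W x).
  move=> /andP[ax xb]; have := Wi x; rewrite (ltW ax) (ltW xb) => /(_ isT).
  move=> /measurable_laplace_integrand; move/(measurable_restrictT _ measurable_Rp).2; exact.
have iW1 x : a < x < b -> laplace_integrable (W1 x) s.
  move=> xab; have [c [d [ac cx xd db]]] := mid x xab; have [M HM] := bW c d ac db.
  apply: (@laplace_integrable_exp_order _ M sg) => //.
    by apply: (@measurable_partial W W1 a b x) => // t t0; exact: dW1.
  by move=> t t0; have [] := HM x t; rewrite ?(ltW cx) ?(ltW xd).
apply: (@ode_exp _ _ (fun x => laplace (W1 x) s) a b) => //; first by rewrite sqrtr_gt0.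
  move=> x xab; have [c [d [ac cx xd db]]] := mid x xab; have [M HM] := bW c d ac db.
  have sub y : c < y < d -> a < y < b by move=> /andP[cy yd]; rewrite (lt_trans ac cy) (lt_trans yd db).
  apply: (@is_derive_laplace W W1 c d x s M sg) => //.
  - by rewrite cx.
  - by move=> y /sub/andP[ay yb]; apply: Wi; rewrite !ltW.
  - by move=> y t /sub; exact: dW1.
  - by move=> y t /andP[cy yd] t0; have [] := HM y t; rewrite ?(ltW cy) ?(ltW yd).
move=> x xab; have [c [d [ac cx xd db]]] := mid x xab; have [M HM] := bW c d ac db.
have sub y : c < y < d -> a < y < b by move=> /andP[cy yd]; rewrite (lt_trans ac cy) (lt_trans yd db).
(* No growth bound on the second [x]-derivative is assumed; the equation expresses it by [W_t] and
   [W], which are bounded. *)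
pose W2 y t := derive1 (W y) t + n%:R ^+ 2 * W y t.
have D2 : is_derive x 1 (fun y => laplace (W1 y) s) (laplace (W2 x) s).
  apply: (@is_derive_laplace W1 W2 c d x s (M + n%:R ^+ 2 * M) sg) => //.
  - by rewrite cx.
  - by move=> y /sub; exact: iW1.
  - by move=> y t /sub; exact: dW2.
  - move=> y t /andP[cy yd] t0; have cyd : c <= y <= d by rewrite (ltW cy) (ltW yd).
    have [b1 b2 _] := HM y t cyd t0.
    rewrite /W2; apply: (le_trans (ler_normD _ _)); rewrite mulrDl lerD//.
    by rewrite normrM ger0_norm ?sqr_ge0// -mulrA ler_wpM2l ?sqr_ge0.
apply: (is_derive_eq D2); rewrite sqr_sqrtr ?(ltW sn0)//.
have [|||||iWt eWt] := @laplace_derive (W x) (derive1 (W x)) M sg s sgs.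
- by move=> t t0; have [h _ _] := dW x t xab t0; apply: DeriveDef => //; rewrite -derive1E.
- move=> t t0; have [ct _] := cW x t xab t0.
  have cp : (fun t' : R => (x, t')) t' @[t' --> t] --> (x, t).
    exact: (@cvg_pair _ _ _ _ _ _ _ _ _ (fun=> x) id (cvg_cst x) cvg_id).
  exact: (cvg_comp (fun t => (x, t)) _ cp ct).
- by have [] := iW x xab.
- by move=> t t0; have [] := HM x t; rewrite ?(ltW cx) ?(ltW xd).
- by move=> t t0; have [] := HM x t; rewrite ?(ltW cx) ?(ltW xd).
have iWx : laplace_integrable (W x) s by apply: Wi; case/andP : xab => /ltW -> /ltW ->.
have E (t : R) : expR (- (s * t)) * W2 x t = expR (- (s * t)) * derive1 (W x) t + n%:R ^+ 2 * (expR (- (s * t)) * W x t).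
  by rewrite /W2; ring.
transitivity (\int[mu]_(t in Rp) (expR (- (s * t)) * derive1 (W x) t + n%:R ^+ 2 * (expR (- (s * t)) * W x t))).
  by apply: eq_Rintegral => t _; exact: E.
rewrite RintegralD//; last exact: integrableRZl.
by rewrite RintegralZl// -/(laplace _ _) eWt mulrDl.
Unshelve. all: by end_near. Qed.
End LaplaceDerivatives.

(** * Symbols and Dirichlet-to-Neumann maps *)

Section Symbols.
Context {R : realType}.
Implicit Types (a b z : R).

(* [coth (a sqrt z) = 1 + 2 coth_sym a z], [1 / sinh (a sqrt z) = 2 csch_sym a z]
   and [tanh (a sqrt z) = 1 - 2 tanh_sym a z]. *)
Definition coth_sym a z : R :=
  expR (- (2 * a * Num.sqrt z)) / (1 - expR (- (2 * a * Num.sqrt z))).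
Definition csch_sym a z : R :=
  expR (- (a * Num.sqrt z)) / (1 - expR (- (2 * a * Num.sqrt z))).
Definition tanh_sym a z : R := coth_sym a z - 2 * coth_sym (2 * a) z.

Lemma expR_double_lt1 a z : 0 < a -> 0 < z ->
  expR (- (2 * a * Num.sqrt z)) = expR (- (a * Num.sqrt z)) ^+ 2 /\
  expR (- (a * Num.sqrt z)) ^+ 2 < 1.
Proof.
move=> a0 z0; have e : expR (- (2 * a * Num.sqrt z)) = expR (- (a * Num.sqrt z)) ^+ 2.
  by rewrite expr2 -expRD; congr expR; ring.
by split => //; rewrite -e expR_lt1 oppr_lt0 !mulr_gt0// sqrtr_gt0.
Qed.

Lemma csch_sym_sqr a z : 0 < a -> 0 < z ->
  csch_sym a z ^+ 2 = coth_sym a z + coth_sym a z ^+ 2.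
Proof.
move=> a0 z0; rewrite /csch_sym /coth_sym; have [-> e1] := expR_double_lt1 a0 z0.
by field; rewrite subr_eq0 gt_eqF.
Qed.

Lemma tanh_coth_sym a z : 0 < a -> 0 < z ->
  (1 - 2 * tanh_sym a z) * (1 + 2 * coth_sym a z) = 1.
Proof.
move=> a0 z0; rewrite /tanh_sym /coth_sym.
have [-> e1] := expR_double_lt1 (mulr_gt0 (ltr0Sn _ 1) a0) z0.
have [-> _] := expR_double_lt1 a0 z0; have [_ e2] := expR_double_lt1 a0 z0.
move: e1 e2; have [-> _] := expR_double_lt1 a0 z0.
set E := expR _ => e1 e2; field.
by rewrite !subr_eq0 !gt_eqF.
Qed.

Lemma coth_sym_ge0 a z : 0 < a -> 0 < z -> 0 <= coth_sym a z.
Proof.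
move=> a0 z0; rewrite /coth_sym; have [-> e1] := expR_double_lt1 a0 z0.
by rewrite divr_ge0 ?sqr_ge0// subr_ge0 ltW.
Qed.

Lemma csch_sym_ge0 a z : 0 < a -> 0 < z -> 0 <= csch_sym a z.
Proof.
move=> a0 z0; rewrite /csch_sym; have [-> e1] := expR_double_lt1 a0 z0.
by rewrite divr_ge0 ?expR_ge0// subr_ge0 ltW.
Qed.

Lemma coth_sym_le a b z : 0 < a -> a <= b -> 0 < z -> coth_sym b z <= coth_sym a z.
Proof.
move=> a0 ab z0; have b0 := lt_le_trans a0 ab; rewrite /coth_sym.
have [-> e1] := expR_double_lt1 a0 z0; have [-> e2] := expR_double_lt1 b0 z0.
have h : expR (- (b * Num.sqrt z)) ^+ 2 <= expR (- (a * Num.sqrt z)) ^+ 2.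
  by rewrite lerXn2r ?nnegrE ?expR_ge0// ler_expR lerN2 ler_wpM2r ?sqrtr_ge0.
by rewrite ler_pM ?sqr_ge0 ?invr_ge0 ?subr_ge0 ?(ltW e2)// lef_pV2 ?posrE ?subr_gt0// lerD2l lerN2.
Qed.

Lemma csch_sym_le a b z : 0 < a -> a <= b -> 0 < z -> csch_sym b z <= csch_sym a z.
Proof.
move=> a0 ab z0; have b0 := lt_le_trans a0 ab; rewrite /csch_sym.
have [-> e1] := expR_double_lt1 a0 z0; have [-> e2] := expR_double_lt1 b0 z0.
have h1 : expR (- (b * Num.sqrt z)) <= expR (- (a * Num.sqrt z)).
  by rewrite ler_expR lerN2 ler_wpM2r ?sqrtr_ge0.
have h : expR (- (b * Num.sqrt z)) ^+ 2 <= expR (- (a * Num.sqrt z)) ^+ 2.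
  by rewrite lerXn2r ?nnegrE ?expR_ge0.
by rewrite ler_pM ?expR_ge0 ?invr_ge0 ?subr_ge0 ?(ltW e2)// lef_pV2 ?posrE ?subr_gt0// lerD2l lerN2.
Qed.

End Symbols.

Section NormalDerivatives.
Context {R : realType}.
Implicit Types (f : R -> R) (a b z : R).

Lemma is_normal_derive_uniq f x nu (d d' : R) :
  is_normal_derive f x nu d -> is_normal_derive f x nu d' -> d = d'.
Proof. by move=> h h'; apply: cvg_unique h h'. Qed.

(** [f] is known only on the inner side of [x]; [g] is a smooth extension of it across the end
    point. *)
Lemma is_normal_deriveE f (g : R -> R) (x nu d d' : R) : is_derive x 1 g d' ->
  f x = g x -> (\forall h \near 0^'+, f (x - h * nu) = g (x - h * nu)) -> d = nu * d' ->
  is_normal_derive f x nu d.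
Proof.
move=> dg fgx fg ->; rewrite /is_normal_derive.
have d1 : is_derive (0 : R) 1 (fun h : R => x - h * nu) (- nu).
  have e0 := @is_deriveZ _ _ _ _ nu _ _ _ (is_derive_id (0 : R) 1).
  have e1 := is_deriveB (is_derive_cst x (0 : R) 1) e0.
  have -> : (fun h : R => x - h * nu) = cst x - nu \*: id.
    by apply/funext => h; rewrite !fctE /GRing.scale/= mulrC.
  by apply: (is_derive_eq e1); rewrite sub0r /GRing.scale/= mulr1.
have x0 : x - 0 * nu = x by rewrite mul0r subr0.
have dg0 : is_derive (x - 0 * nu) 1 g d' by rewrite x0.
have [D e] := @is_derive1_comp _ g (fun h : R => x - h * nu) (0 : R) _ _ dg0 d1.
have D' : h^-1 *: ((g \o (fun h : R => x - h * nu)) (h *: 1 + 0) - (g \o (fun h : R => x - h * nu)) 0)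
   @[h --> 0^'] --> 'D_1 (g \o (fun h : R => x - h * nu)) 0 := D.
rewrite e in D'; have := cvgN (cvg_dnbhs_at_right D').
rewrite (_ : - (d' * - nu) = nu * d'); last by rewrite mulrN opprK mulrC.
have C : Filter (0 : R)^'+ by typeclasses eauto.
move=> /(_ C); apply: cvg_trans; apply: near_eq_cvg; near=> h.
have -> : f (x - h * nu) = g (x - h * nu) by near: h.
by rewrite !fctE /GRing.scale/= mulr1 addr0 x0 fgx; ring.
Unshelve. all: by end_near. Qed.

(** The Dirichlet-to-Neumann map of [f'' = w ^ 2 f]: at each end [w] times [coth] of the own value
    minus [1 / sinh] of the opposite value. *)
Lemma exp_sum_normal_derive f a b (w al be : R) : a < b -> 0 < w ->
  (forall x, a <= x <= b -> f x = al * expR (w * x) + be * expR (- (w * x))) ->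
  is_normal_derive f b 1 (w * ((1 + 2 * coth_sym (b - a) (w ^+ 2)) * f b - 2 * csch_sym (b - a) (w ^+ 2) * f a)) /\
  is_normal_derive f a (-1) (w * ((1 + 2 * coth_sym (b - a) (w ^+ 2)) * f a - 2 * csch_sym (b - a) (w ^+ 2) * f b)).
Proof.
move=> ab w0 fE; pose g (x : R) := al * expR (w * x) + be * expR (- (w * x)).
have ba0 : 0 < b - a by rewrite subr_gt0.
have dg (x : R) : is_derive x 1 g (w * (al * expR (w * x) - be * expR (- (w * x)))).
  have d1 := @is_deriveZ _ _ _ _ al _ _ _ (is_derive_expRM w x).
  have d2 := @is_deriveZ _ _ _ _ be _ _ _ (is_derive_expRM (- w) x).
  have -> : g = al \*: (fun x => expR (w * x)) + be \*: (fun x => expR (- w * x)).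
    by apply/funext => y; rewrite /g !fctE /GRing.scale/= mulNr.
  by apply: (is_derive_eq (is_deriveD d1 d2)); rewrite /GRing.scale/= !mulNr; ring.
have [s2 e1] := expR_double_lt1 ba0 (exprn_gt0 2 w0).
(* With this substitution both formulas are rational in [exp (w a)] and [exp (- ((b - a) w))]. *)
have eb : expR (w * b) = expR (w * a) / expR (- ((b - a) * Num.sqrt (w ^+ 2))).
  rewrite sqrtr_sqr gtr0_norm// -expRN -expRD; congr expR; ring.
have X0 := expR_gt0 (w * a); have Y0 := expR_gt0 (- ((b - a) * Num.sqrt (w ^+ 2))).
rewrite /coth_sym /csch_sym s2 !fE ?lexx ?(ltW ab)//.
split.
  apply: (is_normal_deriveE (dg b)).
  - by rewrite fE// lexx (ltW ab).
  - near=> h; rewrite mulr1 fE//; apply/andP; split.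
      by rewrite lerBrDl -lerBrDr; near: h; exact: nbhs_right_le.
    by rewrite gerBl; near: h; exact: nbhs_right_ge.
  rewrite (expRN (w * b)) (expRN (w * a)) eb; move: e1 X0 Y0; set X := expR (w * a); set E := expR _ => e1 X0 Y0.
  have := lt0r_neq0 X0; have := lt0r_neq0 Y0; have := subr_gt0 (E ^+ 2) 1; rewrite e1 => /lt0r_neq0 n1 n2 n3; by field; rewrite ?n1 ?n2 ?n3.
apply: (is_normal_deriveE (dg a)).
- by rewrite fE// lexx (ltW ab).
- near=> h; rewrite mulrN1 opprK fE//; apply/andP; split.
    by rewrite lerDl; near: h; exact: nbhs_right_ge.
  by rewrite -lerBrDl; near: h; exact: nbhs_right_le.
rewrite (expRN (w * b)) (expRN (w * a)) eb; move: e1 X0 Y0; set X := expR (w * a); set E := expR _ => e1 X0 Y0.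
have := lt0r_neq0 X0; have := lt0r_neq0 Y0; have := subr_gt0 (E ^+ 2) 1; rewrite e1 => /lt0r_neq0 n1 n2 n3; by field; rewrite ?n1 ?n2 ?n3.
Unshelve. all: by end_near. Qed.

End NormalDerivatives.

(** * Norms of the operators of one step *)

Section WeightedBounds.
Context {R : realType}.
Local Notation mu := (@lebesgue_measure R).
Local Notation Rp := (`]0%R, +oo[%classic : set R).
Context (m : nat) (T s0 : R) (s00 : 0 < s0).

(* Convolution with [k] has norm at most [be] for the norm
   [sup_(0 < t < T) expR (- (s0 * t)) * |w t|], uniformly in the mode. *)
Definition kernel_bound (K : R -> R) (be : R) : Prop := exists k kb : R -> R,
  [/\ has_laplace k K, forall t, 0 < t < T -> `|k t| <= kb t, forall t, 0 <= kb t,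
      laplace_integrable kb s0 & laplace kb s0 <= be].

(* Sequences of modes are given by their transforms [F n] only; uniqueness of the
   Laplace transform recovers the bound for any representative (see
   [l2_bounded_ae]). *)
Definition l2_bounded (B : R) (F : nat -> R -> R) : Prop := exists v : nat -> R -> R,
  (forall n, (0 < n)%N -> has_laplace (v n) (F n)) /\
  {ae mu, forall t, 0 < t < T -> l2 m (v ^~ t) <= B * expR (s0 * t)}.

Lemma kernel_boundD K L be ga : kernel_bound K be -> kernel_bound L ga ->
  kernel_bound (fun s => K s + L s) (be + ga).
Proof.
move=> [k [kb [h1 h2 h3 h4 h5]]] [l [lb [g1 g2 g3 g4 g5]]].
have [i e] := laplaceD h4 g4.
exists (fun t => k t + l t), (fun t => kb t + lb t); split => //.
- exact: has_laplaceD.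
- by move=> t tT; apply: (le_trans (ler_normD _ _)); rewrite lerD ?h2 ?g2.
- by move=> t; rewrite addr_ge0.
- by rewrite e lerD.
Qed.

Lemma kernel_boundN K be : kernel_bound K be -> kernel_bound (fun s => - K s) be.
Proof.
move=> [k [kb [h1 h2 h3 h4 h5]]]; exists (fun t => -1 * k t), kb; split => //.
- have := has_laplaceZ (-1) h1; apply: has_laplace_eq; apply: nearW => s.
  by rewrite mulN1r.
- by move=> t tT; rewrite mulN1r normrN h2.
Qed.

Lemma has_laplace_coth (a : R) : 0 < a -> has_laplace (heat_series (2 * a) (2 * a)) (coth_sym a).
Proof.
move=> a0; have a20 : 0 < 2 * a by rewrite mulr_gt0.
near=> s; have s1 : 0 < s by near: s; apply: nbhs_pinfty_gt; exact: num_real.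
exact: heat_series_laplace.
Unshelve. all: by end_near. Qed.

Lemma has_laplace_csch (a : R) : 0 < a -> has_laplace (heat_series a (2 * a)) (csch_sym a).
Proof.
move=> a0; have a20 : 0 < 2 * a by rewrite mulr_gt0.
near=> s; have s1 : 0 < s by near: s; apply: nbhs_pinfty_gt; exact: num_real.
exact: heat_series_laplace.
Unshelve. all: by end_near. Qed.

(** The kernel is nonnegative, hence its own majorant; the symbol at [s0] decreases with the width,
    so the least width [h] gives a common bound. *)
Lemma kernel_bound_csch (h a : R) : 0 < h -> h <= a -> kernel_bound (csch_sym a) (csch_sym h s0).
Proof.
move=> h0 ha; have a0 := lt_le_trans h0 ha; have a20 : 0 < 2 * a by rewrite mulr_gt0.
have [i e] := heat_series_laplace a0 a20 s00.
exists (heat_series a (2 * a)), (heat_series a (2 * a)); split => //.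
- exact: has_laplace_csch.
- by move=> t _; rewrite ger0_norm// heat_series_ge0.
- by move=> t; rewrite heat_series_ge0.
- by rewrite e; exact: csch_sym_le.
Qed.

Lemma kernel_bound_dominated (h a : R) (k K : R -> R) : 0 < h -> h <= a ->
  has_laplace k K -> (forall t, 0 < t < T -> `|k t| <= heat_series (2 * a) (2 * a) t) ->
  kernel_bound K (coth_sym h s0).
Proof.
move=> h0 ha kK kb; have a0 := lt_le_trans h0 ha; have a20 : 0 < 2 * a by rewrite mulr_gt0.
have [i e] := heat_series_laplace a20 a20 s00.
exists k, (heat_series (2 * a) (2 * a)); split => //.
- by move=> t; rewrite heat_series_ge0.
- by rewrite e; exact: coth_sym_le.
Qed.

Lemma kernel_bound_coth (h a : R) : 0 < h -> h <= a -> kernel_bound (coth_sym a) (coth_sym h s0).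
Proof.
move=> h0 ha; have a0 := lt_le_trans h0 ha; have a20 : 0 < 2 * a by rewrite mulr_gt0.
apply: (kernel_bound_dominated h0 ha (has_laplace_coth a0)) => t _.
by rewrite ger0_norm// heat_series_ge0.
Qed.

(** By the duplication formula the kernel is [A - 2 A'] with [0 <= A' <= A], so it stays between
    [- A] and [A]: [tanh] costs no more than [coth]. *)
Lemma kernel_bound_tanh (h a : R) : 0 < h -> h <= a -> kernel_bound (tanh_sym a) (coth_sym h s0).
Proof.
move=> h0 ha; have a0 := lt_le_trans h0 ha; have a20 : 0 < 2 * a by rewrite mulr_gt0.
have a40 : 0 < 2 * (2 * a) by rewrite mulr_gt0.
apply: (@kernel_bound_dominated h a (fun t => heat_series (2 * a) (2 * a) t +
   (- 2) * heat_series (2 * (2 * a)) (2 * (2 * a)) t)) => //.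
  have := has_laplaceD (has_laplace_coth a0) (has_laplaceZ (-2) (has_laplace_coth a20)).
  by apply: has_laplace_eq; apply: nearW => s; rewrite mulNr.
move=> t _; have := heat_series_double t a20; have := heat_series_ge0 t a40 a40.
by move=> p q; rewrite ler_norml; apply/andP; split; lra.
Qed.

(* For [T <= 4 h ^ 2] the two kernels differ by at most one of them: the wider
   one is at most twice the other on [0, T]. *)
Lemma kernel_bound_coth_sub (h a b : R) : 0 < h -> T <= 4 * h ^+ 2 -> h <= a -> h <= b ->
  kernel_bound (fun s => coth_sym a s - coth_sym b s) (coth_sym h s0).
Proof.
move=> h0 Th; wlog ab : a b / a <= b => [H ha hb|ha hb].
  have [ab|/ltW ba] := leP a b; first exact: H.
  have := kernel_boundN (H _ _ ba hb ha); move=> [k [kb [h1 h2 h3 h4 h5]]].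
  exists k, kb; split => //; apply: has_laplace_eq h1; apply: nearW => s.
  by rewrite opprB.
have a0 := lt_le_trans h0 ha; have a20 : 0 < 2 * a by rewrite mulr_gt0.
have b0 := lt_le_trans h0 hb; have b20 : 0 < 2 * b by rewrite mulr_gt0.
apply: (@kernel_bound_dominated h a (fun t => heat_series (2 * a) (2 * a) t +
   (- 1) * heat_series (2 * b) (2 * b) t)) => //.
  have := has_laplaceD (has_laplace_coth a0) (has_laplaceZ (-1) (has_laplace_coth b0)).
  by apply: has_laplace_eq; apply: nearW => s; rewrite mulN1r.
move=> t /andP[t0 tT]; have q := heat_series_ge0 t b20 b20.
have : heat_series (2 * b) (2 * b) t <= 2 * heat_series (2 * a) (2 * a) t.
  apply: heat_series_le2 => //; first by rewrite ler_pM2l.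
  apply: (le_trans (ltW tT)); apply: (le_trans Th).
  by rewrite exprMn -natrX ler_pM2l// lerXn2r ?nnegrE ?(ltW h0) ?(ltW a0).
by move=> p; rewrite ler_norml; apply/andP; split; lra.
Qed.

Lemma l2_bounded_eq B F G : (forall n, (0 < n)%N -> \forall s \near +oo, F n s = G n s) ->
  l2_bounded B F -> l2_bounded B G.
Proof.
move=> FG [v [vF vB]]; exists v; split => // n n0.
exact: has_laplace_eq (FG n n0) (vF n n0).
Qed.

Lemma l2_bounded_le B B' F : l2_bounded B F -> B <= B' -> l2_bounded B' F.
Proof.
move=> [v [vF vB]] BB'; exists v; split => //; apply: ae_imply vB => t vB tT.
by apply: (le_trans (vB tT)); rewrite ler_wpM2r ?expR_ge0.
Qed.

Lemma l2_boundedD B B' F G : l2_bounded B F -> l2_bounded B' G ->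
  l2_bounded (B + B') (fun n s => F n s + G n s).
Proof.
move=> [v [vF vB]] [w [wG wB]]; exists (fun n t => v n t + w n t); split.
  by move=> n n0; apply: has_laplaceD; [exact: vF|exact: wG].
apply: ae_imply (ae_and vB wB) => t [h1 h2] tT.
by apply: (le_trans (l2D _ _ _)); rewrite mulrDl lerD ?h1 ?h2.
Qed.

Lemma l2_boundedN B F : l2_bounded B F -> l2_bounded B (fun n s => - F n s).
Proof.
move=> [v [vF vB]]; exists (fun n t => -1 * v n t); split.
  move=> n n0; have := has_laplaceZ (-1) (vF n n0).
  by apply: has_laplace_eq; apply: nearW => s; rewrite mulN1r.
apply: ae_imply vB => t h1 tT; rewrite l2Z normrN normr1 mul1r; exact: h1.
Qed.

Lemma l2_bounded_kernel K be B F : 0 <= B -> kernel_bound K be -> l2_bounded B F ->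
  l2_bounded (be * B) (fun n s => K (s + n%:R ^+ 2) * F n s).
Proof.
move=> B0 [k [kb [kK kkb kb0 kbi kbe]]] [v [vF vB]].
(* Nothing is known of [v 0], not even measurability, and [l2] does not see it; it is replaced by
   0. *)
pose w n := if n is 0%N then fun=> 0 else v n.
have wv t : l2 m (w ^~ t) = l2 m (v ^~ t).
  rewrite /l2; congr Num.sqrt; apply: eq_big_nat => n /andP[n1 _].
  by case: n n1.
have mS f G : has_laplace f G -> measurable_fun [set: R] (f \_ Rp).
  move=> h; have [s1 _ H] := near_pinfty_ge h; have [i _] := H s1 (lexx _).
  exact: measurable_laplace_integrand i.
have mw n : measurable_fun [set: R] (w n \_ Rp).
  case: n => [|n] /=; last exact: mS (vF n.+1 isT).
  rewrite (_ : (fun=> 0) \_ Rp = fun=> 0)//.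
  by apply/funext => t; rewrite patchE; case: ifP.
exists (fun n => conv (damp n k) (w n)); split.
  move=> [//|n] _; apply: has_laplaceM; last exact: vF.
  exact: has_laplace_damp.
apply: aeW => t tT.
have wB : {ae mu, forall t, 0 < t < T -> l2 m (w ^~ t) <= B * expR (s0 * t)}.
  by apply: ae_imply vB => u; rewrite wv.
apply: (le_trans (conv_l2_le B0 (mS _ _ kK) mw kkb kb0 kbi wB tT)).
by rewrite ler_wpM2r ?expR_ge0// ler_wpM2r.
Qed.

Lemma l2_bounded0 B : 0 <= B -> l2_bounded B (fun _ _ => 0).
Proof.
move=> B0; exists (fun _ _ => 0); split.
  move=> n _; apply: nearW => s; rewrite /laplace_integrable /laplace; split.
    by apply: (@eqR_integrable _ _ (cst 0%E)); [exact: measurable_itv|move=> t _; rewrite mulr0|exact: integrable0].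
  by under eq_Rintegral do rewrite mulr0; rewrite /Rintegral integral0.
apply: aeW => t _; rewrite /l2 big1 ?sqrtr0 ?mulr_ge0 ?expR_ge0// => n _.
by rewrite expr0n.
Qed.

Lemma l2_bounded_ae B F (v : nat -> R -> R) : l2_bounded B F ->
  (forall n, (0 < n)%N -> has_laplace (v n) (F n)) ->
  {ae mu, forall t, 0 < t < T -> l2 m (v ^~ t) <= B * expR (s0 * t)}.
Proof.
move=> [w [wF wB]] vF.
have vw : {ae mu, forall t n, (0 < n)%N -> 0 < t -> v n t = w n t}.
  apply/ae_foralln => -[|n]; first by apply: aeW.
  by apply: ae_imply (has_laplace_uniq (vF n.+1 isT) (wF n.+1 isT)) => t h _.
apply: ae_imply (ae_and vw wB) => t [h1 h2] /[dup] tT /andP[t0 _].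
apply: le_trans (h2 tT); rewrite le_eqVlt; apply/orP; left; apply/eqP.
rewrite /l2; congr Num.sqrt; apply: eq_big_nat => n /andP[n1 _].
by rewrite h1.
Qed.

End WeightedBounds.

(** * The iteration on the interfaces *)

Section ModeLaplace.
Context {R : realType}.
Local Notation mu := (@lebesgue_measure R).
Local Notation D := (`]0%R, pi[%classic : set R).
Local Notation Rp := (`]0%R, +oo[%classic : set R).

Lemma eq_laplace (v w : R -> R) s : (forall t, 0 < t -> v t = w t) -> laplace v s = laplace w s.
Proof.
by move=> vw; apply: eq_Rintegral => t; rewrite inE/= in_itv/= andbT => t0; rewrite vw.
Qed.

Lemma eq_laplace_integrable (v w : R -> R) s : (forall t, 0 < t -> v t = w t) ->
  laplace_integrable v s -> laplace_integrable w s.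
Proof.
move=> vw; apply: eqR_integrable; first exact: measurable_itv.
by move=> t /=; rewrite in_itv/= andbT => t0; rewrite vw.
Qed.

Lemma ae_eq_laplace (v w : R -> R) s : laplace_integrable v s -> laplace_integrable w s ->
  {ae mu, forall t, 0 < t -> v t = w t} -> laplace v s = laplace w s.
Proof.
move=> /integrableP[mv _] /integrableP[mw _] vw; rewrite /laplace /Rintegral; congr fine.
have H : {ae mu, forall t, Rp t -> (expR (- (s * t)) * v t)%:E = (expR (- (s * t)) * w t)%:E}.
  by apply: ae_imply vw => t vw /=; rewrite in_itv/= andbT => t0; rewrite vw.
exact: (@ae_eq_integral _ _ R mu Rp _ _ measurable_Rp mv mw H).
Qed.

Lemma sin_coef_interface (f h : R -> R -> R) n t : on_interface f h -> 0 < t ->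
  sin_coef (f ^~ t) n = sin_coef (h ^~ t) n.
Proof.
move=> fh t0; rewrite /sin_coef; congr (_ * _); apply: eq_Rintegral => y.
by rewrite inE/= in_itv/= => y0; rewrite fh.
Qed.

Lemma sin_coef0 n : sin_coef (fun=> 0 : R) n = 0.
Proof.
rewrite /sin_coef; under eq_Rintegral do rewrite mul0r.
by rewrite /Rintegral integral0 mulr0.
Qed.

Lemma laplace0 s : laplace (fun=> 0 : R) s = 0.
Proof.
by rewrite /laplace; under eq_Rintegral do rewrite mulr0; rewrite /Rintegral integral0.
Qed.

Lemma laplace_integrable0 s : laplace_integrable (fun=> 0 : R) s.
Proof.
apply: (@eqR_integrable _ _ (cst 0%E)); [exact: measurable_itv| |exact: integrable0].
by move=> t _; rewrite mulr0.
Qed.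

Lemma eq_square_integrable (v w : R -> R) : (forall y, D y -> v y = w y) ->
  square_integrable v -> square_integrable w.
Proof.
move=> vw [mv iv]; split.
  by apply: eq_measurable_fun mv => y; rewrite inE => /vw.
by apply: eqR_integrable iv; [exact: measurable_0pi|move=> y /vw ->].
Qed.

Lemma sin_coefD (v w : R -> R) n : square_integrable v -> square_integrable w ->
  sin_coef (fun y => v y + w y) n = sin_coef v n + sin_coef w n.
Proof.
move=> vs ws; have ss := @square_integrable_sine R n.
rewrite /sin_coef -mulrDr; congr (_ * _).
rewrite -[RHS](@RintegralD _ _ R mu D (fun y => v y * sine n y) (fun y => w y * sine n y) measurable_0pi (square_integrableM vs ss) (square_integrableM ws ss)).
by apply: eq_Rintegral => y _; rewrite mulrDl.
Qed.

Lemma sin_coefZ (c : R) (v : R -> R) n : square_integrable v ->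
  sin_coef (fun y => c * v y) n = c * sin_coef v n.
Proof.
move=> vs; have ss := @square_integrable_sine R n.
rewrite /sin_coef mulrCA; congr (_ * _).
rewrite -[RHS](@RintegralZl _ _ R mu D (fun y => v y * sine n y) c measurable_0pi (square_integrableM vs ss)).
by apply: eq_Rintegral => y _; rewrite mulrA.
Qed.

Lemma heat_square_integrable (a b x : R) (U : R -> R -> R -> R) : heat_solution a b U ->
  a <= x <= b -> {ae mu, forall t, 0 < t -> square_integrable (fun y => U x y t)}.
Proof.
move=> hU xab; apply: ae_imply (heat_L2 hU xab) => t h t0.
apply: L2norm_square_integrable (h t0).
apply: (measurable_section measurable_0pi measurable_Rp (heat_measurable hU xab)).
by rewrite /= in_itv/= andbT.
Qed.

Lemma heat_laplace_integrable (a b x : R) (U : R -> R -> R -> R) n : heat_solution a b U ->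
  a <= x <= b -> (0 < n)%N -> \forall s \near +oo, laplace_integrable (mode U n x) s.
Proof.
move=> hU xab n0; have [_ _ _ _ _ h] := heat_mode hU n0; near=> s.
have [+ _] : (forall x, a <= x <= b -> laplace_integrable (mode U n x) s) /\
    {within `[a, b], continuous (fun x => laplace (mode U n x) s)} by near: s.
exact.
Unshelve. all: by end_near. Qed.

Lemma heat_normal_derive (a b : R) (U : R -> R -> R -> R) n : a < b -> heat_solution a b U ->
  (0 < n)%N -> \forall s \near +oo,
  let z := s + n%:R ^+ 2 in let f := mode_laplace U n s in
  is_normal_derive f b 1 (Num.sqrt z * ((1 + 2 * coth_sym (b - a) z) * f b - 2 * csch_sym (b - a) z * f a)) /\
  is_normal_derive f a (-1) (Num.sqrt z * ((1 + 2 * coth_sym (b - a) z) * f a - 2 * csch_sym (b - a) z * f b)).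
Proof.
move=> ab hU n0; near=> s.
have s0 : 0 < s by near: s; apply: nbhs_pinfty_gt; exact: num_real.
have z0 : 0 < s + n%:R ^+ 2 by rewrite ltr_wpDr ?sqr_ge0.
have [al [be E]] : exists al be, forall x, a <= x <= b ->
    laplace (mode U n x) s = al * expR (Num.sqrt (s + n%:R ^+ 2) * x) + be * expR (- (Num.sqrt (s + n%:R ^+ 2) * x)).
  by near: s; exact: mode_solution_laplace ab (heat_mode hU n0).
have w0 : 0 < Num.sqrt (s + n%:R ^+ 2) by rewrite sqrtr_gt0.
have := @exp_sum_normal_derive R (mode_laplace U n s) a b _ al be ab w0 E.
by rewrite sqr_sqrtr ?(ltW z0).
Unshelve. all: by end_near. Qed.

End ModeLaplace.

Section Relations.
Context {R : realType} (N : nat) (x : nat -> R) (T : R).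
Context (u psi : nat -> nat -> R -> R -> R -> R) (g : nat -> nat -> R -> R -> R).
Context (hx : forall i, (i < N)%N -> x i < x i.+1) (hg : nnwr (1 / 4) N x T u psi g).
Local Notation mu := (@lebesgue_measure R).
Local Notation D := (`]0%R, pi[%classic : set R).

Definition width (j : nat) : R := x j - x j.-1.
Definition interface_mode (k i n : nat) (t : R) : R := sin_coef (fun y => g k i y t) n.
Definition interface_lap (k i n : nat) (s : R) : R := laplace (interface_mode k i n) s.

(* The jump of the normal derivatives of the Dirichlet solutions at the
   interface [i], divided by [sqrt (s + n ^ 2)]. *)
Definition flux_jump (k i n : nat) (s : R) : R :=
  let z := s + n%:R ^+ 2 in let G j := interface_lap k j n s in
  ((1 + 2 * coth_sym (width i) z) * G i - 2 * csch_sym (width i) z * G i.-1) +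
  ((1 + 2 * coth_sym (width i.+1) z) * G i - 2 * csch_sym (width i.+1) z * G i.+1).

Lemma interface_lt j : (1 <= j <= N)%N -> x j.-1 < x j.
Proof. by case: j => // j /andP[_ jN]; exact: hx. Qed.

Lemma interface_endpoints j : (1 <= j <= N)%N -> (x j.-1 <= x j.-1 <= x j) /\ (x j.-1 <= x j <= x j).
Proof. by move=> /interface_lt/ltW h; rewrite !lexx h. Qed.

Lemma dirichlet_right k j n s : (1 <= j <= N)%N -> mode_laplace (u k.+1 j) n s (x j) = interface_lap k j n s.
Proof.
move=> jN; have [_ _ h] := nnwr_dirichlet hg k jN.
by apply: eq_laplace => t t0; exact: sin_coef_interface h t0.
Qed.

Lemma dirichlet_left k j n s : (1 <= j <= N)%N -> mode_laplace (u k.+1 j) n s (x j.-1) = interface_lap k j.-1 n s.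
Proof.
move=> jN; have [_ h _] := nnwr_dirichlet hg k jN.
by apply: eq_laplace => t t0; exact: sin_coef_interface h t0.
Qed.

Lemma interface_mode_physical k n t : interface_mode k 0 n t = 0 /\ interface_mode k N n t = 0.
Proof.
split; rewrite /interface_mode; under [X in sin_coef X]eq_fun do
  rewrite ?(nnwr_physical hg k _ _).1 ?(nnwr_physical hg k _ _).2; exact: sin_coef0.
Qed.

Lemma interface_lap_physical k n s : interface_lap k 0 n s = 0 /\ interface_lap k N n s = 0.
Proof.
by split; rewrite -[RHS](laplace0 s); apply: eq_laplace => t _;
  have [h1 h2] := interface_mode_physical k n t.
Qed.

(** The regularity of [g k] comes not from the update but from the Dirichlet problem that has [g k]
    as boundary value. *)
Lemma interface_has_laplace k i n : (i <= N)%N -> (0 < n)%N ->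
  has_laplace (interface_mode k i n) (interface_lap k i n).
Proof.
move=> iN n0; case: (posnP i) => [->|i0].
  apply: nearW => s; split => //; apply: eq_laplace_integrable (laplace_integrable0 s) => t _.
  by have [-> _] := interface_mode_physical k n t.
have iN' : (1 <= i <= N)%N by rewrite i0.
have [hs _ hi] := nnwr_dirichlet hg k iN'; near=> s; split => //.
have : laplace_integrable (mode (u k.+1 i) n (x i)) s.
  by near: s; apply: heat_laplace_integrable hs _ n0; exact: (interface_endpoints iN').2.
by apply: eq_laplace_integrable => t t0; exact: sin_coef_interface hi t0.
Unshelve. all: by end_near. Qed.

Lemma interface_square_integrable k i : (1 <= i < N)%N ->
  {ae mu, forall t, 0 < t -> square_integrable (fun y => g k i y t)}.
Proof.
move=> /andP[i1 iN]; have iN' : (1 <= i <= N)%N by rewrite i1 ltnW.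
have [hs _ hi] := nnwr_dirichlet hg k iN'.
apply: ae_imply (heat_square_integrable hs (interface_endpoints iN').2) => t h t0.
apply: eq_square_integrable (h t0) => y; rewrite /= in_itv/= => y0; exact: hi.
Qed.

(** One-sided derivatives are unique, so the fluxes prescribed for [psi] equal those given by the
    Dirichlet-to-Neumann maps; the common factor [sqrt z] drops out. *)
Lemma neumann_relation k i n : (1 <= i < N)%N -> (0 < n)%N -> \forall s \near +oo,
  let z := s + n%:R ^+ 2 in
  let Psi j := mode_laplace (psi k.+1 j) n s in
  (1 + 2 * coth_sym (width i) z) * Psi i (x i) - 2 * csch_sym (width i) z * Psi i (x i.-1)
    = flux_jump k i n s /\
  (1 + 2 * coth_sym (width i.+1) z) * Psi i.+1 (x i) - 2 * csch_sym (width i.+1) z * Psi i.+1 (x i.+1)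
    = flux_jump k i n s.
Proof.
move=> iN n0; have [i1 iN1] := andP iN.
have j1 : (1 <= i <= N)%N by rewrite i1 ltnW.
have j2 : (1 <= i.+1 <= N)%N by [].
have [hpsi hflux _ _] := nnwr_neumann hg k.
have [hu1 _ _] := nnwr_dirichlet hg k j1; have [hu2 _ _] := nnwr_dirichlet hg k j2.
have n1 := heat_normal_derive (interface_lt j1) hu1 n0.
have n2 := heat_normal_derive (interface_lt j2) hu2 n0.
have n3 := heat_normal_derive (interface_lt j1) (hpsi _ j1) n0.
have n4 := heat_normal_derive (interface_lt j2) (hpsi _ j2) n0.
have nf := hflux i n iN n0.
have [s1 _ H1] := near_pinfty_ge n1; have [s2 _ H2] := near_pinfty_ge n2.
have [s3 _ H3] := near_pinfty_ge n3; have [s4 _ H4] := near_pinfty_ge n4.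
have [s5 _ H5] := near_pinfty_ge nf.
have ge (r : R) : \forall s \near +oo, r <= s by apply: nbhs_pinfty_ge; exact: num_real.
near=> s; set z := s + n%:R ^+ 2.
have s0 : 0 < s by near: s; apply: nbhs_pinfty_gt; exact: num_real.
have w0 : Num.sqrt z != 0 by rewrite gt_eqF// sqrtr_gt0 ltr_wpDr ?sqr_ge0.
have [h1 h2 h3] : [/\ s1 <= s, s2 <= s & s3 <= s] by split; near: s; exact: ge.
have [h4 h5] : s4 <= s /\ s5 <= s by split; near: s; exact: ge.
have [m1 _] : _ /\ _ := H1 s h1.
have [_ m2] : _ /\ _ := H2 s h2.
have [m3 _] : _ /\ _ := H3 s h3.
have [_ m4] : _ /\ _ := H4 s h4.
have [dl [dr [f1 f2 f3 f4]]] := H5 s h5.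
rewrite (dirichlet_right k n s j1) (dirichlet_left k n s j1) in m1.
rewrite (dirichlet_right k n s j2) (dirichlet_left k n s j2) in m2.
have e1 := is_normal_derive_uniq f1 m1; have e2 := is_normal_derive_uniq f2 m2.
have e3 := is_normal_derive_uniq m3 f3; have e4 := is_normal_derive_uniq m4 f4.
have ed : dl + dr = Num.sqrt z * flux_jump k i n s by rewrite e1 e2 -mulrDr.
by split; apply: (mulfI w0); rewrite -ed; [exact: e3|exact: e4].
Unshelve. all: by end_near. Qed.

Lemma neumann_physical_left k n s : (1 <= N)%N -> mode_laplace (psi k.+1 1%N) n s (x 0%N) = 0.
Proof.
move=> N1; have [_ _ h _] := nnwr_neumann hg k; rewrite -[RHS](laplace0 s).
by apply: eq_laplace => t t0; rewrite /mode (sin_coef_interface n h t0); exact: sin_coef0.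
Qed.

Lemma neumann_physical_right k n s : mode_laplace (psi k.+1 N) n s (x N) = 0.
Proof.
have [_ _ _ h] := nnwr_neumann hg k; rewrite -[RHS](laplace0 s).
by apply: eq_laplace => t t0; rewrite /mode (sin_coef_interface n h t0); exact: sin_coef0.
Qed.

(** The update is pointwise, but sine coefficients are linear only on square-integrable functions,
    which the solutions are for almost every [t]; equality almost everywhere is enough for the
    transforms. *)
Lemma update_relation k i n : (1 <= i < N)%N -> (0 < n)%N -> \forall s \near +oo,
  interface_lap k.+1 i n s = interface_lap k i n s -
   1 / 4 * (mode_laplace (psi k.+1 i) n s (x i) + mode_laplace (psi k.+1 i.+1) n s (x i)).
Proof.
move=> iN n0; have [i1 iN1] := andP iN.
have j1 : (1 <= i <= N)%N by rewrite i1 ltnW.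
have j2 : (1 <= i.+1 <= N)%N by [].
have [hpsi _ _ _] := nnwr_neumann hg k.
have l1 := heat_laplace_integrable (hpsi _ j1) (interface_endpoints j1).2 n0.
have l2 := heat_laplace_integrable (hpsi _ j2) (interface_endpoints j2).1 n0.
have l3 := interface_has_laplace k (ltnW iN1) n0.
have l4 := interface_has_laplace k.+1 (ltnW iN1) n0.
have p1 : has_laplace (mode (psi k.+1 i) n (x i)) (fun s => mode_laplace (psi k.+1 i) n s (x i)).
  by near=> s; split => //; near: s.
have p2 : has_laplace (mode (psi k.+1 i.+1) n (x i)) (fun s => mode_laplace (psi k.+1 i.+1) n s (x i)).
  by near=> s; split => //; near: s.
have [s1 _ H1] := near_pinfty_ge (has_laplaceD l3 (has_laplaceZ (- (1 / 4)) (has_laplaceD p1 p2))).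
have [s2 _ H2] := near_pinfty_ge l4.
have ge (r : R) : \forall s \near +oo, r <= s by apply: nbhs_pinfty_ge; exact: num_real.
near=> s.
have [h1 h2] : s1 <= s /\ s2 <= s by split; near: s; exact: ge.
have [i2 e2] := H1 s h1.
have [i4 _] := H2 s h2.
rewrite /interface_lap -mulNr -e2; apply: (ae_eq_laplace i4 i2).
have q0 := interface_square_integrable k iN.
have q1 := heat_square_integrable (hpsi _ j1) (interface_endpoints j1).2.
have q2 := heat_square_integrable (hpsi _ j2) (interface_endpoints j2).1.
apply: ae_imply (ae_and q0 (ae_and q1 q2)) => t [a0 [a1 a2]] t0.
rewrite /interface_mode (sin_coef_interface n (nnwr_update hg k iN) t0).
have a12 := square_integrableD (a1 t0) (a2 t0).
rewrite /mode -sin_coefD//; [|exact: a1|exact: a2].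
rewrite -sin_coefZ// -sin_coefD//; [|exact: a0|exact: square_integrableZ].
by congr sin_coef; apply/funext => y; rewrite mulNr.
Unshelve. all: by end_near. Qed.

End Relations.

(** * Algebra of one iteration step *)

Section RowIdentities.
Context {R : realType}.
Implicit Types (P Q S W G : R).

(* The hypotheses [S ^ 2 = P + P ^ 2] and [(1 - 2 Q) (1 + 2 P) = 1] of this section
   are [coth ^ 2 - 1 / sinh ^ 2 = 1] and [tanh * coth = 1]; [Q = P - 2 X] is the
   duplication formula for [tanh]. *)
Lemma neumann_solve P S W W' A A' : S ^+ 2 = P + P ^+ 2 ->
  (1 + 2 * P) * W - 2 * S * W' = A -> (1 + 2 * P) * W' - 2 * S * W = A' ->
  W = (1 + 2 * P) * A + 2 * S * A'.
Proof.
(* Cramer's rule: the determinant [(1 + 2 P) ^ 2 - (2 S) ^ 2] is 1. *)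
move=> e <- <-; have -> : (1 + 2 * P) * ((1 + 2 * P) * W - 2 * S * W') +
  2 * S * ((1 + 2 * P) * W' - 2 * S * W) = (1 + 4 * (P + P ^+ 2 - S ^+ 2)) * W by ring.
by rewrite e subrr mulr0 addr0 mul1r.
Qed.

Lemma dirichlet_solve P Q S W W' A : (1 - 2 * Q) * (1 + 2 * P) = 1 -> W' = 0 ->
  (1 + 2 * P) * W - 2 * S * W' = A -> W = (1 - 2 * Q) * A.
Proof. by move=> e -> <-; rewrite mulr0 subr0 mulrA e mul1r. Qed.

(** [G2] sits between subdomains 1 and 2. Its constant terms add up to 4, which [1 / 4] cancels. In
    the coefficient of a neighbour the Dirichlet and Neumann contributions have opposite signs,
    leaving only differences of [coth] symbols of two subdomains that are two apart. *)
Lemma interior_row P0 P1 P2 P3 S0 S1 S2 S3 G0 G1 G2 G3 G4 :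
  S1 ^+ 2 = P1 + P1 ^+ 2 -> S2 ^+ 2 = P2 + P2 ^+ 2 ->
  let A1 := ((1 + 2 * P0) * G1 - 2 * S0 * G0) + ((1 + 2 * P1) * G1 - 2 * S1 * G2) in
  let A2 := ((1 + 2 * P1) * G2 - 2 * S1 * G1) + ((1 + 2 * P2) * G2 - 2 * S2 * G3) in
  let A3 := ((1 + 2 * P2) * G3 - 2 * S2 * G2) + ((1 + 2 * P3) * G3 - 2 * S3 * G4) in
  G2 - 1 / 4 * (((1 + 2 * P1) * A2 + 2 * S1 * A1) + ((1 + 2 * P2) * A2 + 2 * S2 * A3)) =
  (- (P1 * G2) + - (P2 * G2)) + (- (P1 * (P2 * G2)) + - (P1 * (P2 * G2))) +
  (- (S1 * ((P0 - P2) * G1)) + - (S2 * ((P3 - P1) * G3))) +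
  (S1 * (S0 * G0) + S2 * (S3 * G4)).
Proof.
move=> e1 e2 /=; apply/eqP; rewrite -subr_eq0; apply/eqP.
transitivity (G2 * ((S1 ^+ 2 - (P1 + P1 ^+ 2)) + (S2 ^+ 2 - (P2 + P2 ^+ 2)))); first by field.
by rewrite e1 e2 !subrr addr0 mulr0.
Qed.

(** [P] belongs to the end subdomain, where the physical Dirichlet condition replaces the two-by-two
    inversion by [tanh]. Only [P - Q = 2 X] enters the diagonal; the coefficient of the neighbour is
    now a sum, [P2 + Q]. *)
Lemma boundary_row P Q X P1 P2 S1 S2 G1 G2 G3 :
  S1 ^+ 2 = P1 + P1 ^+ 2 -> Q = P - 2 * X -> (1 - 2 * Q) * (1 + 2 * P) = 1 ->
  let A1 := (1 + 2 * P) * G1 + ((1 + 2 * P1) * G1 - 2 * S1 * G2) in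
  let A2 := ((1 + 2 * P1) * G2 - 2 * S1 * G1) + ((1 + 2 * P2) * G2 - 2 * S2 * G3) in
  G1 - 1 / 4 * ((1 - 2 * Q) * A1 + ((1 + 2 * P1) * A1 + 2 * S1 * A2)) =
  (- (X * G1) + - (P1 * G1)) + (- (X * (P1 * G1)) + - (X * (P1 * G1))) +
  - (S1 * ((P2 + Q) * G2)) + S1 * (S2 * G3).
Proof.
move=> e1 -> e2 /=; apply/eqP; rewrite -subr_eq0; apply/eqP.
transitivity (G1 * ((S1 ^+ 2 - (P1 + P1 ^+ 2)) - (1 - (1 - 2 * (P - 2 * X)) * (1 + 2 * P)) * - (1 / 4))); first by field.
by rewrite e1 e2 !subrr mul0r subr0 mulr0.
Qed.

Lemma boundary_row_mirror P Q X P1 P2 S1 S2 G1 G2 G3 :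
  S1 ^+ 2 = P1 + P1 ^+ 2 -> Q = P - 2 * X -> (1 - 2 * Q) * (1 + 2 * P) = 1 ->
  let A1 := (1 + 2 * P) * G1 + ((1 + 2 * P1) * G1 - 2 * S1 * G2) in
  let A2 := ((1 + 2 * P1) * G2 - 2 * S1 * G1) + ((1 + 2 * P2) * G2 - 2 * S2 * G3) in
  G1 - 1 / 4 * (((1 + 2 * P1) * A1 + 2 * S1 * A2) + (1 - 2 * Q) * A1) =
  (- (X * G1) + - (P1 * G1)) + (- (X * (P1 * G1)) + - (X * (P1 * G1))) +
  - (S1 * ((P2 + Q) * G2)) + S1 * (S2 * G3).
Proof. by move=> e1 e2 e3 A1 A2; rewrite [X in 1 / 4 * X]addrC; exact: boundary_row. Qed.

Lemma subrM0 (a b c d : R) : d = 0 -> a - b * d + c = a + c.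
Proof. by move=> ->; rewrite mulr0 subr0. Qed.

(** Both subdomains touch the physical boundary, so [tanh] occurs on both sides; to first order
    again only [P - Q] and [P' - Q'] survive. *)
Lemma two_subdomains_row P Q X P' Q' X' G :
  Q = P - 2 * X -> (1 - 2 * Q) * (1 + 2 * P) = 1 ->
  Q' = P' - 2 * X' -> (1 - 2 * Q') * (1 + 2 * P') = 1 ->
  let A := (1 + 2 * P) * G + (1 + 2 * P') * G in
  G - 1 / 4 * ((1 - 2 * Q) * A + (1 - 2 * Q') * A) =
  (- (X * G) + - (X' * G)) + (Q * (P' * G) + Q' * (P * G)).
Proof.
move=> -> e -> e' /=; apply/eqP; rewrite -subr_eq0; apply/eqP.
transitivity (1 / 4 * G * ((1 - (1 - 2 * (P - 2 * X)) * (1 + 2 * P)) + (1 - (1 - 2 * (P' - 2 * X')) * (1 + 2 * P')))); first by field.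
by rewrite e e' !subrr addr0 mulr0.
Qed.

End RowIdentities.

Section OneStep.
Context {R : realType} (N : nat) (x : nat -> R) (T : R).
Context (u psi : nat -> nat -> R -> R -> R -> R) (g : nat -> nat -> R -> R -> R).
Context (hN : (2 <= N)%N) (hx : forall i, (i < N)%N -> x i < x i.+1).
Context (hg : nnwr (1 / 4) N x T u psi g).
Context (m : nat) (s0 h de : R) (s00 : 0 < s0) (h0 : 0 < h) (de1 : 1 <= de).
Context (hw : forall j, (1 <= j <= N)%N -> h <= width x j).
Context (hD : forall a b, h <= a -> h <= b ->
  kernel_bound T s0 (fun s => coth_sym a s - coth_sym b s) (de * coth_sym h s0)).
Local Notation p := (coth_sym h s0).
Local Notation q := (csch_sym h s0).
Local Notation G k j := (interface_lap g k j).
Local Notation bounded := (l2_bounded m T s0).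

(* The sum of the absolute values of the coefficients of [interior_row] at [s0],
   all widths being replaced by the least one; it also dominates the other rows. *)
Definition step_rate : R := 2 * p + 2 * p ^+ 2 + 2 * (q * (de * p)) + 2 * q ^+ 2.

Lemma coth_rate_ge0 : 0 <= p. Proof. exact: coth_sym_ge0. Qed.
Lemma csch_rate_ge0 : 0 <= q. Proof. exact: csch_sym_ge0. Qed.

Lemma de_ge0 : 0 <= de. Proof. exact: le_trans de1. Qed.
Lemma cross_rate_ge0 : 0 <= q * (de * p).
Proof. exact: mulr_ge0 csch_rate_ge0 (mulr_ge0 de_ge0 coth_rate_ge0). Qed.

Lemma step_rate_ge0 : 0 <= step_rate.
Proof.
have a := coth_rate_ge0; have b := cross_rate_ge0; have c := sqr_ge0 p; have d := sqr_ge0 q.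
by rewrite /step_rate; lra.
Qed.

Lemma width_gt0 j : (1 <= j <= N)%N -> 0 < width x j.
Proof. by move=> /hw; exact: lt_le_trans. Qed.

Lemma near_pinfty_eq (P Q : R -> Prop) : (\forall s \near +oo, P s) ->
  (forall s, 0 < s -> P s -> Q s) -> \forall s \near +oo, Q s.
Proof.
move=> hP PQ; near=> s; apply: PQ; last by near: s.
by near: s; apply: nbhs_pinfty_gt; exact: num_real.
Unshelve. all: by end_near. Qed.

Lemma flux_jumpC k i n s : flux_jump x g k i n s =
  ((1 + 2 * coth_sym (width x i.+1) (s + n%:R ^+ 2)) * G k i n s -
    2 * csch_sym (width x i.+1) (s + n%:R ^+ 2) * G k i.+1 n s) +
  ((1 + 2 * coth_sym (width x i) (s + n%:R ^+ 2)) * G k i n s -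
    2 * csch_sym (width x i) (s + n%:R ^+ 2) * G k i.-1 n s).
Proof. exact: addrC. Qed.

Lemma flux_jump_first k n s : flux_jump x g k 1 n s =
  (1 + 2 * coth_sym (width x 1) (s + n%:R ^+ 2)) * G k 1 n s +
  ((1 + 2 * coth_sym (width x 2) (s + n%:R ^+ 2)) * G k 1 n s -
    2 * csch_sym (width x 2) (s + n%:R ^+ 2) * G k 2 n s).
Proof. exact: subrM0 (interface_lap_physical hg k n s).1. Qed.

Lemma flux_jump_last k n s i : N = i.+1 -> flux_jump x g k i n s =
  (1 + 2 * coth_sym (width x i.+1) (s + n%:R ^+ 2)) * G k i n s +
  ((1 + 2 * coth_sym (width x i) (s + n%:R ^+ 2)) * G k i n s -
    2 * csch_sym (width x i) (s + n%:R ^+ 2) * G k i.-1 n s).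
Proof.
move=> Ni; have GN := (interface_lap_physical hg k n s).2; rewrite Ni in GN.
by rewrite flux_jumpC; exact: subrM0 GN.
Qed.

Section Rows.
Context (k : nat) (B : R) (B0 : 0 <= B) (hB : forall j, (j <= N)%N -> bounded B (G k j)).

Let kP j (jN : (1 <= j <= N)%N) := kernel_bound_coth T s00 h0 (hw jN).
Let kS j (jN : (1 <= j <= N)%N) := kernel_bound_csch T s00 h0 (hw jN).
Let kQ j (jN : (1 <= j <= N)%N) := kernel_bound_tanh T s00 h0 (hw jN).
Let kX j (jN : (1 <= j <= N)%N) : kernel_bound T s0 (coth_sym (2 * width x j)) p.
Proof.
apply: kernel_bound_coth => //; apply: (le_trans (hw jN)).
by rewrite ler_peMl ?ler1n// ltW// width_gt0.
Qed.
Let pB0 : 0 <= p * B. Proof. by rewrite mulr_ge0// coth_rate_ge0. Qed.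
Let qB0 : 0 <= q * B. Proof. by rewrite mulr_ge0// csch_rate_ge0. Qed.
Let ppB0 : 0 <= (p + p) * B. Proof. by rewrite mulr_ge0// addr_ge0// coth_rate_ge0. Qed.
Let dpB0 : 0 <= (de * p) * B.
Proof. exact: mulr_ge0 (mulr_ge0 de_ge0 coth_rate_ge0) B0. Qed.

(** The excess of [step_rate] over the end rows: they have one neighbour term [q (p + p)] against
    [2 q (de p)], and one term [q ^ 2] against two. *)
Let slack : 0 <= 2 * (q * ((de - 1) * p)) * B + q ^+ 2 * B.
Proof.
have d0 : 0 <= de - 1 by rewrite subr_ge0.
have a := mulr_ge0 (mulr_ge0 csch_rate_ge0 (mulr_ge0 d0 coth_rate_ge0)) B0.
have b := mulr_ge0 (sqr_ge0 q) B0.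
by apply: addr_ge0 => //; rewrite -mulrA mulr_ge0.
Qed.

Lemma bounded_interior i : (i.+3 < N)%N -> bounded (step_rate * B) (G k.+1 i.+2).
Proof.
move=> iN.
have le j : (j <= 4)%N -> (j + i <= N)%N by move=> j4; exact: leq_trans (leq_add j4 (leqnn i)) iN.
have j1 : (1 <= i.+1 <= N)%N := le 1%N isT.
have j2 : (1 <= i.+2 <= N)%N := le 2%N isT.
have j3 : (1 <= i.+3 <= N)%N := le 3%N isT.
have j4 : (1 <= i.+4 <= N)%N := le 4%N isT.
have g0 := hB (le 0%N isT : (i <= N)%N).
have g1 := hB (le 1%N isT : (i.+1 <= N)%N).
have g2 := hB (le 2%N isT : (i.+2 <= N)%N).
have g3 := hB (le 3%N isT : (i.+3 <= N)%N).
have g4 := hB (le 4%N isT : (i.+4 <= N)%N).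
(* [t1] to [t7] bound the summands of [interior_row], added below in the grouping of that identity,
   with [t3] twice. *)
have t1 := l2_boundedN (l2_bounded_kernel B0 (kP j2) g2).
have t2 := l2_boundedN (l2_bounded_kernel B0 (kP j3) g2).
have t3 := l2_boundedN (l2_bounded_kernel pB0 (kP j2) (l2_bounded_kernel B0 (kP j3) g2)).
have t4 := l2_boundedN (l2_bounded_kernel dpB0 (kS j2) (l2_bounded_kernel B0 (hD (hw j1) (hw j3)) g1)).
have t5 := l2_boundedN (l2_bounded_kernel dpB0 (kS j3) (l2_bounded_kernel B0 (hD (hw j4) (hw j2)) g3)).
have t6 := l2_bounded_kernel qB0 (kS j2) (l2_bounded_kernel B0 (kS j1) g0).
have t7 := l2_bounded_kernel qB0 (kS j3) (l2_bounded_kernel B0 (kS j4) g4).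
have t := l2_boundedD (l2_boundedD (l2_boundedD (l2_boundedD t1 t2) (l2_boundedD t3 t3)) (l2_boundedD t4 t5)) (l2_boundedD t6 t7).
apply: l2_bounded_le (l2_bounded_eq _ t) _; last by rewrite /step_rate le_eqVlt; apply/orP; left; apply/eqP; ring.
move=> n n0.
apply: near_pinfty_eq (filterI (neumann_relation hx hg k (le 2%N isT : (1 <= i.+1 < N)%N) n0)
  (filterI (neumann_relation hx hg k (le 3%N isT : (1 <= i.+2 < N)%N) n0)
  (filterI (neumann_relation hx hg k (le 4%N isT : (1 <= i.+3 < N)%N) n0)
   (update_relation hx hg k (le 3%N isT : (1 <= i.+2 < N)%N) n0)))) _.
move=> s sp [[_ e1] [[e2 e3] [[e4 _] ->]]].
have z0 : 0 < s + n%:R ^+ 2 by rewrite ltr_wpDr ?sqr_ge0.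
have c2 := csch_sym_sqr (width_gt0 j2) z0; have c3 := csch_sym_sqr (width_gt0 j3) z0.
rewrite (neumann_solve c2 e2 e1) (neumann_solve c3 e3 e4).
by symmetry; exact: interior_row.
Qed.

Lemma bounded_first : (2 < N)%N -> bounded (step_rate * B) (G k.+1 1).
Proof.
move=> N2.
have le j : (j <= 3)%N -> (j <= N)%N by move=> j3; exact: leq_trans j3 N2.
have j1 : (1 <= 1 <= N)%N := le 1%N isT.
have j2 : (1 <= 2 <= N)%N := le 2%N isT.
have j3 : (1 <= 3 <= N)%N := le 3%N isT.
have g1 := hB (le 1%N isT : (1 <= N)%N).
have g2 := hB (le 2%N isT : (2 <= N)%N).
have g3 := hB (le 3%N isT : (3 <= N)%N).
have t1 := l2_boundedN (l2_bounded_kernel B0 (kX j1) g1).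
have t2 := l2_boundedN (l2_bounded_kernel B0 (kP j2) g1).
have t3 := l2_boundedN (l2_bounded_kernel pB0 (kX j1) (l2_bounded_kernel B0 (kP j2) g1)).
have t4 := l2_boundedN (l2_bounded_kernel ppB0 (kS j2) (l2_bounded_kernel B0 (kernel_boundD (kP j3) (kQ j1)) g2)).
have t5 := l2_bounded_kernel qB0 (kS j2) (l2_bounded_kernel B0 (kS j3) g3).
have t := l2_boundedD (l2_boundedD (l2_boundedD (l2_boundedD t1 t2) (l2_boundedD t3 t3)) t4) t5.
apply: l2_bounded_le (l2_bounded_eq _ t) _; last first.
  by rewrite -subr_ge0 (le_trans slack)// le_eqVlt; apply/orP; left; apply/eqP; rewrite /step_rate; ring.
move=> n n0.
apply: near_pinfty_eq (filterI (neumann_relation hx hg k (le 2%N isT : (1 <= 1 < N)%N) n0)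
  (filterI (neumann_relation hx hg k (le 3%N isT : (1 <= 2 < N)%N) n0)
   (update_relation hx hg k (le 2%N isT : (1 <= 1 < N)%N) n0))) _.
move=> s sp [[e1 e2] [[e3 _] ->]].
have z0 : 0 < s + n%:R ^+ 2 by rewrite ltr_wpDr ?sqr_ge0.
have c2 := csch_sym_sqr (width_gt0 j2) z0; have c1 := tanh_coth_sym (width_gt0 j1) z0.
have l0 := neumann_physical_left hg k n s (ltnW hN).
rewrite (dirichlet_solve c1 l0 e1) (neumann_solve c2 e2 e3).
rewrite (flux_jump_first k n s).
by symmetry; exact: boundary_row.
Qed.

Lemma bounded_last i : N = i.+3 -> bounded (step_rate * B) (G k.+1 i.+2).
Proof.
move=> Ni.
have le j : (j <= 3)%N -> (j + i <= N)%N by move=> j3; rewrite Ni; exact: leq_add j3 (leqnn i).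
have j1 : (1 <= i.+1 <= N)%N := le 1%N isT.
have j2 : (1 <= i.+2 <= N)%N := le 2%N isT.
have j3 : (1 <= i.+3 <= N)%N := le 3%N isT.
(* Numbered from the physical boundary inwards, as in [boundary_row]: the last interface comes
   first. *)
have g1 := hB (le 2%N isT : (i.+2 <= N)%N).
have g2 := hB (le 1%N isT : (i.+1 <= N)%N).
have g3 := hB (le 0%N isT : (i <= N)%N).
have t1 := l2_boundedN (l2_bounded_kernel B0 (kX j3) g1).
have t2 := l2_boundedN (l2_bounded_kernel B0 (kP j2) g1).
have t3 := l2_boundedN (l2_bounded_kernel pB0 (kX j3) (l2_bounded_kernel B0 (kP j2) g1)).
have t4 := l2_boundedN (l2_bounded_kernel ppB0 (kS j2) (l2_bounded_kernel B0 (kernel_boundD (kP j1) (kQ j3)) g2)).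
have t5 := l2_bounded_kernel qB0 (kS j2) (l2_bounded_kernel B0 (kS j1) g3).
have t := l2_boundedD (l2_boundedD (l2_boundedD (l2_boundedD t1 t2) (l2_boundedD t3 t3)) t4) t5.
apply: l2_bounded_le (l2_bounded_eq _ t) _; last first.
  by rewrite -subr_ge0 (le_trans slack)// le_eqVlt; apply/orP; left; apply/eqP; rewrite /step_rate; ring.
move=> n n0.
apply: near_pinfty_eq (filterI (neumann_relation hx hg k (le 2%N isT : (1 <= i.+1 < N)%N) n0)
  (filterI (neumann_relation hx hg k (le 3%N isT : (1 <= i.+2 < N)%N) n0)
   (update_relation hx hg k (le 3%N isT : (1 <= i.+2 < N)%N) n0))) _.
move=> s sp [[_ e2] [[e3 e1] ->]].
have z0 : 0 < s + n%:R ^+ 2 by rewrite ltr_wpDr ?sqr_ge0.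
have c2 := csch_sym_sqr (width_gt0 j2) z0; have c1 := tanh_coth_sym (width_gt0 j3) z0.
have l0 := neumann_physical_right hg k n s; rewrite Ni in l0.
rewrite (neumann_solve c2 e3 e2) (dirichlet_solve c1 l0 e1).
rewrite (flux_jump_last k n s Ni) (flux_jumpC k i.+1 n s).
by symmetry; exact: boundary_row_mirror.
Qed.

Lemma bounded_two_subdomains : N = 2%N -> bounded (step_rate * B) (G k.+1 1).
Proof.
move=> N2.
have le j : (j <= 2)%N -> (j <= N)%N by rewrite N2.
have j1 : (1 <= 1 <= N)%N := le 1%N isT.
have j2 : (1 <= 2 <= N)%N := le 2%N isT.
have g1 := hB (le 1%N isT : (1 <= N)%N).
have t1 := l2_boundedN (l2_bounded_kernel B0 (kX j1) g1).
have t2 := l2_boundedN (l2_bounded_kernel B0 (kX j2) g1).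
have t3 := l2_bounded_kernel pB0 (kQ j1) (l2_bounded_kernel B0 (kP j2) g1).
have t4 := l2_bounded_kernel pB0 (kQ j2) (l2_bounded_kernel B0 (kP j1) g1).
have t := l2_boundedD (l2_boundedD t1 t2) (l2_boundedD t3 t4).
apply: l2_bounded_le (l2_bounded_eq _ t) _; last first.
  have a1 : 0 <= 2 * (q * (de * p)) * B by rewrite -mulrA mulr_ge0// mulr_ge0// cross_rate_ge0.
  have a2 : 0 <= 2 * q ^+ 2 * B by rewrite -mulrA mulr_ge0// mulr_ge0// sqr_ge0.
  by rewrite -subr_ge0 (le_trans (addr_ge0 a1 a2))// le_eqVlt; apply/orP; left; apply/eqP; rewrite /step_rate; ring.
move=> n n0.
apply: near_pinfty_eq (filterI (neumann_relation hx hg k (le 2%N isT : (1 <= 1 < N)%N) n0)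
   (update_relation hx hg k (le 2%N isT : (1 <= 1 < N)%N) n0)) _.
move=> s sp [[e1 e2] ->].
have z0 : 0 < s + n%:R ^+ 2 by rewrite ltr_wpDr ?sqr_ge0.
have c1 := tanh_coth_sym (width_gt0 j1) z0; have c2 := tanh_coth_sym (width_gt0 j2) z0.
have l0 := neumann_physical_left hg k n s (ltnW hN); have r0 := neumann_physical_right hg k n s; rewrite N2 in r0.
rewrite (dirichlet_solve c1 l0 e1) (dirichlet_solve c2 r0 e2).
have GN := (interface_lap_physical hg k n s).2; rewrite N2 in GN.
rewrite (flux_jump_first k n s).
have E (a b c : R) : a + (b - c * G k 2 n s) = a + b by rewrite GN mulr0 subr0.
rewrite E.
by symmetry; exact: two_subdomains_row.
Qed.

Lemma bounded_step i : (i <= N)%N -> bounded (step_rate * B) (G k.+1 i).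
Proof.
move=> iN.
have r0 : 0 <= step_rate * B := mulr_ge0 step_rate_ge0 B0.
have zero j : (forall n s, G k.+1 j n s = 0) -> bounded (step_rate * B) (G k.+1 j).
  move=> e; apply: l2_bounded_eq (l2_bounded0 m T s0 r0) => n _.
  by apply: nearW => s; rewrite e.
case: i iN => [|[|i]] iN.
- by apply: zero => n s; exact: (interface_lap_physical hg k.+1 n s).1.
- have [N2|N2] := eqVneq N 2%N; first exact: bounded_two_subdomains.
  by apply: bounded_first; rewrite ltn_neqAle eq_sym N2.
- have [iN'|iN'] := eqVneq i.+2 N.
    by apply: zero => n s; rewrite iN'; exact: (interface_lap_physical hg k.+1 n s).2.
  have [iN''|iN''] := eqVneq i.+3 N; first exact: bounded_last.
  by apply: bounded_interior; rewrite ltn_neqAle iN'' ltn_neqAle iN'.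
Qed.

End Rows.

Lemma bounded_iter k (B : R) : 0 <= B -> (forall j, (j <= N)%N -> bounded B (G 0%N j)) ->
  forall j, (j <= N)%N -> bounded (step_rate ^+ k * B) (G k j).
Proof.
move=> B0 hB; elim: k => [|k IH] j jN; first by rewrite expr0 mul1r; exact: hB.
rewrite exprS -mulrA; apply: bounded_step => //.
exact: mulr_ge0 (exprn_ge0 _ step_rate_ge0) B0.
Qed.

End OneStep.

(** * Assembly of the estimate *)

Section Assembly.
Context {R : realType}.
Local Notation mu := (@lebesgue_measure R).

(** Since [p + p ^ 2 = q ^ 2], the rate is [4 q ^ 2 + 2 de q p], where [q = E / (1 - E ^ 2)] and
    [p = E q]. *)
Lemma step_rateE (s h de : R) : 0 < s -> 0 < h ->
  step_rate s h de = contraction (2 * de) (expR (- (h * Num.sqrt s))).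
Proof.
move=> s0 h0; rewrite /step_rate /contraction /coth_sym /csch_sym.
have [-> e1] := expR_double_lt1 h0 s0.
by field; rewrite subr_eq0 gt_eqF.
Qed.

Lemma hmin_le N (x : nat -> R) j : (1 <= j <= N)%N -> hmin N x <= width x j.
Proof.
move=> /andP[j1 jN]; rewrite /hmin /width.
have : j \in index_iota 1 N.+1 by rewrite mem_index_iota j1.
elim: (index_iota 1 N.+1) => // a r IH; rewrite in_cons big_cons ge_min => /orP[/eqP ->|jr].
  by rewrite lexx.
by rewrite IH// orbT.
Qed.

Lemma hmin_gt0 N (x : nat -> R) : (1 <= N)%N -> (forall i, (i < N)%N -> x i < x i.+1) ->
  0 < hmin N x.
Proof.
move=> N1 hx; rewrite /hmin big_seq; apply: (big_ind (fun v => 0 < v)) => //.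
- by rewrite subr_gt0 hx.
- by move=> a b a0 b0; rewrite lt_min a0.
- move=> [|i]; rewrite mem_index_iota// => /andP[_ iN].
  by rewrite subr_gt0 hx.
Qed.

Lemma LinfL2norm_le_max_norm N T (g : nat -> R -> R -> R) i : (1 <= i < N)%N ->
  (LinfL2norm T (g i) <= max_norm N T g)%E.
Proof.
rewrite -mem_index_iota /max_norm.
elim: (index_iota 1 N) => // a r IH; rewrite in_cons big_cons le_max => /orP[/eqP ->|ir].
  by rewrite lexx.
by rewrite IH// orbT.
Qed.

Lemma max_norm_le N T (g : nat -> R -> R -> R) (C : \bar R) :
  (forall i, (1 <= i < N)%N -> (LinfL2norm T (g i) <= C)%E) -> (max_norm N T g <= C)%E.
Proof.
move=> h; rewrite /max_norm big_seq; apply: (big_ind (fun v => v <= C)%E) => //.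
- exact: leNye.
- by move=> a b a0 b0; rewrite ge_max a0.
- by move=> i; rewrite mem_index_iota; exact: h.
Qed.

Lemma max_norm_fin N T (g : nat -> R -> R -> R) : (2 <= N)%N ->
  (forall i, (1 <= i < N)%N -> (LinfL2norm T (g i) < +oo)%E) ->
  exists2 B : R, 0 <= B & max_norm N T g = B%:E.
Proof.
move=> N2 h.
have l : (max_norm N T g < +oo)%E.
  rewrite /max_norm big_seq; apply: (big_ind (fun v => v < +oo)%E) => //.
  - by move=> a b a0 b0; rewrite gt_max a0.
  - by move=> i; rewrite mem_index_iota; exact: h.
have ge : (0 <= max_norm N T g)%E.
  by apply: le_trans (@LinfL2norm_le_max_norm N T g 1 N2); exact: LinfL2norm_ge0.
have f : max_norm N T g \is a fin_num by rewrite ge0_fin_numE.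
exists (fine (max_norm N T g)); first exact: fine_ge0.
by rewrite fineK.
Qed.

(** [y] parametrizes the weight, and [de] is the cost of a difference of two [coth] kernels in units
    of one: 1 if [T <= 4 h ^ 2], and 2 otherwise, in the application. *)
Lemma nnwr_weighted_bound (N : nat) (x : nat -> R) (T : R)
    (u psi : nat -> nat -> R -> R -> R -> R) (g : nat -> nat -> R -> R -> R)
    (y de B : R) (k : nat) :
  (2 <= N)%N -> (forall i, (i < N)%N -> x i < x i.+1) -> 0 < T ->
  nnwr (1 / 4) N x T u psi g -> 0 < y -> 1 <= de -> 0 <= B ->
  max_norm N T (g 0%N) = B%:E ->
  (forall s a b, 0 < s -> hmin N x <= a -> hmin N x <= b ->
    kernel_bound T s (fun s => coth_sym a s - coth_sym b s) (de * coth_sym (hmin N x) s)) ->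
  (max_norm N T (g k) <= (expR (y ^+ 2 / (hmin N x ^+ 2 / T)) *
     contraction (2 * de) (expR (- y)) ^+ k * B)%:E)%E.
Proof.
move=> N2 hx T0 hg y0 de1 B0 g0B hD.
set h := hmin N x in hD *; have h0 : 0 < h := hmin_gt0 (ltnW N2) hx.
have hw j : (1 <= j <= N)%N -> h <= width x j by exact: hmin_le.
(* So that [E = exp (- y)] and the price [exp (s T)] of the weight is
   [exp (y ^ 2 / (h ^ 2 / T))]. *)
pose s := (y / h) ^+ 2; have s0 : 0 < s by rewrite exprn_gt0// divr_gt0.
have hs : h * Num.sqrt s = y.
  by rewrite sqrtr_sqr ger0_norm ?divr_ge0 ?ltW// mulrC divfK// gt_eqF.
have sT : s * T = y ^+ 2 / (h ^+ 2 / T).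
  by rewrite /s; field; rewrite !gt_eqF.
have r0 := step_rate_ge0 s0 h0 de1.
have rE := step_rateE de s0 h0; rewrite hs in rE; rewrite -rE -sT.
have C0 : 0 <= Num.sqrt (2 / pi) :> R by exact: sqrtr_ge0.
have base m j : (j <= N)%N -> l2_bounded m T s (Num.sqrt (2 / pi) * B) (interface_lap g 0 j).
  move=> jN; exists (interface_mode g 0 j); split.
    by move=> n n0; exact: (interface_has_laplace hx hg).
  have CB : 0 <= Num.sqrt (2 / pi) * B by exact: mulr_ge0.
  have zero : (j == 0%N) || (j == N) ->
      {ae mu, forall t, 0 < t < T -> l2 m (fun n => interface_mode g 0 j n t) <= Num.sqrt (2 / pi) * B * expR (s * t)}.
    move=> j0; apply: aeW => t _; rewrite /l2 big1 ?sqrtr0 ?mulr_ge0 ?expR_ge0// => n _.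
    have [z1 z2] := interface_mode_physical hg 0 n t.
    by case/orP : j0 => /eqP ->; rewrite ?z1 ?z2 expr0n.
  have [j0|j0] := eqVneq j 0%N; first by apply: zero; rewrite j0 eqxx.
  have [jN'|jN'] := eqVneq j N; first by apply: zero; rewrite jN' eqxx orbT.
  have jr : (1 <= j < N)%N by rewrite lt0n j0 ltn_neqAle jN'.
  have a1 := LinfL2norm_ae T (g 0%N j); have a2 := interface_square_integrable hx hg 0 jr.
  apply: ae_imply (ae_and a1 a2) => t [b1 b2] /[dup] tT /andP[t0 _].
  have b3 := le_trans (b1 tT) (LinfL2norm_le_max_norm T (g 0%N) jr); rewrite g0B in b3.
  apply: (le_trans (l2_sin_coef_le m B0 (b2 t0) b3)).
  (* The weight [exp (s t)] is at least 1, so an unweighted bound on the data is enough. *)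
  by rewrite ler_peMr// -expR0 ler_expR mulr_ge0 ?ltW.
apply: max_norm_le => i iN.
have CB : 0 <= expR (s * T) * step_rate s h de ^+ k * B.
  by rewrite !mulr_ge0 ?expR_ge0 ?exprn_ge0.
apply: LinfL2norm_le => //.
(* The null set must not depend on [m], as completeness uses all truncations at the same [t]. *)
have a1 : {ae mu, forall t, forall m, 0 < t < T ->
    l2 m (interface_mode g k i ^~ t) <= step_rate s h de ^+ k * (Num.sqrt (2 / pi) * B) * expR (s * t)}.
  apply/ae_foralln => m; have [i1 i2] := andP iN.
  have bd := bounded_iter N2 hx hg s0 h0 de1 hw (fun a b => hD s a b s0) k (mulr_ge0 C0 B0) (base m) (ltnW i2).
  apply: (l2_bounded_ae bd) => n n0; exact: (interface_has_laplace hx hg) (ltnW i2) n0.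
have a2 := interface_square_integrable hx hg k iN.
apply: ae_imply (ae_and a1 a2) => t [b1 b2] /[dup] tT /andP[t0 tT'].
apply: L2norm_le_sin_coef => //; first exact: b2.
move=> m; apply: (le_trans (b1 m tT)).
rewrite [leRHS](_ : _ = step_rate s h de ^+ k * (Num.sqrt (2 / pi) * B) * expR (s * T)); last by ring.
by rewrite ler_wpM2l ?mulr_ge0 ?exprn_ge0// ler_expR ler_pM2l// ltW.
Qed.

End Assembly.

Theorem theorem6p1 (R : realType) (N : nat) (l L : R) (x : nat -> R) (T : R)
    (u psi : nat -> nat -> R -> R -> R -> R) (g : nat -> nat -> R -> R -> R)
    (hN : (2 <= N)%N) (hl : x 0%N = l) (hL : x N = L)
    (hx : forall i, (i < N)%N -> x i < x i.+1)
    (hT : 0 < T)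
    (hg : nnwr (1 / 4) N x T u psi g)
    (k : nat) (hk : (1 <= k)%N) :
  (max_norm N T (g k) <=
   ((Num.sqrt 6 / (1 - expR (- ((2 * k%:R + 1) * hmin N x ^+ 2 / T))))
        ^+ (2 * k)
      * expR (- (k%:R ^+ 2 * hmin N x ^+ 2 / T)))%:E
   * max_norm N T (g 0%N))%E.
Proof.
have [B B0 g0B] := max_norm_fin hN (fun i iN => (nnwr_guess hg iN).2).
have h0 := hmin_gt0 (ltnW hN) hx; set h := hmin N x in h0 *.
rewrite g0B -EFinM -(mulrA (2 * k%:R + 1)) -(mulrA (k%:R ^+ 2)) -/(nnwr_factor k (h ^+ 2 / T)).
have x0 : 0 < h ^+ 2 / T by rewrite divr_gt0// exprn_gt0.
suff [y [de [y0 de1 yx hD]]] : exists y de, [/\ 0 < y, 1 <= de,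
    expR (y ^+ 2 / (h ^+ 2 / T)) * contraction (2 * de) (expR (- y)) ^+ k <= nnwr_factor k (h ^+ 2 / T) &
    forall s a b, 0 < s -> h <= a -> h <= b ->
    kernel_bound T s (fun s => coth_sym a s - coth_sym b s) (de * coth_sym h s)].
  apply: (le_trans (nnwr_weighted_bound k hN hx hT hg y0 de1 B0 g0B hD)).
  by rewrite lee_fin ler_wpM2r.
have [Th|Th] := leP T (4 * h ^+ 2).
  have [y kxy yx] := contraction_large_time hk x0.
  exists y, 1; split => //.
  - by apply: lt_le_trans kxy; rewrite mulr_gt0// ltr0n.
  - by rewrite mulr1.
  - by move=> s a b s0 ha hb; rewrite mul1r; exact: kernel_bound_coth_sub.
have [|y y0 yx] := contraction_small_time hk x0.
  by rewrite ler_pdivrMr//; lra.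
exists y, 2; split => //.
- by rewrite ler1n.
- by rewrite (_ : 2 * 2 = 4 :> R)//; rewrite -natrM.
- move=> s a b s0 ha hb; rewrite mulr_natl mulr2n.
  exact: kernel_boundD (kernel_bound_coth T s0 h0 ha) (kernel_boundN (kernel_bound_coth T s0 h0 hb)).
Qed.
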